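(* $\big(\mathrm{BARI}_{il}^{\mathrm{pol}},uri\big)$ is a Lie subalgebra of the Lie algebra $\big(\mathrm{BARI}_{il}^{\mathrm{rat}},uri\big)$. Here $\mathrm{BARI}_{il}^{\mathrm{pol}}$ and $\mathrm{BARI}_{il}^{\mathrm{rat}}$ are the spaces of alternil polynomial, respectively alternil rational, bimoulds.
   Context: **Bimoulds.** Fix a commutative $\mathbb{Q}$-algebra $R$. A bimould is a sequence $M=(M_d)_{d\ge 0}$, where $M_d=M_d\binom{u_1,\ldots,u_d}{v_1,\ldots,v_d}$ lies in $R[u_1,v_1,\ldots,u_d,v_d]$ (polynomial bimould) or in the ring of rational functions $R(u_1,v_1,\ldots,u_d,v_d)$ (rational bimould). The index $d$ is often omitted, $M(\emptyset)=M_0$, $w_i=\binom{u_i}{v_i}$ and $w=(w_1,\ldots,w_d)$. $\mathrm{BARI}^{\mathrm{pol}}$ is the space of polynomial bimoulds with $M_0=0$ and only finitely many nonzero components; $\mathrm{BARI}^{\mathrm{rat}}$ is the space of rational bimoulds with $M_0=0$. **Alternil.** Consider words in letters $\binom{a}{b}$, where $a,b$ are linear forms in the $u$- resp. $v$-variables, and define a product on linear combinations of words recursively by $1*x=x*1=x$ and, for letters $\binom{a}{b},\binom{a'}{b'}$ and words $x,y$, $$\tbinom{a}{b}x*\tbinom{a'}{b'}y=\tbinom{a}{b}\big(x*\tbinom{a'}{b'}y\big)+\tbinom{a'}{b'}\big(\tbinom{a}{b}x*y\big)+\tfrac{1}{b-b'}\Big(\tbinom{a+a'}{b}-\tbinom{a+a'}{b'}\Big)(x*y).$$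 Extend $M$ linearly (over rational functions) to linear combinations of words. $M$ (with $M_0=0$) is alternil if for all $0<n<d$ the value of $M$ on $w_1\cdots w_n*w_{n+1}\cdots w_d$ is $0$. For polynomial bimoulds, writing $M_d=\sum \varphi(y_{k_1,m_1}\cdots y_{k_d,m_d})\frac{u_1^{m_1}}{m_1!}v_1^{k_1-1}\cdots\frac{u_d^{m_d}}{m_d!}v_d^{k_d-1}$ (sum over $k_i\ge1$, $m_i\ge0$), this means that $\varphi$ vanishes on all stuffle products (quasi-shuffle with $y_{k_1,m_1}\diamond y_{k_2,m_2}=y_{k_1+k_2,m_1+m_2}$) of two nonempty words in the letters $y_{k,m}$. $\mathrm{BARI}_{il}^{\mathrm{pol}}$, $\mathrm{BARI}_{il}^{\mathrm{rat}}$ are the subspaces of alternil elements. **Flexions.** For consecutive blocks $w=\cdots abc\cdots$ define: $\lceil c$ is $c$ with the sum of all $u$'s of the block $b$ immediately before it added to the first $u$ of $c$; $a\rceil$ is $a$ with the sum of all $u$'s of the block $b$ immediately after it added to the last $u$ of $a$; $b\rfloor$ is $b$ with the first $v$ of the block $c$ immediately after it subtracted from every $v$ of $b$; $\lfloor b$ is $b$ with the last $v$ of the block $a$ immediately before it subtracted from every $v$ of $b$. If the relevant neighbouring block is empty, nothing is changed. **Products and brackets.** $mu(A,B)(w_1,\ldots,w_d)=\sum_{j=0}^d A(w_1,\ldots,w_j)B(w_{j+1},\ldots,w_d)$, $lu(A,B)=mu(A,B)-mu(B,A)$, $$arit(B)(A)(w)=\sum_{w=abc,\ b,c\ne\emptyset}A(a\lceil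 c)B(b\rfloor)-\sum_{w=abc,\ a,b\neq\emptyset}A(a\rceil c)B(\lfloor b),$$ $$ari(A,B)=arit(B)(A)-arit(A)(B)+lu(A,B).$$ **ganit and uri.** For a rational bimould $B$ with $B_0=1$ set $$ganit_B(A)(w)=\sum_{w=b_1c_1\cdots b_sc_s}A(b_1\rceil\cdots b_s\rceil)B(\lfloor c_1)\cdots B(\lfloor c_s),$$ the sum being over all decompositions in which only $c_s$ may be empty (here $b_i\rceil$ refers to the block $c_i$ following it and $\lfloor c_i$ to the block $b_i$ preceding it). Let $pic,poc$ have depth $0$ component $1$ and, for $r\ge 1$, $$pic\binom{u_1,\ldots,u_r}{v_1,\ldots,v_r}=\frac1{v_1\cdots v_r},\qquad poc\binom{u_1,\ldots,u_r}{v_1,\ldots,v_r}=-\frac1{v_1(v_1-v_2)\cdots(v_{r-1}-v_r)}.$$ For $A,B\in \mathrm{BARI}^{\mathrm{rat}}$ define $uri(A,B)=ganit_{pic}\big(ari(ganit_{poc}(A),ganit_{poc}(B))\big)$. *)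

(* Defs.v *)
From HB Require Import structures.
From mathcomp Require Import all_boot all_algebra.
From mathcomp Require Import boolp.
From mathcomp Require Import mpoly ring.

Set Implicit Arguments.
Unset Strict Implicit.
Unset Printing Implicit Defensive.

Import GRing.Theory.
Local Open Scope ring_scope.
Local Open Scope quotient_scope.

(* Total ring of fractions: MathComp's {fraction A} requires an integral
   domain, whereas the coefficient ring R below may have zero divisors. The
   construction follows mathcomp.algebra.fraction, with denominators ranging
   over the non-zero-divisors instead of the nonzero elements. *)
Section TotRatio.
Variable A : comNzRingType.

Definition regb (x : A) : bool := `[< GRing.lreg x >].

Lemma regbP x : reflect (GRing.lreg x) (regb x).
Proof. exact: asboolP. Qed.

Lemma regb1 : regb 1. Proof. by apply/regbP; exact: lreg1. Qed.

Lemma regbM x y : regb x -> regb y -> regb (x * y).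
Proof. by move=> /regbP rx /regbP ry; apply/regbP; exact: lregM. Qed.

Inductive tratio := TRatio { tr_val :> A * A; _ : regb tr_val.2 }.

HB.instance Definition _ := [isSub for tr_val].
HB.instance Definition _ := [Choice of tratio by <:].

Lemma tden_reg (r : tratio) : regb (val r).2. Proof. by case: r. Qed.
End TotRatio.

Module TotFrac.
Section TotFrac.
Variable A : comNzRingType.
Implicit Types x y z : tratio A.

Definition equivt x y := (val x).1 * (val y).2 == (val x).2 * (val y).1.

Lemma equivt_refl : reflexive equivt.
Proof. by move=> x; rewrite /equivt mulrC. Qed.

Lemma equivt_sym : ssrbool.symmetric equivt.
Proof.
by move=> x y; rewrite /equivt eq_sym mulrC; congr (_ == _); rewrite mulrC.
Qed.

Lemma equivt_trans : transitive equivt.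
Proof.
move=> [[y1 y2] /= Py] [[x1 x2] Px] [[z1 z2] Pz]; rewrite /equivt /=.
move=> /eqP xy /eqP yz; apply/eqP/(regbP _ Py).
by rewrite mulrA (mulrC y2) xy -mulrA yz !mulrA [y2 * _]mulrC.
Qed.

Canonical equivt_equiv := EquivRel equivt equivt_refl equivt_sym equivt_trans.

Definition type := {eq_quot equivt}.
HB.instance Definition _ : EqQuotient _ equivt type := EqQuotient.on type.
HB.instance Definition _ := Choice.on type.

Definition mk (n d : A) (rd : regb d) : type := \pi_type (@TRatio A (n, d) rd).
Definition num (a : type) : A := (val (repr a)).1.
Definition den (a : type) : A := (val (repr a)).2.

Lemma den_reg a : regb (den a). Proof. exact: tden_reg. Qed.

Lemma mk_eq n d rd n' d' rd' :
  n * d' = d * n' -> @mk n d rd = @mk n' d' rd'.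
Proof. by move=> e; apply/eqP; rewrite eqmodE; apply/eqP. Qed.

Lemma mk_inj n d rd n' d' rd' :
  @mk n d rd = @mk n' d' rd' -> n * d' = d * n'.
Proof. by move=> /eqP; rewrite eqmodE => /eqP. Qed.

Lemma mkK a : mk (num a) (den_reg a) = a.
Proof.
have e : @TRatio A (num a, den a) (den_reg a) = repr a.
  by apply: val_inj; rewrite /= /num /den -surjective_pairing.
by rewrite /mk e reprK.
Qed.

Lemma num_mk n d rd : num (@mk n d rd) * d = den (@mk n d rd) * n.
Proof. by apply: (@mk_inj _ _ (den_reg _) _ _ rd); rewrite mkK. Qed.

Variant spec (a : type) : type -> Prop := Spec n d rd : spec a (@mk n d rd).

Lemma mkP a : spec a a.
Proof. by rewrite -[X in spec _ X]mkK; constructor. Qed.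

Definition emb (n : A) : type := mk n (regb1 A).
Definition add a b : type :=
  mk (num a * den b + num b * den a) (regbM (den_reg a) (den_reg b)).
Definition opp a : type := mk (- num a) (den_reg a).
Definition mul a b : type := mk (num a * num b) (regbM (den_reg a) (den_reg b)).
Definition unit : pred type := fun a => regb (num a).
Definition inv a : type :=
  if insub (den a, num a) is Some r then \pi_type r else a.

Lemma inv_mk a (ra : regb (num a)) : inv a = mk (den a) ra.
Proof. by rewrite /inv insubT. Qed.

Lemma add_mk n d rd n' d' rd' :
  add (@mk n d rd) (@mk n' d' rd') = mk (n * d' + n' * d) (regbM rd rd').
Proof.
apply: mk_eq; have e := num_mk n rd; have e' := num_mk n' rd'.
set x := num _ in e *; set y := den _ in e *.
set x' := num _ in e' *; set y' := den _ in e' *.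
have -> : (x * y' + x' * y) * (d * d') = x * d * (y' * d') + x' * d' * (y * d).
  by ring.
by rewrite e e'; ring.
Qed.

Lemma opp_mk n d rd : opp (@mk n d rd) = mk (- n) rd.
Proof. by apply: mk_eq; rewrite mulNr mulrN num_mk. Qed.

Lemma mul_mk n d rd n' d' rd' :
  mul (@mk n d rd) (@mk n' d' rd') = mk (n * n') (regbM rd rd').
Proof. by apply: mk_eq; rewrite mulrACA !num_mk mulrACA. Qed.

Lemma addA : associative add.
Proof.
move=> a b c; case: (mkP a) => n d r; case: (mkP b) => n' d' r'.
case: (mkP c) => m e s; rewrite !add_mk.
by apply: mk_eq; ring.
Qed.

Lemma addC : commutative add.
Proof.
move=> a b; case: (mkP a) => n d r; case: (mkP b) => n' d' r'.
by rewrite !add_mk; apply: mk_eq; rewrite mulrC addrC [d' * d]mulrC.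
Qed.

Lemma add0 : left_id (emb 0) add.
Proof.
move=> a; case: (mkP a) => n d r; rewrite add_mk.
by apply: mk_eq; ring.
Qed.

Lemma addN : left_inverse (emb 0) opp add.
Proof.
move=> a; case: (mkP a) => n d r; rewrite opp_mk add_mk.
by apply: mk_eq; ring.
Qed.

HB.instance Definition _ := GRing.isZmodule.Build type addA addC add0 addN.

Lemma mulA : associative mul.
Proof.
move=> a b c; case: (mkP a) => n d r; case: (mkP b) => n' d' r'.
case: (mkP c) => m e s; rewrite !mul_mk.
by apply: mk_eq; ring.
Qed.

Lemma mulC : commutative mul.
Proof.
move=> a b; case: (mkP a) => n d r; case: (mkP b) => n' d' r'.
by rewrite !mul_mk; apply: mk_eq; ring.
Qed.

Lemma mul1 : left_id (emb 1) mul.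
Proof.
move=> a; case: (mkP a) => n d r; rewrite mul_mk.
by apply: mk_eq; ring.
Qed.

Lemma mulDl : left_distributive mul add.
Proof.
move=> a b c; case: (mkP a) => n d r; case: (mkP b) => n' d' r'.
case: (mkP c) => m e s; rewrite !(mul_mk, add_mk).
by apply: mk_eq; ring.
Qed.

Lemma one_neq0 : emb 1 != emb 0.
Proof.
by apply/eqP => /mk_inj /eqP; rewrite mulr1 mulr0 oner_eq0.
Qed.

HB.instance Definition _ :=
  GRing.Zmodule_isComNzRing.Build type mulA mulC mul1 mulDl one_neq0.

Lemma mulVx : {in unit, left_inverse 1 inv *%R}.
Proof.
move=> a ua; rewrite (inv_mk ua).
have -> : mk (den a) ua * a = mul (mk (den a) ua) (mk (num a) (den_reg a)).
  by rewrite mkK.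
by rewrite mul_mk; apply: mk_eq; ring.
Qed.

Lemma unitPl (a b : type) : b * a = 1 -> unit a.
Proof.
rewrite -[a in _ * a]mkK -[b]mkK -[_ * _]/(mul _ _) mul_mk => /mk_inj.
rewrite !mulr1 => e; apply/regbP => x y exy.
have /regbP := regbM (den_reg b) (den_reg a); apply.
by rewrite -e -!mulrA exy.
Qed.

Lemma inv_out : {in [predC unit], inv =1 id}.
Proof. by move=> a na; rewrite /inv insubN. Qed.

HB.instance Definition _ :=
  GRing.ComNzRing_hasMulInverse.Build type mulVx unitPl inv_out.

Lemma emb_is_zmod_morphism : zmod_morphism emb.
Proof.
move=> x y; rewrite -[RHS]/(add _ (opp _)) opp_mk add_mk.
by apply: mk_eq; ring.
Qed.

Lemma emb_is_monoid_morphism : monoid_morphism emb.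
Proof.
split=> // x y; rewrite -[RHS]/(mul _ _) mul_mk; apply: mk_eq.
by rewrite !mulr1 mul1r.
Qed.

HB.instance Definition _ :=
  GRing.isZmodMorphism.Build A type emb emb_is_zmod_morphism.
HB.instance Definition _ :=
  GRing.isMonoidMorphism.Build A type emb emb_is_monoid_morphism.

End TotFrac.
End TotFrac.
HB.export TotFrac.

Notation totfrac := TotFrac.type.

Section Words.
Variable K : comUnitRingType.

(* A letter (u over v) is the pair (u, v). *)
Definition letter : Type := (K * K)%type.
Definition word : Type := seq letter.
Implicit Types (a b c x y w : word) (l : letter).

Definition usum b : K := \sum_(l <- b) l.1.

(* Flexions, with both blocks as arguments in the order they have in the word:
   uflexl b c is c with an upper left corner, b being the block before it;
   uflexr a b is a with an upper right corner, b being the block after it. *)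
Definition uflexl b c : word :=
  if c is l :: c' then (usum b + l.1, l.2) :: c' else [::].

Definition uflexr a b : word :=
  if a is l :: a' then
    rcons (belast l a') ((last l a').1 + usum b, (last l a').2)
  else [::].

(* vflexr b c is b with a lower right corner, c being the block after it;
   vflexl a b is b with a lower left corner, a being the block before it. *)
Definition vflexr b c : word :=
  if c is l :: _ then [seq (m.1, m.2 - l.2) | m <- b] else b.

Definition vflexl a b : word :=
  if a is l :: a' then [seq (m.1, m.2 - (last l a').2) | m <- b] else b.

Definition cuts2 w : seq (word * word) :=
  [seq (take j w, drop j w) | j <- iota 0 (size w).+1].

Definition cuts3 w : seq (word * word * word) :=
  [seq (p.1, q.1, q.2) | p <- cuts2 w, q <- cuts2 p.2].

(* All ((b_1, c_1), ..., (b_s, c_s)) with w = b_1 c_1 ... b_s c_s, all b_i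
   nonempty and only c_s possibly empty; n bounds the recursion depth, and
   n = size w suffices. *)
Fixpoint bcdecs_rec n w : seq (seq (word * word)) :=
  if nilp w then [:: [::]] else
  if n is n'.+1 then
    flatten [seq [seq (t.1.1, t.1.2) :: s | s <- bcdecs_rec n' t.2]
            | t <- cuts3 w & ~~ nilp t.1.1 && (~~ nilp t.1.2 || nilp t.2)]
  else [::].

Definition bcdecs w := bcdecs_rec (size w) w.

(* A linear combination of words is a list of (coefficient, word) pairs. *)
Definition lcomb : Type := seq (K * word).

Definition lc_cons l (X : lcomb) : lcomb := [seq (t.1, l :: t.2) | t <- X].
Definition lc_scale (k : K) (X : lcomb) : lcomb := [seq (k * t.1, t.2) | t <- X].

Fixpoint stuffle x : word -> lcomb :=
  if x is l :: x' then
    fix stuffle_x y : lcomb :=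
      if y is m :: y' then
        lc_cons l (stuffle x' y) ++ lc_cons m (stuffle_x y') ++
        lc_scale (l.2 - m.2)^-1
          (lc_cons (l.1 + m.1, l.2) (stuffle x' y') ++
           lc_scale (-1) (lc_cons (l.1 + m.1, m.2) (stuffle x' y')))
      else [:: (1, x)]
  else fun y => [:: (1, y)].

End Words.

Arguments cuts2 {K}.
Arguments cuts3 {K}.

Section Bimoulds.
Variable R : comNzRingType.

(* The u_i are the first d variables and the v_i are the last d. *)
Definition ratfun (d : nat) := totfrac {mpoly R[d + d]}.

Definition polfun d (p : {mpoly R[d + d]}) : ratfun d := TotFrac.emb p.
Definition pconst d (c : R) : ratfun d := polfun c%:MP.

Fact pconst_is_zmod_morphism d : zmod_morphism (@pconst d).
Proof. by move=> a b; rewrite /pconst /polfun mpolyCB rmorphB. Qed.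
Fact pconst_is_monoid_morphism d : monoid_morphism (@pconst d).
Proof.
by split=> [|a b]; rewrite /pconst /polfun ?rmorph1 // mpolyCM rmorphM.
Qed.
HB.instance Definition _ d :=
  GRing.isZmodMorphism.Build R (ratfun d) (@pconst d)
    (@pconst_is_zmod_morphism d).
HB.instance Definition _ d :=
  GRing.isMonoidMorphism.Build R (ratfun d) (@pconst d)
    (@pconst_is_monoid_morphism d).

Definition uvar d (i : 'I_d) : ratfun d := polfun 'X_(lshift d i).
Definition vvar d (i : 'I_d) : ratfun d := polfun 'X_(rshift d i).

Definition gword d : word (ratfun d) := [seq (uvar i, vvar i) | i <- enum 'I_d].

(* Value of f at u_i := (w_i).1, v_i := (w_i).2. The chosen fraction
   representing f does not matter as soon as the value of its denominator is
   invertible (see rsubst_mk); this is always the case below, where the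
   entries of the letters of w are linearly independent rational linear forms. *)
Definition psubst m d (w : word (ratfun d)) (p : {mpoly R[m + m]}) : ratfun d :=
  mmap (@pconst d)
       (fun k => match split k with
                 | inl i => (nth (0, 0) w i).1
                 | inr i => (nth (0, 0) w i).2
                 end) p.

Definition rsubst m d (w : word (ratfun d)) (f : ratfun m) : ratfun d :=
  psubst w (TotFrac.num f) / psubst w (TotFrac.den f).

Lemma psubstM m d (w : word (ratfun d)) : {morph @psubst m d w : p q / p * q}.
Proof. by move=> p q; rewrite /psubst rmorphM. Qed.

Lemma rsubst_mk m d (w : word (ratfun d)) n e (re : regb e) :
  psubst w e \is a GRing.unit ->
  psubst w (TotFrac.den (TotFrac.mk n re)) \is a GRing.unit ->
  rsubst w (TotFrac.mk n re : ratfun m) = psubst w n / psubst w e.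
Proof.
move=> ue uf; rewrite /rsubst; apply: (mulrI uf); rewrite mulrC divrK //.
apply: (mulIr ue); rewrite -mulrA divrK // -!psubstM.
by rewrite TotFrac.num_mk.
Qed.

Lemma psubst_gword d p : psubst (gword d) p = polfun p.
Proof.
rewrite [in RHS](mpolyE p) /polfun rmorph_sum /=; apply: eq_bigr => m _.
rewrite -mul_mpolyC rmorphM /=; congr (_ * _).
rewrite mpolyXE_id rmorph_prod; apply: eq_bigr => i _; rewrite rmorphXn.
congr (_ ^+ _); rewrite -[in RHS](splitK i); case: (split i) => j /=;
  by rewrite (nth_map j) ?size_enum_ord // nth_ord_enum.
Qed.

Lemma rsubst_gword d (f : ratfun d) : rsubst (gword d) f = f.
Proof.
have ud : polfun (TotFrac.den f) \is a GRing.unit.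
  apply: (@TotFrac.unitPl _ _ (TotFrac.mk 1 (TotFrac.den_reg f))).
  rewrite -[LHS]/(TotFrac.mul _ _) TotFrac.mul_mk.
  by apply: TotFrac.mk_eq; ring.
rewrite /rsubst !psubst_gword; apply: (mulIr ud); rewrite divrK //.
rewrite -[X in _ = X * _]TotFrac.mkK -[RHS]/(TotFrac.mul _ _) TotFrac.mul_mk.
by apply: TotFrac.mk_eq; ring.
Qed.

Definition bimould : Type := forall d, ratfun d.

HB.instance Definition _ := gen_eqMixin bimould.
HB.instance Definition _ := gen_choiceMixin bimould.

Implicit Types A B M : bimould.

Let badd A B : bimould := fun d => A d + B d.
Let bopp A : bimould := fun d => - A d.
Let bzero : bimould := fun=> 0.
Let bscale (c : R) A : bimould := fun d => pconst d c * A d.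

Fact baddA : associative badd.
Proof. by move=> A B C; apply: functional_extensionality_dep => d; apply: addrA. Qed.
Fact baddC : commutative badd.
Proof. by move=> A B; apply: functional_extensionality_dep => d; apply: addrC. Qed.
Fact badd0 : left_id bzero badd.
Proof. by move=> A; apply: functional_extensionality_dep => d; apply: add0r. Qed.
Fact baddN : left_inverse bzero bopp badd.
Proof. by move=> A; apply: functional_extensionality_dep => d; apply: addNr. Qed.

HB.instance Definition _ := GRing.isZmodule.Build bimould baddA baddC badd0 baddN.

Fact bscaleA a b M : bscale a (bscale b M) = bscale (a * b) M.
Proof.
apply: functional_extensionality_dep => d.
by rewrite /bscale mulrA rmorphM.
Qed.
Fact bscale1 : left_id 1 bscale.
Proof.
move=> M; apply: functional_extensionality_dep => d.
by rewrite /bscale rmorph1 mul1r.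
Qed.
Fact bscaleDr : right_distributive bscale +%R.
Proof. by move=> c A B; apply: functional_extensionality_dep => d; apply: mulrDr. Qed.
Fact bscaleDl M : {morph bscale^~ M : a b / a + b}.
Proof.
move=> a b; apply: functional_extensionality_dep => d.
by rewrite /bscale rmorphD mulrDl.
Qed.

HB.instance Definition _ :=
  GRing.Zmodule_isLmodule.Build R bimould bscaleA bscale1 bscaleDr bscaleDl.

Definition bval M d (w : word (ratfun d)) : ratfun d := rsubst w (M (size w)).

Definition mu A B : bimould := fun d =>
  \sum_(p <- cuts2 (gword d)) bval A p.1 * bval B p.2.

Definition lu A B : bimould := mu A B - mu B A.

Definition arit B A : bimould := fun d =>
  \sum_(t <- cuts3 (gword d) | let: (a, b, c) := t in ~~ nilp b && ~~ nilp c)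
     (let: (a, b, c) := t in bval A (a ++ uflexl b c) * bval B (vflexr b c))
  - \sum_(t <- cuts3 (gword d) | let: (a, b, c) := t in ~~ nilp a && ~~ nilp b)
     (let: (a, b, c) := t in bval A (uflexr a b ++ c) * bval B (vflexl a b)).

Definition ari A B : bimould := arit B A - arit A B + lu A B.

Definition ganit B A : bimould := fun d =>
  \sum_(s <- bcdecs (gword d))
     bval A (flatten [seq uflexr t.1 t.2 | t <- s])
     * \prod_(t <- s) bval B (vflexl t.1 t.2).

Definition pic : bimould := fun d => (\prod_(i < d) vvar i)^-1.

Definition poc : bimould := fun d =>
  if d == 0%N then 1 else
  let v := [seq vvar i | i <- enum 'I_d] in
  - (v`_0 * \prod_(i < d.-1) (v`_i - v`_i.+1))^-1.

Definition uri A B : bimould := ganit pic (ari (ganit poc A) (ganit poc B)).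

Definition lcval M d (X : lcomb (ratfun d)) : ratfun d :=
  \sum_(t <- X) t.1 * bval M t.2.

Definition alternil M : Prop :=
  forall d n, (0 < n < d)%N ->
    lcval M (stuffle (take n (gword d)) (drop n (gword d))) = 0.

(* M 0 ranges over the fractions of R itself, but it is required to vanish. *)
Definition BARI_rat M : Prop := M 0%N = 0.

(* Polynomial bimoulds are viewed inside the rational ones. *)
Definition BARI_pol M : Prop :=
  [/\ M 0%N = 0,
      forall d, exists p : {mpoly R[d + d]}, M d = polfun p
    & exists N, forall d, (N < d)%N -> M d = 0].

Definition BARI_il_rat M : Prop := BARI_rat M /\ alternil M.
Definition BARI_il_pol M : Prop := BARI_pol M /\ alternil M.

End Bimoulds.

Section Lie.
Variables (R : comNzRingType) (V : lmodType R).

Definition submodule (L : V -> Prop) : Prop :=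
  L 0 /\ forall (a : R) (x y : V), L x -> L y -> L (a *: x + y).

Record lie_algebra (L : V -> Prop) (br : V -> V -> V) : Prop := {
  lie_submod : submodule L;
  lie_closed : forall x y, L x -> L y -> L (br x y);
  lie_linearl : forall (a : R) x y z, L x -> L y -> L z ->
    br (a *: x + y) z = a *: br x z + br y z;
  lie_linearr : forall (a : R) x y z, L x -> L y -> L z ->
    br z (a *: x + y) = a *: br z x + br z y;
  lie_alternating : forall x, L x -> br x x = 0;
  lie_jacobi : forall x y z, L x -> L y -> L z ->
    br x (br y z) + br y (br z x) + br z (br x y) = 0
}.

Record lie_subalgebra (S L : V -> Prop) (br : V -> V -> V) : Prop := {
  lie_ambient : lie_algebra L br;
  lie_sub : forall x, S x -> L x;
  lie_sub_submod : submodule S;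
  lie_sub_closed : forall x y, S x -> S y -> S (br x y)
}.

End Lie.

(* Main.v *)
(* Dually, mu, arit, ari and ganit act on words: arit B is the transpose of a
   coderivation for deconcatenation, ganit_B of a coalgebra automorphism.  Both
   are determined by their components on single letters, so every identity
   reduces to one about words collapsed to one letter.  In this way
   [arit B, arit A] = arit (ari A B) gives the Jacobi identity of ari;
   ganit_pic and ganit_poc are mutually inverse and exchange shuffles with
   stuffles, hence alternal with alternil bimoulds; and ari preserves alternal
   bimoulds.  Conjugating arit by ganit_pic gives again the transpose of a
   coderivation, whose letter component involves B only through divided
   differences of t |-> B(y - t).  These are polynomial when B is, and vanish at
   orders above the degree of B, so uri preserves polynomiality and finiteness
   of depth. *)
Require Import Defs.
From HB Require Import structures.
From mathcomp Require Import all_boot all_algebra.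
From mathcomp Require Import boolp mpoly ring zify.

Set Implicit Arguments.
Unset Strict Implicit.
Unset Printing Implicit Defensive.

Import GRing.Theory.
Local Open Scope ring_scope.

(** * Linear combinations and deconcatenation *)

(** Two obstacles shape the proof. Conjugation by [ganit_pic] creates poles term by term, so
    polynomiality cannot be read off summands. The part of [arit] keeping the last v is harmless,
    because there pic and poc cancel. The part keeping the first v requires solving an equation for
    a new letter component ([ucoef_sweep]); [ucoef] is an explicit solution in which each pole is
    absorbed into a divided difference. The second obstacle is that the coefficient ring may have
    zero divisors, so substitution of linear forms into a rational function makes sense only where
    denominators stay regular. The algebra is therefore done for functionals on words over any ring
    with units, restricted to a class of words stable under all operations ([closed_words]). The
    concrete class [good] consists of words whose letters can be specialized at will, and McCoy's
    theorem turns regularity after specialization into invertibility. Evaluation at a good word is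
    then a ring morphism, and a bimould is recovered from its value at the generic word. *)

Section Pairing.
Variable K : comUnitRingType.

(* Linear combinations are lists of (coefficient, item) pairs; they are compared
   by evaluating every functional F on them. *)
Definition lin T (X : seq (K * T)) (F : T -> K) : K := \sum_(k <- X) k.1 * F k.2.

Lemma lin_nil T (F : T -> K) : lin [::] F = 0.
Proof. by rewrite /lin big_nil. Qed.

Lemma lin_seq1 T k (F : T -> K) : lin [:: k] F = k.1 * F k.2.
Proof. by rewrite /lin big_seq1. Qed.

Lemma lin_cat T (X Y : seq (K * T)) F : lin (X ++ Y) F = lin X F + lin Y F.
Proof. by rewrite /lin big_cat. Qed.

Lemma lin_flatten T I (s : seq I) (X : I -> seq (K * T)) F :
  lin (flatten [seq X i | i <- s]) F = \sum_(i <- s) lin (X i) F.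
Proof. by rewrite /lin big_flatten big_map. Qed.

Lemma eq_lin T (X : seq (K * T)) F F' : F =1 F' -> lin X F = lin X F'.
Proof. by move=> e; apply: eq_bigr => k _; rewrite e. Qed.

Lemma lin_scale (k : K) X (F : word K -> K) : lin (lc_scale k X) F = k * lin X F.
Proof. by rewrite /lin big_map mulr_sumr; apply: eq_bigr => t _; rewrite mulrA. Qed.

Lemma lin_lcons l X (F : word K -> K) : lin (lc_cons l X) F = lin X (F \o cons l).
Proof. by rewrite /lin big_map. Qed.

Lemma linD T (X : seq (K * T)) F F' : lin X (fun t => F t + F' t) = lin X F + lin X F'.
Proof. by rewrite -big_split; apply: eq_bigr => k _; rewrite mulrDr. Qed.

Lemma linN T (X : seq (K * T)) F : lin X (fun t => - F t) = - lin X F.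
Proof. by rewrite /lin raddf_sum; apply: eq_bigr => k _ /=; rewrite mulrN. Qed.

Lemma linB T (X : seq (K * T)) F F' : lin X (fun t => F t - F' t) = lin X F - lin X F'.
Proof. by rewrite linD linN. Qed.

Lemma linZ T (X : seq (K * T)) a F : lin X (fun t => a * F t) = a * lin X F.
Proof. by rewrite /lin mulr_sumr; apply: eq_bigr => k _; ring. Qed.

Lemma linZr T (X : seq (K * T)) a F : lin X (fun t => F t * a) = lin X F * a.
Proof. by rewrite /lin mulr_suml; apply: eq_bigr => k _; ring. Qed.

Lemma lin0 T (X : seq (K * T)) : lin X (fun=> 0) = 0.
Proof. by apply: big1 => k _; rewrite mulr0. Qed.

Lemma lin_exchange T T' (X : seq (K * T)) (Y : seq (K * T')) (F : T -> T' -> K) :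
  lin X (fun t => lin Y (F t)) = lin Y (fun t' => lin X (F^~ t')).
Proof.
rewrite /lin; under eq_bigr do rewrite mulr_sumr.
rewrite exchange_big /=; apply: eq_bigr => k _.
by rewrite mulr_sumr; apply: eq_bigr => k' _; ring.
Qed.

Implicit Types (a b c w : word K) (l : letter K) (f g : word K -> word K -> K).

Definition cut w f : K := \sum_(p <- cuts2 w) f p.1 p.2.

Lemma cuts2_cons l w :
  cuts2 (l :: w) = ([::], l :: w) :: [seq (l :: p.1, p.2) | p <- cuts2 w].
Proof.
rewrite /cuts2 -[iota 0 (size (l :: w)).+1]/(0%N :: iota (1 + 0) (size w).+1).
by rewrite map_cons take0 drop0 iotaDl -!map_comp.
Qed.

Lemma cut_nil f : cut [::] f = f [::] [::].
Proof. by rewrite /cut /cuts2 /= big_seq1. Qed.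

Lemma cut_cons l w f : cut (l :: w) f = f [::] (l :: w) + cut w (fun a => f (l :: a)).
Proof. by rewrite /cut cuts2_cons big_cons big_map. Qed.

Lemma eq_cut w f g : (forall a b, w = a ++ b -> f a b = g a b) -> cut w f = cut w g.
Proof.
elim: w f g => [|l w IHw] f g e; first by rewrite !cut_nil e.
rewrite !cut_cons e //; congr (_ + _); apply: IHw => a b ew.
by rewrite e // ew.
Qed.

Lemma cut0 w : cut w (fun _ _ => 0) = 0.
Proof. exact: big1. Qed.

Lemma cut_eq0 w f : (forall a b, w = a ++ b -> f a b = 0) -> cut w f = 0.
Proof. by move=> /eq_cut->; exact: cut0. Qed.

Lemma cutD w f g : cut w (fun a b => f a b + g a b) = cut w f + cut w g.
Proof. exact: big_split. Qed.

Lemma cutN w f : cut w (fun a b => - f a b) = - cut w f.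
Proof. by rewrite /cut raddf_sum. Qed.

Lemma cutB w f g : cut w (fun a b => f a b - g a b) = cut w f - cut w g.
Proof. by rewrite cutD cutN. Qed.

Lemma cutZ w k f : cut w (fun a b => k * f a b) = k * cut w f.
Proof. by rewrite /cut mulr_sumr. Qed.

Lemma cutZr w k f : cut w (fun a b => f a b * k) = cut w f * k.
Proof. by rewrite /cut mulr_suml. Qed.

Lemma cut_lin w T (X : seq (K * T)) (f : word K -> word K -> T -> K) :
  cut w (fun a b => lin X (f a b)) = lin X (fun t => cut w (fun a b => f a b t)).
Proof.
rewrite /cut /lin exchange_big; apply: eq_bigr => k _.
by rewrite mulr_sumr.
Qed.

Lemma cut_cut w w' (f : word K -> word K -> word K -> word K -> K) :
  cut w (fun a b => cut w' (f a b)) = cut w' (fun c d => cut w (fun a b => f a b c d)).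
Proof. exact: exchange_big. Qed.

(** Coassociativity of deconcatenation, the source of the reindexings below. *)
Lemma cutA w (f : word K -> word K -> word K -> K) :
  cut w (fun a r => cut r (f a)) = cut w (fun r c => cut r (fun a b => f a b c)).
Proof.
elim: w f => [|l w IHw] f; first by rewrite !cut_nil.
rewrite !cut_cons !cut_nil IHw -addrA -cutD; congr (_ + _).
by apply: eq_cut => a b _; rewrite cut_cons.
Qed.

Lemma cut_cat_cons a l c f :
  cut (a ++ l :: c) f = cut a (fun a1 a2 => f a1 (a2 ++ l :: c))
                      + cut c (fun c1 c2 => f (a ++ l :: c1) c2).
Proof.
elim: a f => [|m a IHa] f /=; first by rewrite cut_cons cut_nil.
by rewrite !cut_cons IHa addrA.
Qed.

Lemma cut_rcons w l f :
  cut (rcons w l) f = cut w (fun a b => f a (rcons b l)) + f (rcons w l) [::].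
Proof.
rewrite -cats1 cut_cat_cons cut_nil cats1; congr (_ + _).
by apply: eq_cut => a b _; rewrite cats1.
Qed.

Definition cut3 w (f : word K -> word K -> word K -> K) : K :=
  cut w (fun a r => cut r (f a)).

Lemma sum_cuts3 w (P : pred (word K * word K * word K))
    (f : word K * word K * word K -> K) :
  \sum_(t <- cuts3 w | P t) f t = cut3 w (fun a b c => if P (a, b, c) then f (a, b, c) else 0).
Proof.
rewrite big_mkcond /cuts3 big_allpairs_dep /=.
by apply: eq_bigr => p _; apply: eq_bigr => q _.
Qed.

Implicit Types h : word K -> word K -> word K -> K.

Lemma eq_cut3 w h h' : (forall a b c, w = a ++ b ++ c -> h a b c = h' a b c) ->
  cut3 w h = cut3 w h'.
Proof.
move=> e; apply: eq_cut => a r ew; apply: eq_cut => b c er.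
by rewrite e // ew er.
Qed.

Lemma cut3D w h h' : cut3 w (fun a b c => h a b c + h' a b c) = cut3 w h + cut3 w h'.
Proof. by rewrite /cut3 -cutD; apply: eq_cut => a r _; rewrite cutD. Qed.

Lemma cut3N w h : cut3 w (fun a b c => - h a b c) = - cut3 w h.
Proof. by rewrite /cut3 -cutN; apply: eq_cut => a r _; rewrite cutN. Qed.

Lemma cut3B w h h' : cut3 w (fun a b c => h a b c - h' a b c) = cut3 w h - cut3 w h'.
Proof. by rewrite cut3D cut3N. Qed.

Lemma cut3Z w k h : cut3 w (fun a b c => k * h a b c) = k * cut3 w h.
Proof. by rewrite /cut3 -cutZ; apply: eq_cut => a r _; rewrite cutZ. Qed.

Lemma cut3_lin w T (X : seq (K * T)) (f : word K -> word K -> word K -> T -> K) :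
  cut3 w (fun a b c => lin X (f a b c)) = lin X (fun t => cut3 w (fun a b c => f a b c t)).
Proof. by rewrite /cut3 -cut_lin; apply: eq_cut => a r _; rewrite cut_lin. Qed.

End Pairing.

(** * The coderivation dual to arit *)

Section Coderivations.
Variable K : comUnitRingType.
Implicit Types (a b c w s : word K) (l : letter K) (F A B C : word K -> K).
Implicit Types E : word K -> seq (K * letter K).

Lemma cut3_cat_cons a l c (h : word K -> word K -> word K -> K) :
  cut3 (a ++ l :: c) h
    = cut3 a (fun x y z => h x y (z ++ l :: c))
      + cut a (fun a1 a2 => cut c (fun c1 c2 => h a1 (a2 ++ l :: c1) c2))
      + cut3 c (fun x y z => h (a ++ l :: x) y z).
Proof.
rewrite /cut3 cut_cat_cons; congr (_ + _); rewrite -cutD.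
by apply: eq_cut => a1 a2 _; rewrite cut_cat_cons.
Qed.

Lemma cut3_cut3l w (f : word K -> word K -> word K -> word K -> word K -> K) :
  cut3 w (fun a s c => cut3 a (fun x y z => f x y z s c))
    = cut3 w (fun x y r => cut3 r (fun z s c => f x y z s c)).
Proof.
rewrite /cut3; under eq_cut => a r _ do rewrite cut_cut.
rewrite -cutA; apply: eq_cut => x r _.
under eq_cut => q t _ do rewrite cut_cut.
by rewrite -cutA.
Qed.

Lemma cut3_cut_cut w (f : word K -> word K -> word K -> word K -> word K -> K) :
  cut3 w (fun a s c => cut a (fun x y => cut c (fun u v => f x y s u v)))
    = cut3 w (fun x t v => cut3 t (fun y s u => f x y s u v)).
Proof.
rewrite /cut3; under eq_cut => a r _ do rewrite cut_cut.
rewrite -cutA; apply: eq_cut => x r _.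
rewrite -[RHS]cutA; apply: eq_cut => y t _.
by rewrite cutA.
Qed.

(* Transpose of the coderivation for deconcatenation whose letter component is E. *)
Definition coder E F w : K :=
  cut3 w (fun a s c => lin (E s) (fun l => F (a ++ l :: c))).

Definition mulm F F' w : K := cut w (fun a b => F a * F' b).

Lemma coder_ext E F F' : F =1 F' -> coder E F =1 coder E F'.
Proof.
by move=> e w; apply: eq_cut3 => a s c _; apply: eq_lin => l; apply: e.
Qed.

(** Replacements in two disjoint segments commute and cancel. What remains is the case where the
    second segment swallows the letter created by the first; it is again a coderivation, with a
    nested letter component. *)
Lemma coder_comp E E' F w :
  coder E (coder E' F) w - coder E' (coder E F) w =
    cut3 w (fun a s c => coder E (fun z => lin (E' z) (fun l => F (a ++ l :: c))) s
                       - coder E' (fun z => lin (E z) (fun l => F (a ++ l :: c))) s).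
Proof.
pose T3 E1 E2 := cut3 w (fun a s r => lin (E1 s) (fun l =>
  cut3 r (fun x y z => lin (E2 y) (fun m => F ((a ++ l :: x) ++ m :: z))))).
(* The second segment lies to the left of the new letter, contains it, or lies to its right. *)
have split E1 E2 : coder E1 (coder E2 F) w = T3 E2 E1 +
  cut3 w (fun a s c => coder E1 (fun z => lin (E2 z) (fun l => F (a ++ l :: c))) s)
  + T3 E1 E2.
  rewrite {1}/coder.
  under eq_cut3 => a s c w_eq.
    under eq_lin => l do rewrite /coder cut3_cat_cons.
    rewrite 2!linD -cut3_lin -cut_lin.
    over.
  rewrite 2!cut3D; congr (_ + _); congr (_ + _).
    rewrite cut3_cut3l /T3; apply: eq_cut3 => x y r _.
    rewrite -cut3_lin; apply: eq_cut3 => z s c _.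
    rewrite lin_exchange; apply: eq_lin => l; apply: eq_lin => m.
    by rewrite -catA.
  under eq_cut3 => a s c w_eq.
    under eq_cut => a1 a2 _ do rewrite -cut_lin.
    over.
  rewrite cut3_cut_cut; apply: eq_cut3 => a s c _.
  by rewrite /coder; apply: eq_cut3 => x y z _.
by rewrite cut3B (split E E') (split E' E); ring.
Qed.

Lemma cut3_cutl w (f : word K -> word K -> word K -> word K -> K) :
  cut3 w (fun a s c => cut a (fun x y => f x y s c))
    = cut w (fun x r => cut3 r (fun y s c => f x y s c)).
Proof.
rewrite /cut3; under eq_cut => a r _ do rewrite cut_cut.
by rewrite -cutA.
Qed.

Lemma cut3_cutr w (f : word K -> word K -> word K -> word K -> K) :
  cut3 w (fun a s c => cut c (fun x y => f a s x y))
    = cut w (fun r y => cut3 r (fun a s x => f a s x y)).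
Proof.
rewrite /cut3; under eq_cut => a r _ do rewrite cutA.
by rewrite cutA.
Qed.

(** Derivation rule: a cut of [a ++ l :: c] leaves the new letter [l] in exactly one of the two
    factors. *)
Lemma coder_mulm E F F' w :
  coder E (mulm F F') w = mulm (coder E F) F' w + mulm F (coder E F') w.
Proof.
rewrite {1}/coder.
under eq_cut3 => a s c w_eq.
  under eq_lin => l do rewrite /mulm cut_cat_cons.
  rewrite linD -2!cut_lin.
  over.
rewrite cut3D addrC cut3_cutl cut3_cutr; congr (_ + _).
  apply: eq_cut => q c _; rewrite /coder /cut3 -cutZr.
  apply: eq_cut => a r _; rewrite -cutZr; apply: eq_cut => s d _.
  by rewrite linZr.
rewrite [RHS]/mulm; apply: eq_cut => q c _ /=; rewrite /coder -cut3Z.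
by apply: eq_cut3 => y s d _; rewrite linZ.
Qed.

Lemma mulmA F F' F'' w : mulm F (mulm F' F'') w = mulm (mulm F F') F'' w.
Proof.
rewrite /mulm; under eq_cut do rewrite -cutZ; rewrite cutA.
apply: eq_cut => r c _; rewrite -cutZr; apply: eq_cut => a b _.
by rewrite mulrA.
Qed.

Definition sh w (t : K) : word K := [seq (l.1, l.2 - t) | l <- w].

(* Letter component of the coderivation transposed to arit B: the part keeping
   the last v of the word, then minus the part keeping the first. *)
Definition edgeL B s : seq (K * letter K) :=
  flatten [seq (if p.2 is [:: y] then
                  [:: (B (sh p.1 y.2), (usum p.1 + y.1, y.2))] else [::])
          | p <- cuts2 s].

Definition edgeF B s : seq (K * letter K) :=
  if s is x :: b then [:: (B (sh b x.2), (x.1 + usum b, x.2))] else [::].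

Definition edge B s := edgeL B s ++ [seq (- k.1, k.2) | k <- edgeF B s].

Lemma lin_edgeL B s (f : letter K -> K) :
  lin (edgeL B s) f
    = cut s (fun a b => if b is [:: y] then B (sh a y.2) * f (usum a + y.1, y.2) else 0).
Proof.
rewrite lin_flatten; apply: eq_bigr => -[a [|y [|z b]]] _ /=;
by rewrite ?lin_nil ?lin_seq1.
Qed.

Lemma lin_edgeL_rcons B s y (f : letter K -> K) :
  lin (edgeL B (rcons s y)) f = B (sh s y.2) * f (usum s + y.1, y.2).
Proof.
rewrite lin_edgeL cut_rcons addr0.
elim/last_ind: s => [|s z _]; first by rewrite cut_nil.
rewrite cut_rcons cut_eq0 ?add0r // => a b _.
by case: b => [|x [|x' b]].
Qed.

Lemma lin_edge B s f : lin (edge B s) f = lin (edgeL B s) f - lin (edgeF B s) f.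
Proof.
rewrite lin_cat; congr (_ + _).
rewrite /lin big_map raddf_sum; apply: eq_bigr => k _ /=; exact: mulNr.
Qed.

Lemma edgeN B : edge B [::] = [::].
Proof. by []. Qed.

End Coderivations.

(** * Commutator of the coderivations attached to two functionals *)

Section EdgeCommutator.
Variable K : comUnitRingType.
Implicit Types (a b c w s : word K) (l x y : letter K) (t : K).
Implicit Types (F A B C : word K -> K) (f : letter K -> K).

Lemma usum_nil : usum [::] = 0 :> K.
Proof. exact: big_nil. Qed.

Lemma usum_cons l w : usum (l :: w) = l.1 + usum w.
Proof. exact: big_cons. Qed.

Lemma usum_cat a b : usum (a ++ b) = usum a + usum b.
Proof. exact: big_cat. Qed.

Lemma usum_rcons w l : usum (rcons w l) = usum w + l.1.
Proof. by rewrite -cats1 usum_cat usum_cons usum_nil addr0. Qed.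

Lemma usum_sh w t : usum (sh w t) = usum w.
Proof. by rewrite /usum big_map. Qed.

Lemma sh_cat a b t : sh (a ++ b) t = sh a t ++ sh b t.
Proof. exact: map_cat. Qed.

Lemma sh_sh w t t' : sh (sh w t) (t' - t) = sh w t'.
Proof.
by rewrite /sh -map_comp; apply: eq_map => l /=; congr pair; ring.
Qed.

Lemma cut_map (T : comUnitRingType) (h : letter T -> letter K) (w : word T)
    (g : word K -> word K -> K) :
  cut (map h w) g = \sum_(p <- cuts2 w) g (map h p.1) (map h p.2).
Proof.
elim: w g => [|l w IHw] g /=; first by rewrite cut_nil /cuts2 big_seq1.
by rewrite cut_cons IHw cuts2_cons [RHS]big_cons [in RHS]big_map.
Qed.

Lemma cut_sh w t (g : word K -> word K -> K) :
  cut (sh w t) g = cut w (fun a b => g (sh a t) (sh b t)).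
Proof. exact: cut_map. Qed.

(** Whichever v survives, the letters of [edge B s] carry the whole u-sum of [s]. *)
Lemma eq_lin_edge B s f f' :
  (forall v, f (usum s, v) = f' (usum s, v)) -> lin (edge B s) f = lin (edge B s) f'.
Proof.
case: s => [|x s] e; first by rewrite edgeN !lin_nil.
rewrite 2!lin_edge !lin_seq1 -usum_cons e; congr (_ - _).
case/lastP: (x :: s) e => [|{}s y] e; first by rewrite !lin_edgeL !cut_nil.
by rewrite !lin_edgeL_rcons -usum_rcons e.
Qed.

Lemma lin_edge_sh B s t f :
  lin (edge B (sh s t)) f = lin (edge B s) (fun l => f (l.1, l.2 - t)).
Proof.
rewrite 2!lin_edge; congr (_ - _); last first.
  by case: s => [|x s]; rewrite ?lin_nil ?lin_seq1 //= sh_sh usum_sh.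
case/lastP: s => [|s y]; first by rewrite !lin_edgeL !cut_nil.
by rewrite /sh map_rcons !lin_edgeL_rcons /= -!/(sh _ _) sh_sh usum_sh.
Qed.

Lemma coder_edge_sh A B w t :
  coder (edge B) A (sh w t) = coder (edge B) (fun z => A (sh z t)) w.
Proof.
rewrite /coder /cut3 cut_sh; apply: eq_cut => a r _.
rewrite cut_sh; apply: eq_cut => s c _.
by rewrite lin_edge_sh; apply: eq_lin => l; rewrite sh_cat.
Qed.

Lemma mulm_sh A B w t :
  mulm A B (sh w t) = mulm (fun z => A (sh z t)) (fun z => B (sh z t)) w.
Proof. exact: cut_sh. Qed.

Lemma cut_singleton r (g : letter K -> word K -> K) :
  cut r (fun b c => if b is [:: y] then g y c else 0)
    = if r is y :: c then g y c else 0.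
Proof.
case: r => [|y c]; first by rewrite cut_nil.
rewrite cut_cons add0r; case: c => [|z c]; first by rewrite cut_nil.
by rewrite cut_cons cut_eq0 ?addr0.
Qed.

(** Terms in which one surviving letter has given everything on its left to one factor and
    everything on its right to the other. They have no counterpart in an edge component and must
    cancel in the commutator. *)
Definition mid A B f s : K :=
  cut s (fun a r => if r is x :: b then A (sh a x.2) * B (sh b x.2) * f (usum s, x.2) else 0).

Lemma cut3_cons x w (h : word K -> word K -> word K -> K) :
  cut3 (x :: w) h = h [::] [::] (x :: w) + cut w (fun s c => h [::] (x :: s) c)
                    + cut3 w (fun a s c => h (x :: a) s c).
Proof. by rewrite /cut3 !cut_cons. Qed.

Lemma cut3_rcons w y (h : word K -> word K -> word K -> K) :
  cut3 (rcons w y) h = cut3 w (fun a s c => h a s (rcons c y))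
                       + cut w (fun a s => h a (rcons s y) [::])
                       + h (rcons w y) [::] [::].
Proof.
rewrite /cut3 cut_rcons cut_nil -cutD; congr (_ + _).
by apply: eq_cut => a r _; rewrite cut_rcons.
Qed.

(** A replaced segment either avoids the last letter of [s] or ends with it. The former give the
    action on [A]; the latter give [mulm A B] if the segment keeps its last v, and [mid A B] if it
    keeps its first. *)
Lemma coder_edge_edgeL A B f s :
  coder (edge B) (fun z => lin (edgeL A z) f) s
    = lin (edgeL (fun z => coder (edge B) A z + mulm A B z) s) f - mid A B f s.
Proof.
case/lastP: s => [|s y].
  by rewrite /coder /cut3 !cut_nil lin_nil lin_edgeL /mid !cut_nil subr0.
rewrite {1}/coder cut3_rcons edgeN lin_nil addr0 lin_edgeL_rcons mulrDl -addrA.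
congr (_ + _).
  rewrite coder_edge_sh /coder mulrC -cut3Z; apply: eq_cut3 => a b c w_eq.
  under eq_lin => l do rewrite -rcons_cons -rcons_cat lin_edgeL_rcons.
  rewrite mulrC -linZr; apply: eq_lin_edge => v.
  by rewrite w_eq !(usum_cat, usum_cons).
rewrite mulm_sh /mid cut_rcons addr0 /mulm -cutZr -cutB.
apply: eq_cut => a b w_eq.
under eq_lin => l do rewrite cats1 lin_edgeL_rcons.
rewrite lin_edge lin_edgeL_rcons; congr (_ - _).
  by rewrite /= w_eq usum_cat !addrA; ring.
rewrite w_eq; case: b {w_eq} => [|x b];
  rewrite lin_seq1 /= !(usum_cat, usum_cons, usum_nil, usum_rcons).
  by rewrite !addr0; ring.
by rewrite -/(rcons b y) !addrA; ring.
Qed.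

(** Mirror image of [coder_edge_edgeL], with [A] and [B] exchanged in the product and in [mid].
    Together the two halves of [edge] contribute [- (mid A B + mid B A)], which is symmetric. *)
Lemma coder_edge_edgeF A B f s :
  coder (edge B) (fun z => lin (edgeF A z) f) s
    = lin (edgeF (fun z => coder (edge B) A z - mulm B A z) s) f + mid B A f s.
Proof.
case: s => [|x s].
  by rewrite /coder /cut3 !cut_nil !lin_nil /mid !cut_nil addr0.
rewrite {1}/coder cut3_cons edgeN lin_nil add0r lin_seq1 /= mulrBl addrC -addrA.
congr (_ + _).
  rewrite coder_edge_sh /coder mulrC -cut3Z; apply: eq_cut3 => a b c w_eq.
  under eq_lin => l do rewrite lin_seq1.
  rewrite mulrC -linZr; apply: eq_lin_edge => v.
  by rewrite w_eq !(usum_cat, usum_cons).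
rewrite addrC mulm_sh /mulm -cutZr.
(* Grouping by the prefix that ends with the surviving letter exhibits [mid] as a sum over
   [edgeL B]. *)
have -> : mid B A f (x :: s) = cut s (fun b c => lin (edgeL B (x :: b))
    (fun l => A (sh c l.2) * f (usum (x :: s), l.2))).
  rewrite /mid; under eq_cut => a r _.
    rewrite -(cut_singleton r (fun y c =>
      B (sh a y.2) * A (sh c y.2) * f (usum (x :: s), y.2))).
    over.
  rewrite cutA cut_cons cut_nil add0r; apply: eq_cut => b c _.
  rewrite lin_edgeL; apply: eq_cut => p q _.
  by case: q => [|y [|z q]] //; rewrite mulrA.
rewrite -cutB; apply: eq_cut => b c w_eq.
under eq_lin => l do rewrite lin_seq1.
rewrite lin_edge lin_seq1 /= mulrA; congr (_ - _ * _); last first.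
  by rewrite w_eq usum_cat addrA.
rewrite !lin_edgeL; apply: eq_cut => p q b_eq.
case: q b_eq => [|y [|z q]] // b_eq.
by rewrite w_eq -cat_cons usum_cat b_eq usum_cat usum_cons usum_nil addr0.
Qed.

Definition arim A B w : K :=
  coder (edge B) A w - coder (edge A) B w + (mulm A B w - mulm B A w).

(** By [coder_comp] only letter components are compared. There the symmetric [mid] terms drop out,
    and both halves produce the same functional [arim A B]. *)
Lemma coder_edge_comm A B F w :
  coder (edge B) (coder (edge A) F) w - coder (edge A) (coder (edge B) F) w
    = coder (edge (arim A B)) F w.
Proof.
rewrite coder_comp; apply: eq_cut3 => a s c _.
set f := fun l => F (a ++ l :: c).
have ext C D : coder (edge C) (fun z => lin (edge D z) f) s
    = coder (edge C) (fun z => lin (edgeL D z) f) s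
    - coder (edge C) (fun z => lin (edgeF D z) f) s.
  rewrite /coder -cut3B; apply: eq_cut3 => ? ? ? _; rewrite -linB.
  by apply: eq_lin => l; rewrite lin_edge.
rewrite 2!ext 2!coder_edge_edgeL 2!coder_edge_edgeF lin_edge.
clear ext; case/lastP: s => [|s y]; first by rewrite !lin_edgeL !cut_nil; ring.
rewrite !lin_edgeL_rcons; case: (rcons s y) => [|x b] /=; first by rewrite !lin_nil /arim; ring.
by rewrite !lin_seq1 /arim /=; ring.
Qed.

End EdgeCommutator.

(** * Shuffle and stuffle products *)

Section QuasiShuffle.
Variable K : comUnitRingType.
Implicit Types (a b c w s x y z : word K) (l m : letter K) (t : K).
Implicit Types (F A B C : word K -> K) (f : letter K -> K) (kap : K -> K -> K).

(* kap = 0 gives the shuffle and kap t t' = (t - t')^-1 the stuffle. *)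
Definition qsh kap : word K -> word K -> lcomb K :=
  fix qsh_rec x :=
  if x is l :: x' then
    fix qsh_x y : lcomb K :=
      if y is m :: y' then
        lc_cons l (qsh_rec x' y) ++ lc_cons m (qsh_x y') ++
        lc_scale (kap l.2 m.2)
          (lc_cons (l.1 + m.1, l.2) (qsh_rec x' y') ++
           lc_scale (-1) (lc_cons (l.1 + m.1, m.2) (qsh_rec x' y')))
      else [:: (1, x)]
  else fun y => [:: (1, y)].

Definition stk t t' : K := (t - t')^-1.
Definition shk t t' : K := 0.

Lemma stuffleE x y : stuffle x y = qsh stk x y.
Proof. by []. Qed.

Lemma lin_qsh0l kap y F : lin (qsh kap [::] y) F = F y.
Proof. by rewrite lin_seq1 mul1r. Qed.

Lemma lin_qsh0r kap x F : lin (qsh kap x [::]) F = F x.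
Proof. by case: x => [|l x]; rewrite lin_seq1 mul1r. Qed.

Lemma lin_qsh_cons kap l x m y F :
  lin (qsh kap (l :: x) (m :: y)) F =
    lin (qsh kap x (m :: y)) (fun z => F (l :: z))
    + lin (qsh kap (l :: x) y) (fun z => F (m :: z))
    + kap l.2 m.2 * (lin (qsh kap x y) (fun z => F ((l.1 + m.1, l.2) :: z))
                     - lin (qsh kap x y) (fun z => F ((l.1 + m.1, m.2) :: z))).
Proof.
rewrite [qsh kap (l :: x) (m :: y)]/= !lin_cat lin_scale lin_cat lin_scale !lin_lcons.
by rewrite addrA mulN1r.
Qed.

Lemma lin_shuf_cons l x m y F :
  lin (qsh shk (l :: x) (m :: y)) F =
    lin (qsh shk x (m :: y)) (fun z => F (l :: z))
    + lin (qsh shk (l :: x) y) (fun z => F (m :: z)).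
Proof. by rewrite lin_qsh_cons mul0r addr0. Qed.

(** Bialgebra compatibility of deconcatenation and quasi-shuffle. It holds for every [kap], since a
    merged letter always falls on one side of a cut. *)
Lemma lin_qsh_cut kap x y (g : word K -> word K -> K) :
  lin (qsh kap x y) (fun z => cut z g)
    = cut x (fun x1 x2 => cut y (fun y1 y2 =>
        lin (qsh kap x1 y1) (fun s => lin (qsh kap x2 y2) (g s)))).
Proof.
elim: x y g => [|l x IHx] y g.
  by rewrite cut_nil lin_qsh0l; apply: eq_cut => a b _; rewrite !lin_qsh0l.
elim: y g => [|m y IHy] g.
  rewrite lin_qsh0r; apply: eq_cut => a b _; rewrite cut_nil.
  by rewrite !lin_qsh0r.
rewrite lin_qsh_cons.
under eq_lin => z do rewrite cut_cons.
under [X in _ + X + _]eq_lin => z do rewrite cut_cons.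
under [X in _ * (X - _)]eq_lin => z do rewrite cut_cons.
under [X in _ * (_ - X)]eq_lin => z do rewrite cut_cons.
rewrite !linD IHx IHy 2!IHx [in RHS]cut_cons [X in _ = X + _]cut_cons.
under [X in _ = _ + X]eq_cut => x1 x2 _.
  rewrite cut_cons lin_qsh0r.
  under eq_cut => y1 y2 _ do rewrite lin_qsh_cons.
  rewrite !cutD cutZ cutB.
  over.
rewrite !cutD cutZ cutB.
under [X in _ + X + _ + _]eq_cut => x1 x2 _ do rewrite cut_cons lin_qsh0r.
rewrite cutD [X in _ + _ + (_ + X)]cut_cons !lin_qsh0l lin_qsh_cons.
have e (h : word K -> word K -> word K -> K) :
    cut y (fun y1 y2 => lin (qsh kap [::] y1) (h y1 y2)) = cut y (fun y1 y2 => h y1 y2 y1).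
  by apply: eq_cut => y1 y2 _; rewrite lin_qsh0l.
have e' (h : word K -> word K -> word K -> K) :
    cut y (fun y1 y2 => lin (qsh kap [::] (m :: y1)) (h y1 y2))
      = cut y (fun y1 y2 => h y1 y2 (m :: y1)).
  by apply: eq_cut => y1 y2 _; rewrite lin_qsh0l.
by rewrite e e'; ring.
Qed.

Lemma cut_if_nill w (g : word K -> word K -> K) :
  cut w (fun a b => if a is [::] then g a b else 0) = g [::] w.
Proof. by case: w => [|l w]; rewrite ?cut_nil // cut_cons cut0 addr0. Qed.

Lemma cut_if_nilr w (g : word K -> word K -> K) :
  cut w (fun a b => if b is [::] then g a b else 0) = g w [::].
Proof.
case/lastP: w => [|w l]; rewrite ?cut_nil // cut_rcons cut_eq0 ?add0r // => a b _.
by case: b.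
Qed.

(** The place of [l] splits [y] into a part shuffled before it and a part shuffled after it. This is
    specific to the shuffle, where [l] never merges with a letter of [y]. *)
Lemma lin_shuf_insert a l c y F :
  lin (qsh shk (a ++ l :: c) y) F =
    cut y (fun y1 y2 => lin (qsh shk a y1) (fun p =>
      lin (qsh shk c y2) (fun q => F (p ++ l :: q)))).
Proof.
elim: a y F => [|n a IHa] y F.
  elim: y F => [|m y IHy] F; first by rewrite cut_nil lin_qsh0l !lin_qsh0r.
  by rewrite lin_shuf_cons IHy cut_cons lin_qsh0l; congr (_ + _);
    apply: eq_cut => y1 y2 _; rewrite !lin_qsh0l.
elim: y F => [|m y IHy] F; first by rewrite cut_nil !lin_qsh0r.
rewrite cat_cons lin_shuf_cons IHa -cat_cons IHy !cut_cons !lin_qsh0r -addrA.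
congr (_ + _); rewrite -cutD; apply: eq_cut => y1 y2 _.
by rewrite lin_shuf_cons.
Qed.

Lemma lin_shuf_rcons x l y m F :
  lin (qsh shk (rcons x l) (rcons y m)) F =
    lin (qsh shk x (rcons y m)) (fun z => F (rcons z l))
    + lin (qsh shk (rcons x l) y) (fun z => F (rcons z m)).
Proof.
have e Y (G : word K -> K) : lin (qsh shk (rcons x l) Y) G
    = cut Y (fun y1 y2 => lin (qsh shk x y1) (fun p => G (p ++ l :: y2))).
  rewrite -cats1 lin_shuf_insert; apply: eq_cut => y1 y2 _.
  by apply: eq_lin => p; rewrite lin_qsh0l.
rewrite !e cut_rcons addrC; congr (_ + _).
  by apply: eq_lin => z; rewrite cats1.
by apply: eq_cut => y1 y2 _; apply: eq_lin => p; rewrite rcons_cat.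
Qed.

(** Merging adds the u's, so all words of the product share one u-sum, which a functional may treat
    as a constant. *)
Lemma lin_qsh_usum kap x y (g : K -> word K -> K) :
  lin (qsh kap x y) (fun z => g (usum z) z) = lin (qsh kap x y) (g (usum x + usum y)).
Proof.
elim: x y g => [|l x IHx] y g; first by rewrite !lin_qsh0l usum_nil add0r.
elim: y g => [|m y IHy] g; first by rewrite !lin_qsh0r usum_nil addr0.
rewrite !lin_qsh_cons.
congr (_ + _ + _ * (_ - _)).
- under eq_lin => z do rewrite usum_cons.
  rewrite (IHx _ (fun u z => g (l.1 + u) (l :: z))).
  by apply: eq_lin => z; rewrite !usum_cons !addrA.
- under eq_lin => z do rewrite usum_cons.
  rewrite (IHy (fun u z => g (m.1 + u) (m :: z))).
  by apply: eq_lin => z; rewrite !usum_cons; congr g; ring.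
- under eq_lin => z do rewrite usum_cons.
  rewrite (IHx _ (fun u z => g (l.1 + m.1 + u) ((l.1 + m.1, l.2) :: z))).
  by apply: eq_lin => z; rewrite !usum_cons; congr g; ring.
under eq_lin => z do rewrite usum_cons.
rewrite (IHx _ (fun u z => g (l.1 + m.1 + u) ((l.1 + m.1, m.2) :: z))).
by apply: eq_lin => z; rewrite !usum_cons; congr g; ring.
Qed.

Lemma lin_shuf_sh x y t F :
  lin (qsh shk (sh x t) (sh y t)) F = lin (qsh shk x y) (fun z => F (sh z t)).
Proof.
elim: x y F => [|l x IHx] y F; first by rewrite !lin_qsh0l.
elim: y F => [|m y IHy] F; first by rewrite !lin_qsh0r.
rewrite [LHS]lin_shuf_cons [RHS]lin_shuf_cons.
by rewrite -[_ :: map _ y]/(sh (m :: y) t) -[_ :: map _ x]/(sh (l :: x) t) IHx IHy.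
Qed.

End QuasiShuffle.

Arguments stk {K}.
Arguments shk {K}.

Ltac perm_count :=
  apply/permP => ?; rewrite -?cats1;
  repeat first [rewrite count_cat | progress simpl]; first [lia | ring].

(** * Classes of words stable under the operations *)

Section Closed.
Variable K : comUnitRingType.
Implicit Types (a b c w s x y z : word K) (l m : letter K) (t : K).
Implicit Types (F A B C : word K -> K) (f : letter K -> K) (kap : K -> K -> K).

(* Stability of the words at which rational bimoulds can be evaluated under the
   operations occurring in flexions and stuffles. *)
Record closed_words (P : word K -> Prop) : Prop := ClosedWords {
  cw_perm : forall w w', perm_eq w w' -> P w -> P w';
  cw_behead : forall l w, P (l :: w) -> P w;
  cw_merge : forall l m w, P (l :: m :: w) -> P ((l.1 + m.1, l.2) :: w);
  cw_sh : forall l w, P (l :: w) -> P (sh w l.2);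
  cw_unit : forall l m w, P (l :: m :: w) -> l.2 - m.2 \is a GRing.unit }.

Variable P : word K -> Prop.
Hypothesis cP : closed_words P.

Lemma cw_sub w' r w : perm_eq w (w' ++ r) -> P w -> P w'.
Proof.
move=> e /(cw_perm cP e); have := permEl (perm_catC w' r).
move=> {}e /(cw_perm cP e); elim: r {e} => [|l r IHr] //.
by move=> /(cw_behead cP).
Qed.

Lemma cw_letter l c s :
  P (rcons s l ++ c) -> P ((usum s + l.1, l.2) :: c).
Proof.
move=> H; have {H} : P (l :: s ++ c).
  by apply: cw_perm H => //; perm_count.
elim: s l => [|m s IHs] l H; first by rewrite usum_nil add0r -surjective_pairing.
have := IHs _ (cw_merge cP H).
by rewrite usum_cons /= [m.1 + _]addrC [l.1 + m.1]addrC addrA.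
Qed.

(** The prefix [a] collects the letters already output: membership in [P] concerns the whole word,
    so the induction must remember them. *)
Lemma cw_qsh kap a x y k : P (a ++ x ++ y) -> k \in qsh kap x y -> P (a ++ k.2).
Proof.
elim: x a y k => [|l x IHx] a y k Pw; first by rewrite inE => /eqP->.
elim: y a k Pw => [|m y IHy] a k Pw.
  by rewrite inE => /eqP-> /=; rewrite cats0 in Pw.
rewrite [qsh _ _ _]/= !mem_cat => /orP[/mapP[k' k'in ->]|] /=.
  by rewrite -cat_rcons; apply: IHx k'in; rewrite cat_rcons.
case/orP=> [/mapP[k' k'in ->]|] /=.
  rewrite -cat_rcons; apply: IHy k'in; apply: cw_perm Pw => //.
  by perm_count.
have Pm l' : l' = (l.1 + m.1, l.2) \/ l' = (l.1 + m.1, m.2) -> P (rcons a l' ++ x ++ y).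
  move=> e; suff: P (l' :: a ++ x ++ y).
    apply: (cw_perm cP); perm_count.
  case: e => ->; last rewrite addrC; apply: (cw_merge cP); apply: cw_perm Pw => //;
    by perm_count.
move=> /mapP[k' ]; rewrite mem_cat => /orP[] /mapP[k'' k''in ->] -> /=.
  rewrite -cat_rcons; apply: IHx k''in; apply: Pm; by left.
move: k''in => /mapP[k3 k3in ->] /=.
rewrite -cat_rcons; apply: IHx k3in; apply: Pm; by right.
Qed.

Lemma lin_ext_in (T : eqType) (X : seq (K * T)) (F F' : T -> K) :
  (forall k, k \in X -> F k.2 = F' k.2) -> lin X F = lin X F'.
Proof. by move=> e; apply: eq_big_seq => k /e->. Qed.

Lemma lin_qsh_ext kap x y F F' : P (x ++ y) ->
  (forall z, P z -> F z = F' z) -> lin (qsh kap x y) F = lin (qsh kap x y) F'.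
Proof.
move=> Pw e; apply: lin_ext_in => k kin; apply: e.
exact: (@cw_qsh _ [::] _ _ _ Pw kin).
Qed.

End Closed.

(** * Alternality is preserved by ari *)

Section Alternal.
Variable K : comUnitRingType.
Implicit Types (a b c w s x y z : word K) (l m : letter K) (t : K).
Implicit Types (F A B C : word K -> K) (f : letter K -> K) (kap : K -> K -> K).
Variable P : word K -> Prop.
Hypothesis cP : closed_words P.

(** Alternality for [kap = shk] and alternility for [kap = stk], tested only on words of the class
    [P]. *)
Definition vanishes_on kap F := forall x y, x <> [::] -> y <> [::] -> P (x ++ y) ->
  lin (qsh kap x y) F = 0.

(** The surviving letter comes from [x] or from [y], and [B] sees the shuffle of what is left; this
    vanishes unless the word that provided the letter consisted of it alone. The boundary terms [S]
    so obtained are the same for the two halves of [edge]. *)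
Lemma shuf_edge B x y f : vanishes_on shk B -> x <> [::] -> y <> [::] -> P (x ++ y) ->
  lin (qsh shk x y) (fun s => lin (edge B s) f) = 0.
Proof.
move=> aB x0 y0 Pxy.
pose g l x y := if x is [::] then B (sh y l.2) else 0.
have H l x' y' : y' <> [::] -> P (l :: x' ++ y') ->
    lin (qsh shk x' y') (fun z => B (sh z l.2) * f (usum z + l.1, l.2))
    = g l x' y' * f (usum x' + usum y' + l.1, l.2).
  move=> y'0 Pl; rewrite (lin_qsh_usum _ _ _ (fun u z => B (sh z l.2) * f (u + l.1, l.2))).
  rewrite linZr; congr (_ * _); case: x' Pl => [|m x'] Pl; first by rewrite lin_qsh0l.
  rewrite -lin_shuf_sh aB //; first by case: y' y'0 {Pl}.
  by rewrite -sh_cat; apply: cw_sh Pl.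
have H' l x' y' : x' <> [::] -> P (l :: x' ++ y') ->
    lin (qsh shk x' y') (fun z => B (sh z l.2) * f (usum z + l.1, l.2))
    = g l y' x' * f (usum x' + usum y' + l.1, l.2).
  move=> x'0 Pl; rewrite (lin_qsh_usum _ _ _ (fun u z => B (sh z l.2) * f (u + l.1, l.2))).
  rewrite linZr; congr (_ * _); case: y' Pl => [|m y'] Pl; first by rewrite lin_qsh0r.
  rewrite -lin_shuf_sh aB //; first by case: x' x'0 {Pl}.
  by rewrite -sh_cat; apply: cw_sh Pl.
pose S x y := if x is l :: _
  then (if x is [:: l] then B (sh y l.2) else 0) * f (usum x + usum y, l.2) else 0.
under eq_lin => s do rewrite lin_edge.
rewrite linB; apply/eqP; rewrite subr_eq0; apply/eqP.
transitivity (S x y + S y x).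
  case/lastP: x x0 Pxy => [|x l] // _; case/lastP: y y0 => [|y m] // _ Pxy.
  rewrite lin_shuf_rcons; congr (_ + _).
    under eq_lin => z do rewrite lin_edgeL_rcons.
    have c1 : rcons y m <> [::] by case: (y).
    have c2 : P (l :: x ++ rcons y m) by apply: cw_perm Pxy => //; perm_count.
    rewrite H //.
    rewrite /g /S; case: x {Pxy c1 c2} => [|n x] /=; last by case: (x) => *; rewrite !mul0r.
    by rewrite !(usum_cons, usum_rcons, usum_nil); congr (_ * f (_, _)); ring.
  under eq_lin => z do rewrite lin_edgeL_rcons.
  have c1 : rcons x l <> [::] by case: (x).
  have c2 : P (m :: rcons x l ++ y) by apply: cw_perm Pxy => //; perm_count.
  rewrite H' //.
  rewrite /g /S; case: y {Pxy c1 c2} => [|n y] /=; last by case: (y) => *; rewrite !mul0r.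
  by rewrite !(usum_cons, usum_rcons, usum_nil); congr (_ * f (_, _)); ring.
case: x x0 Pxy => [|l x] // _; case: y y0 => [|m y] // _ Pxy.
rewrite lin_shuf_cons; congr (_ + _); under eq_lin => z do rewrite lin_seq1 [_ + usum z]addrC /=.
  rewrite H //; rewrite /g /S; case: x {Pxy} => [|n x] /=; last by rewrite !mul0r.
  by rewrite !(usum_cons, usum_rcons, usum_nil); congr (_ * f (_, _)); ring.
rewrite H' //; last by apply: cw_perm Pxy => //; perm_count.
rewrite /g /S; case: y {Pxy} => [|n y] /=; last by rewrite !mul0r.
by rewrite !(usum_cons, usum_rcons, usum_nil); congr (_ * f (_, _)); ring.
Qed.

Lemma lin_shufC x y F : lin (qsh shk x y) F = lin (qsh shk y x) F.
Proof.
elim: x y F => [|l x IHx] y F; first by rewrite lin_qsh0l lin_qsh0r.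
elim: y F => [|m y IHy] F; first by rewrite !lin_qsh0l ?lin_qsh0r.
by rewrite !lin_shuf_cons IHx IHy addrC.
Qed.

Lemma cw_edge B p s q k : P (p ++ s ++ q) -> k \in edge B s -> P (p ++ k.2 :: q).
Proof.
move=> Pw kin; suff [s1 [m [s2 [-> e]]]] :
    exists s1 m s2, k.2 = (usum s1 + m.1, m.2) /\ perm_eq s (rcons s1 m ++ s2).
  have /(cw_letter cP) : P (rcons s1 m ++ p ++ q).
    apply: (@cw_sub _ _ cP _ s2) Pw; apply/permP => o; move/permP: e => /(_ o).
    rewrite -cats1; repeat first [rewrite count_cat | progress simpl]; lia.
  by apply: (cw_perm cP); perm_count.
move: kin; rewrite mem_cat => /orP[|].
  case/flattenP => X /mapP[[a b] abin ->] /=; case: b abin => [|y [|]] // abin.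
  rewrite inE => /eqP->; exists a, y, [::]; split=> //; rewrite cats0.
  case/mapP: abin => j _ [-> e].
  by rewrite -cats1 e cat_take_drop.
case/mapP => k'; case: s {Pw} => [|x s] //; rewrite inE => /eqP-> -> /=.
exists s, x, [::]; split; first by rewrite addrC.
by rewrite cats0; perm_count.
Qed.

(** Cut the shuffle in three. By [shuf_edge] the middle pieces contribute only if one of them is
    empty; the letter replacing the other is then part of an ordinary shuffle ([lin_shuf_insert]),
    on which [A] vanishes. *)
Lemma shuf_coder_edge A B :
  vanishes_on shk A -> vanishes_on shk B -> vanishes_on shk (coder (edge B) A).
Proof.
move=> aA aB x y x0 y0 Pxy; rewrite /coder.
rewrite lin_qsh_cut.
under eq_cut => x1 xr x_eq.
  under eq_cut => y1 yr y_eq.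
    under eq_lin => a.
      rewrite lin_qsh_cut.
      under eq_cut => x2 x3 xr_eq.
        under eq_cut => y2 y3 yr_eq.
          under eq_lin => s do rewrite lin_exchange.
          have -> : lin (qsh shk x2 y2) (fun s => lin (edge B s) (fun l =>
                  lin (qsh shk x3 y3) (fun c => A (a ++ l :: c)))) =
            (if y2 is [::] then lin (edge B x2) (fun l =>
                  lin (qsh shk x3 y3) (fun c => A (a ++ l :: c))) else 0)
            + (if x2 is [::] then lin (edge B y2) (fun l =>
                  lin (qsh shk x3 y3) (fun c => A (a ++ l :: c))) else 0).
            case: x2 xr_eq => [|n x2] xr_eq.
              by case: y2 yr_eq => *; rewrite lin_qsh0l ?edgeN ?lin_nil ?add0r.
            case: y2 yr_eq => [|n' y2] yr_eq; first by rewrite lin_qsh0r addr0.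
            rewrite addr0; apply: shuf_edge => //.
            apply: (@cw_sub _ _ cP _ (x1 ++ x3 ++ y1 ++ y3)) Pxy.
            by rewrite x_eq y_eq xr_eq yr_eq; perm_count.
          over.
        rewrite cutD cut_if_nill.
        over.
      rewrite cutD [X in _ + X]cut_cut.
      under [X in _ + X]eq_cut => ? ? _ do rewrite cut_if_nill.
      over.
    rewrite linD -!cut_lin.
    over.
  rewrite cutD.
  over.
rewrite cutD; under eq_cut => a b _ do rewrite cut_cut.
rewrite cut_eq0 ?add0r => [|x1 xr x_eq].
  rewrite cut_cut; apply: cut_eq0 => y1 yr y_eq.
  rewrite cut_cut; apply: cut_eq0 => y2 y3 yr_eq.
  under eq_cut => a b _ do rewrite lin_exchange.
  rewrite cut_lin -[RHS](lin0 (edge B y2)).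
  apply: (lin_ext_in) => k kin.
  under eq_cut => a b _.
    rewrite lin_shufC; under eq_lin => t do rewrite lin_shufC.
    over.
  rewrite -lin_shuf_insert aA //; first by case: (y1).
  apply: cw_perm (_ : P ((y1 ++ k.2 :: y3) ++ x)) => //.
  rewrite -catA; apply: (cw_edge _ kin); apply: cw_perm Pxy => //.
  by rewrite y_eq yr_eq; perm_count.
apply: cut_eq0 => x2 x3 xr_eq.
under eq_cut => a b _ do rewrite lin_exchange.
rewrite cut_lin -[RHS](lin0 (edge B x2)).
apply: lin_ext_in => k kin; rewrite -lin_shuf_insert aA //; first by case: (x1).
rewrite -catA; apply: (cw_edge _ kin); apply: cw_perm Pxy => //.
by rewrite x_eq xr_eq; perm_count.
Qed.

(** Only the two cuts separating [x] from [y] survive. The value is symmetric in [A] and [B], so it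
    disappears from the commutator in [arim]. *)
Lemma shuf_mulm A B x y : A [::] = 0 -> B [::] = 0 ->
  vanishes_on shk A -> vanishes_on shk B -> x <> [::] -> y <> [::] -> P (x ++ y) ->
  lin (qsh shk x y) (mulm A B) = A y * B x + A x * B y.
Proof.
move=> A0 B0 aA aB x0 y0 Pxy; rewrite lin_qsh_cut.
have split C u v : C [::] = 0 -> vanishes_on shk C -> P (u ++ v) ->
  lin (qsh shk u v) C = (if u is [::] then C v else 0) + (if v is [::] then C u else 0).
  move=> C0 aC Puv; case: u Puv => [|l u] Puv.
    by rewrite lin_qsh0l; case: {Puv} v => [|m v] /=; rewrite ?C0 addr0.
  by case: v Puv => [|m v] Puv; rewrite add0r ?lin_qsh0r // aC.
under eq_cut => x1 x2 x_eq.
  under eq_cut => y1 y2 y_eq.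
    under eq_lin => s do rewrite linZ.
    rewrite linZr split // ?split //; first last.
      by apply: (@cw_sub _ _ cP _ (x2 ++ y2)) Pxy; rewrite x_eq y_eq; perm_count.
      by apply: (@cw_sub _ _ cP _ (x1 ++ y1)) Pxy; rewrite x_eq y_eq; perm_count.
    over.
  have -> : cut y (fun y1 y2 =>
      ((if x1 is [::] then A y1 else 0) + (if y1 is [::] then A x1 else 0))
      * ((if x2 is [::] then B y2 else 0) + (if y2 is [::] then B x2 else 0)))
    = (if x1 is [::] then A y * B x2 else 0) + (if x2 is [::] then A x1 * B y else 0).
    case: x1 x_eq => [|l x1] x_eq; case: x2 x_eq => [|m x2] x_eq //.
    - rewrite addr0 -(cut_if_nilr y (fun a b => A a * B (m :: x2))).
      apply: eq_cut => y1 y2 _; rewrite add0r; case: y2 => [|? ?] /=; rewrite ?mulr0 //.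
      by case: y1 => [|? ?] /=; rewrite ?A0 addr0.
    - rewrite add0r -(cut_if_nill y (fun a b => A (l :: x1) * B b)).
      apply: eq_cut => y1 y2 _; rewrite add0r; case: y1 => [|? ?] /=; rewrite ?mul0r //.
      by case: y2 => [|? ?] /=; rewrite ?B0 addr0.
    rewrite !addr0; apply: cut_eq0 => y1 y2 y_eq; rewrite !add0r.
    case: y1 y_eq => [|? ?]; rewrite ?mul0r //; case: y2 => [|? ?]; rewrite ?mulr0 //.
  over.
by rewrite cutD cut_if_nill cut_if_nilr.
Qed.

Lemma shuf_arim A B : A [::] = 0 -> B [::] = 0 ->
  vanishes_on shk A -> vanishes_on shk B -> vanishes_on shk (arim A B).
Proof.
move=> A0 B0 aA aB x y x0 y0 Pxy; rewrite /arim linD !linB.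
by rewrite !shuf_coder_edge // !shuf_mulm //; ring.
Qed.

End Alternal.

(** * The coalgebra morphism dual to ganit *)

Section Segments.
Variable K : comUnitRingType.
Implicit Types (a b w s x y z : word K) (l m : letter K) (t u : K).
Implicit Types (F A B : word K -> K) (f : letter K -> K) (c : word K -> K).

Definition collapse s : letter K := (usum s, (head (0, 0) s).2).

Lemma collapse_cons l s : collapse (l :: s) = (l.1 + usum s, l.2).
Proof. by rewrite /collapse usum_cons. Qed.

Lemma collapse1 l : collapse [:: l] = l.
Proof. by rewrite collapse_cons usum_nil addr0 -surjective_pairing. Qed.

(* Cut w into nonempty segments, each collapsed to a letter with weight given by
   c; n bounds the recursion depth. *)
Fixpoint gan_rec c n w : lcomb K :=
  if w is l :: w' then
    if n is n'.+1 then
      flatten [seq lc_scale (c (l :: p.1)) (lc_cons (collapse (l :: p.1)) (gan_rec c n' p.2))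
              | p <- cuts2 w']
    else [::]
  else [:: (1, [::])].

Definition gan c w : lcomb K := gan_rec c (size w) w.

Lemma lin_gan0 c F : lin (gan c [::]) F = F [::].
Proof. by rewrite lin_seq1 mul1r. Qed.

Lemma lin_gan_rec c n l w F :
  lin (gan_rec c n.+1 (l :: w)) F = cut w (fun a b =>
    c (l :: a) * lin (gan_rec c n b) (fun z => F (collapse (l :: a) :: z))).
Proof.
rewrite -[gan_rec _ _ _]/(flatten [seq lc_scale (c (l :: p.1))
  (lc_cons (collapse (l :: p.1)) (gan_rec c n p.2)) | p <- cuts2 w]) lin_flatten.
apply: eq_bigr => p _.
by rewrite lin_scale lin_lcons.
Qed.

Lemma lin_gan_fuel c n w F : (size w <= n)%N -> lin (gan_rec c n w) F = lin (gan c w) F.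
Proof.
rewrite /gan; elim: n {-2}n (leqnn n) w F => [|N IHN] [|n] lenN [|l w] F //= lewn.
rewrite -!/(gan_rec _ _.+1 (_ :: _)) 2!lin_gan_rec; apply: eq_cut => a b w_eq.
have lebw : (size b <= size w)%N by rewrite w_eq size_cat leq_addl.
congr (_ * _); rewrite (IHN n) ?(IHN (size w)) //.
  exact: leq_trans lewn lenN.
exact: leq_trans lebw lewn.
Qed.

Lemma lin_gan_cons c l w F :
  lin (gan c (l :: w)) F = cut w (fun a b =>
    c (l :: a) * lin (gan c b) (fun z => F (collapse (l :: a) :: z))).
Proof.
rewrite lin_gan_rec; apply: eq_cut => a b w_eq.
by rewrite lin_gan_fuel // -/(size w) w_eq size_cat leq_addl.
Qed.

Lemma size_word_ind (Q : word K -> Prop) :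
  (forall w, (forall w', (size w' < size w)%N -> Q w') -> Q w) -> forall w, Q w.
Proof.
move=> ind w; elim: (size w) {-2}w (leqnn (size w)) => [|n IHn] {}w lewn;
  apply: ind => w' ltw'w; first by move: (leq_trans ltw'w lewn).
by apply: IHn; rewrite -ltnS (leq_trans ltw'w).
Qed.

Lemma size_cat_ltS l a b : (size b < size (l :: a ++ b))%N.
Proof. by rewrite /= size_cat ltnS leq_addl. Qed.

(** Coalgebra morphism property: a cut of the collapsed word falls between two segments, hence comes
    from a cut of [w]. *)
Lemma lin_gan_cut c w (h : word K -> word K -> K) :
  lin (gan c w) (fun z => cut z h)
    = cut w (fun w1 w2 => lin (gan c w1) (fun z1 => lin (gan c w2) (h z1))).
Proof.
elim/size_word_ind: w h => -[|l w] IHw h; first by rewrite !(cut_nil, lin_gan0).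
rewrite lin_gan_cons cut_cons lin_gan0.
under [X in _ = _ + X]eq_cut => a b _ do rewrite lin_gan_cons.
rewrite lin_gan_cons -cutA -cutD; apply: eq_cut => a b w_eq.
rewrite cutZ -mulrDr; congr (_ * _).
under eq_lin => z do rewrite cut_cons.
by rewrite linD IHw // w_eq; apply: size_cat_ltS.
Qed.

Lemma lin_gan_mulm c w A B :
  lin (gan c w) (mulm A B) = mulm (fun z => lin (gan c z) A) (fun z => lin (gan c z) B) w.
Proof.
rewrite lin_gan_cut; apply: eq_cut => a b _; under eq_lin => z do rewrite linZ.
by rewrite linZr.
Qed.

Lemma lin_gan_usum c w (g : K -> word K -> K) :
  lin (gan c w) (fun z => g (usum z) z) = lin (gan c w) (g (usum w)).
Proof.
elim/size_word_ind: w g => -[|l w] IHw g; first by rewrite !lin_gan0.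
rewrite !lin_gan_cons; apply: eq_cut => a b w_eq; congr (_ * _).
under eq_lin => z do rewrite usum_cons.
rewrite (IHw b _ (fun u z => g ((collapse (l :: a)).1 + u) (collapse (l :: a) :: z))).
  by apply: eq_lin => z; rewrite w_eq collapse_cons usum_cons usum_cat addrA.
by rewrite w_eq; apply: size_cat_ltS.
Qed.

(** A run of consecutive segments is again a segment, so two collapses compose to one; its weight is
    the letter component of the composite. *)
Lemma lin_gan_comp c c' w F :
  lin (gan c w) (fun z => lin (gan c' z) F)
    = lin (gan (fun s => lin (gan c s) c') w) F.
Proof.
elim/size_word_ind: w F => -[|l w] IHw F; first by rewrite !lin_gan0.
rewrite !lin_gan_cons.
transitivity (cut w (fun r b => cut r (fun a1 a2 =>
    c (l :: a1) * lin (gan c a2) (fun z => c' (collapse (l :: a1) :: z))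
    * lin (gan (fun s => lin (gan c s) c') b) (fun z => F (collapse (l :: a1 ++ a2) :: z)))));
  last first.
  apply: eq_cut => a b _; rewrite lin_gan_cons -cutZr.
  by apply: eq_cut => a1 a2 ->.
rewrite -cutA; apply: eq_cut => a b w_eq.
under eq_lin => z do rewrite lin_gan_cons.
rewrite lin_gan_cut -cutZ; apply: eq_cut => b1 b2 b_eq; rewrite -mulrA; congr (_ * _).
under eq_lin => z.
  rewrite linZ IHw; last first.
    by rewrite w_eq b_eq catA; apply: size_cat_ltS.
  rewrite [collapse (_ :: z)]collapse_cons.
  over.
rewrite (lin_gan_usum c b1 (fun u z => c' (collapse (l :: a) :: z) *
  lin (gan (fun s => lin (gan c s) c') b2)
    (fun z' => F (((collapse (l :: a)).1 + u, (collapse (l :: a)).2) :: z')))).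
rewrite linZr; congr (_ * _); apply: eq_lin => z.
by rewrite !collapse_cons usum_cat addrA.
Qed.

Lemma lin_gan_id c w F :
  (forall l s, c (l :: s) = (nilp s)%:R) -> lin (gan c w) F = F w.
Proof.
move=> c1; elim: w F => [|l w IHw] F; first by rewrite lin_gan0.
rewrite lin_gan_cons -[RHS](cut_if_nill w (fun _ b => F (l :: b))).
apply: eq_cut => a b; rewrite c1; case: a => [|? ?]; rewrite ?mul0r //= => <-.
by rewrite mul1r IHw collapse1.
Qed.

Lemma lin_gan_insert c a l b F :
  lin (gan c (a ++ l :: b)) F = cut a (fun a1 a2 => cut b (fun b1 b2 =>
    c (a2 ++ l :: b1) * lin (gan c a1) (fun p => lin (gan c b2) (fun q =>
      F (p ++ collapse (a2 ++ l :: b1) :: q))))).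
Proof.
elim/size_word_ind: a F => -[|n a] IHa F.
  by rewrite cut_nil lin_gan_cons; apply: eq_cut => b1 b2 _; rewrite lin_gan0.
rewrite cat_cons lin_gan_cons cut_cat_cons cut_cons addrC; congr (_ + _).
  by apply: eq_cut => b1 b2 _; rewrite lin_gan0.
under [RHS]eq_cut => a1 a2 _.
  under eq_cut => b1 b2 _ do rewrite lin_gan_cons -cutZ.
  rewrite cut_cut.
  over.
rewrite -cutA; apply: eq_cut => a1 a2 a_eq; rewrite IHa; last first.
  by rewrite a_eq; apply: size_cat_ltS.
rewrite -cutZ; apply: eq_cut => a3 a4 _; rewrite -cutZ; apply: eq_cut => b1 b2 _.
by rewrite mulrCA.
Qed.

(** Intertwining may be checked on letter components: both sides collapse the outer parts of [w] and
    turn one inner factor [s] into a letter, and the hypothesis compares what happens inside [s]. *)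
Lemma lin_gan_coder c E E' F w :
  (forall p s q f, w = p ++ s ++ q -> lin (gan c s) (fun z => lin (E z) f)
      = coder E' (fun z => c z * f (collapse z)) s) ->
  lin (gan c w) (coder E F) = coder E' (fun z => lin (gan c z) F) w.
Proof.
move=> cE; rewrite lin_gan_cut.
under eq_cut => a r _.
  under eq_lin => p do rewrite lin_gan_cut.
  rewrite -cut_lin.
  over.
rewrite [RHS]/coder.
under [RHS]eq_cut3 => a s q _.
  under eq_lin => l.
    rewrite lin_gan_insert.
    over.
  rewrite -cut_lin.
  under eq_cut => a1 a2 _ do rewrite -cut_lin.
  over.
rewrite [RHS]cut3_cut_cut; apply: eq_cut => a r w_eq; apply: eq_cut => s q r_eq.
under eq_lin => p.
  under eq_lin => z do rewrite lin_exchange.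
  over.
rewrite lin_exchange; under eq_lin => z do rewrite lin_exchange.
rewrite (cE a s q (fun l => lin (gan c a) (fun p => lin (gan c q) (fun q' => F (p ++ l :: q'))))).
  by [].
by rewrite w_eq r_eq.
Qed.

Lemma lin_gan_sh c w t F : (forall s, c (sh s t) = c s) ->
  lin (gan c (sh w t)) F = lin (gan c w) (fun z => F (sh z t)).
Proof.
move=> csh; elim/size_word_ind: w F => -[|l w] IHw F; first by rewrite !lin_gan0.
rewrite [sh _ _]/= -/(sh w t) !lin_gan_cons cut_sh; apply: eq_cut => a b w_eq.
rewrite -[_ :: sh a t]/(sh (l :: a) t) csh IHw; last by rewrite w_eq; apply: size_cat_ltS.
by rewrite /collapse usum_cons usum_sh usum_cons.
Qed.

End Segments.

(** * The morphisms for pic and poc *)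

Section PicPoc.
Variable K : comUnitRingType.
Implicit Types (a b w s x y z : word K) (l m : letter K) (t u : K).
Implicit Types (F A B : word K -> K) (f : letter K -> K) (c : word K -> K).

(** [star t z] and [chain t z] are the values of pic and poc at [z] with [t] subtracted from every
    v. The sign of poc is absorbed in the first factor of [chain]. *)
Definition star t z : K := \prod_(l <- z) (l.2 - t)^-1.

Fixpoint chain t z : K := if z is l :: z' then (t - l.2)^-1 * chain l.2 z' else 1.

Definition cpic s : K := if s is l :: z then star l.2 z else 1.
Definition cpoc s : K := if s is l :: z then chain l.2 z else 1.

Lemma star_nil t : star t [::] = 1.
Proof. exact: big_nil. Qed.

Lemma star_cons t l z : star t (l :: z) = (l.2 - t)^-1 * star t z.
Proof. exact: big_cons. Qed.

Lemma star_cat t a b : star t (a ++ b) = star t a * star t b.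
Proof. exact: big_cat. Qed.

Lemma invBr t u : (t - u)^-1 = - (u - t)^-1.
Proof. by rewrite -invrN opprB. Qed.

Lemma cpic_sh s t : cpic (sh s t) = cpic s.
Proof.
case: s => //= l s; rewrite /star big_map; apply: eq_bigr => m _ /=.
by congr (_^-1); ring.
Qed.

(* Each gap of the word is either a cut, contributing 1/(v_j - v_1), or not,
   contributing 1/(v_(j-1) - v_j); the two choices cancel at the first gap. *)
Lemma gan_cpoc_cpic l s : lin (gan cpoc (l :: s)) cpic = (nilp s)%:R.
Proof.
rewrite lin_gan_cons.
have gaps t u w : cut w (fun a b => chain u a * lin (gan cpoc b) (star t))
    = (fix gaps u w := if w is m :: w' then ((m.2 - t)^-1 + (u - m.2)^-1) * gaps m.2 w'
                       else 1) u w.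
  elim: w u => [|m w IHw] u; first by rewrite cut_nil lin_gan0 star_nil mulr1.
  rewrite -IHw cut_cons lin_gan_cons mul1r mulrDl -!cutZ; congr (_ + _).
    apply: eq_cut => a b _; under eq_lin => z do rewrite star_cons.
    by rewrite linZ /=; ring.
  by apply: eq_cut => a b _ /=; rewrite mulrA.
have := gaps l.2 l.2 s; rewrite /cpic => ->; case: s => [|m s] //.
by rewrite [(m.2 - _)^-1]invBr addNr mul0r.
Qed.

(** The next letter [m] either joins the segment of [l] or opens a new one, with the opposite
    weights [(m.2 - l.2)^-1] and [(l.2 - m.2)^-1]. The cofactors [W l s] and [W m s] agree by
    induction. *)
Lemma gan_cpic_cpoc l s : lin (gan cpic (l :: s)) cpoc = (nilp s)%:R.
Proof.
rewrite lin_gan_cons.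
pose W m w := cut w (fun a b => star m.2 a * lin (gan cpic b) (chain m.2)).
have step (m n : letter K) w : lin (gan cpic (n :: w)) (chain m.2) = (m.2 - n.2)^-1 * W n w.
  rewrite lin_gan_cons -cutZ; apply: eq_cut => a b _ /=.
  by rewrite linZ; ring.
rewrite -[LHS]/(W l s); elim: s l => [|m s IHs] l.
  by rewrite /W cut_nil lin_gan0 mulr1 star_nil.
rewrite /W cut_cons star_nil mul1r step.
under eq_cut => a b _ do rewrite star_cons -mulrA.
by rewrite cutZ -/(W l s) !IHs [(m.2 - _)^-1]invBr mulNr subrr.
Qed.

Lemma gan_cpocK F w : lin (gan cpoc w) (fun z => lin (gan cpic z) F) = F w.
Proof. by rewrite lin_gan_comp lin_gan_id // => l s; rewrite gan_cpoc_cpic. Qed.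

Lemma gan_cpicK F w : lin (gan cpic w) (fun z => lin (gan cpoc z) F) = F w.
Proof. by rewrite lin_gan_comp lin_gan_id // => l s; rewrite gan_cpic_cpoc. Qed.

Lemma subrV_unit t u : t \is a GRing.unit -> u \is a GRing.unit ->
  t - u \is a GRing.unit -> (t - u)^-1 * (t^-1 - u^-1) = - (t^-1 * u^-1).
Proof.
move=> ut uu utu; apply: (mulrI utu); rewrite mulVKr //.
rewrite -{1}[t^-1]mulr1 -{1}[u^-1]mul1r -{1}(mulrV uu) -{1}(mulrV ut); ring.
Qed.

Section Closed.
Variable P : word K -> Prop.
Hypothesis cP : closed_words P.

Lemma cw_unit2 a l b m d : P (a ++ l :: b ++ m :: d) ->
  (l.2 - m.2 \is a GRing.unit) && (m.2 - l.2 \is a GRing.unit).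
Proof.
move=> Pw; apply/andP; split.
  by apply: (cw_unit cP (w := a ++ b ++ d)); apply: cw_perm Pw => //; perm_count.
by apply: (cw_unit cP (w := a ++ b ++ d)); apply: cw_perm Pw => //; perm_count.
Qed.

(** Either choice of first letter gives the full product, and by partial fractions the merged
    letters remove one of the two copies. *)
Lemma stuffle_star n x y : P (n :: x ++ y) ->
  lin (qsh stk x y) (star n.2) = star n.2 x * star n.2 y.
Proof.
elim: x y => [|l x IHx] y Pw; first by rewrite lin_qsh0l star_nil mul1r.
elim: y Pw => [|m y IHy] Pw; first by rewrite lin_qsh0r star_nil mulr1.
have /andP[_ ul] := @cw_unit2 [::] n [::] l _ Pw.
have /andP[_ um] := @cw_unit2 [::] n (l :: x) m y Pw.
have /andP[ulm _] := @cw_unit2 [:: n] l x m y Pw.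
have e X (k : letter K) : lin X (fun z => star n.2 (k :: z)) = (k.2 - n.2)^-1 * lin X (star n.2).
  by rewrite -linZ; apply: eq_lin => z; rewrite star_cons.
have Px : P (n :: x ++ m :: y) by apply: (@cw_sub _ _ cP _ [:: l]) Pw; perm_count.
have Py : P (n :: (l :: x) ++ y) by apply: (@cw_sub _ _ cP _ [:: m]) Pw; perm_count.
have Pxy : P (n :: x ++ y) by apply: (@cw_sub _ _ cP _ [:: l; m]) Pw; perm_count.
rewrite lin_qsh_cons !e IHx // IHy // IHx // !star_cons /= /stk.
have := subrV_unit ul um; rewrite (_ : _ - _ - _ = l.2 - m.2); last by ring.
move=> /(_ ulm); set i := (l.2 - n.2)^-1; set j := (m.2 - n.2)^-1; set k := (l.2 - m.2)^-1 => ij.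
set X := star _ x; set Y := star _ y.
transitivity ((i * j) * (X * Y) *+ 2 + (k * (i - j)) * (X * Y)); first by ring.
by rewrite ij; ring.
Qed.

(** With n, l, m standing for the v's, the two choices of first letter add up by 1/((n-l)(l-m)) +
    1/((n-m)(m-l)) = 1/((n-l)(n-m)). *)
Lemma shuf_chain n x y : P (n :: x ++ y) ->
  lin (qsh shk x y) (chain n.2) = chain n.2 x * chain n.2 y.
Proof.
elim: x n y => [|l x IHx] n y Pw; first by rewrite lin_qsh0l mul1r.
elim: y n Pw => [|m y IHy] n Pw; first by rewrite lin_qsh0r mulr1.
have /andP[ul _] := @cw_unit2 [::] n [::] l _ Pw.
have /andP[um _] := @cw_unit2 [::] n (l :: x) m y Pw.
have /andP[_ ulm] := @cw_unit2 [:: n] l x m y Pw.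
have Px : P (l :: x ++ m :: y) by apply: cw_behead Pw.
have Py : P (m :: (l :: x) ++ y) by apply: (@cw_sub _ _ cP _ [:: n]) Pw; perm_count.
rewrite lin_shuf_cons !linZ IHx // IHy //=.
have := subrV_unit ul um; rewrite (_ : _ - _ - _ = m.2 - l.2); last by ring.
rewrite [(m.2 - l.2)^-1]invBr => /(_ ulm).
set i := (n.2 - l.2)^-1; set j := (n.2 - m.2)^-1; set k := (l.2 - m.2)^-1 => ij.
set X := chain _ x; set Y := chain _ y.
transitivity (- (- k * (i - j)) * (X * Y)); first by ring.
by rewrite ij; ring.
Qed.

Definition diamond kap l m f : K :=
  kap l.2 m.2 * (f (l.1 + m.1, l.2) - f (l.1 + m.1, m.2)).

(** Letter component of the claim that [gan c] carries the product of [kap] to that of [kap']: in a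
    product of two collapsed words, a single letter can arise only by merging one letter of each. *)
Definition letter_morphism kap kap' c := forall l x m y f,
  P ((l :: x) ++ m :: y) ->
  lin (qsh kap (l :: x) (m :: y)) (fun z => c z * f (collapse z)) =
  c (l :: x) * c (m :: y) * diamond kap' (collapse (l :: x)) (collapse (m :: y)) f.

(** With [l] first, [star] contributes [(m.2 - l.2)^-1]; the merged letter carrying [l.2] has the
    opposite factor from the stuffle. The terms carrying [m.2] cancel likewise. *)
Lemma cpic_letter : letter_morphism stk shk cpic.
Proof.
move=> l x m y f Pw; rewrite /diamond mul0r mulr0 lin_qsh_cons.
set U := usum (l :: x) + usum (m :: y).
have e x' y' k : usum x' + usum y' + k.1 = U -> P (k :: x' ++ y') ->
    lin (qsh stk x' y') (fun z => cpic (k :: z) * f (collapse (k :: z)))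
    = star k.2 x' * star k.2 y' * f (U, k.2).
  move=> kU Pk; under eq_lin => z do rewrite collapse_cons.
  rewrite (lin_qsh_usum stk _ _ (fun u z => cpic (k :: z) * f (k.1 + u, k.2))).
  by rewrite linZr /= stuffle_star // -kU [k.1 + _]addrC.
have Ul : U = usum x + usum (m :: y) + l.1 by rewrite /U !usum_cons; ring.
have Um : U = usum (l :: x) + usum y + m.1 by rewrite /U !usum_cons; ring.
have Ulm : U = usum x + usum y + (l.1 + m.1) by rewrite /U !usum_cons; ring.
have Py : P (m :: (l :: x) ++ y) by apply: cw_perm Pw => //; perm_count.
have Pl : P ((l.1 + m.1, l.2) :: x ++ y).
  by apply: (cw_merge cP); apply: cw_perm Pw => //; perm_count.
have Pm : P ((l.1 + m.1, m.2) :: x ++ y).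
  by rewrite addrC; apply: (cw_merge cP); apply: cw_perm Pw => //; perm_count.
rewrite !e // !star_cons /= /stk [(m.2 - l.2)^-1]invBr.
ring.
Qed.

Lemma cpoc_letter : letter_morphism shk stk cpoc.
Proof.
move=> l x m y f Pw; rewrite /diamond lin_shuf_cons.
set U := usum (l :: x) + usum (m :: y).
have e x' y' k : usum x' + usum y' + k.1 = U -> P (k :: x' ++ y') ->
    lin (qsh shk x' y') (fun z => cpoc (k :: z) * f (collapse (k :: z)))
    = chain k.2 x' * chain k.2 y' * f (U, k.2).
  move=> kU Pk; under eq_lin => z do rewrite collapse_cons.
  rewrite (lin_qsh_usum shk _ _ (fun u z => cpoc (k :: z) * f (k.1 + u, k.2))).
  by rewrite linZr /= shuf_chain // -kU [k.1 + _]addrC.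
have Ul : U = usum x + usum (m :: y) + l.1 by rewrite /U !usum_cons; ring.
have Um : U = usum (l :: x) + usum y + m.1 by rewrite /U !usum_cons; ring.
have Py : P (m :: (l :: x) ++ y) by apply: cw_perm Pw => //; perm_count.
rewrite !e // /= /stk [(m.2 - l.2)^-1]invBr -!/(usum _) -/U.
ring.
Qed.

(** The first segment of the product comes from [x] alone, from [y] alone, or from both, where
    [letter_morphism] applies. The remaining words are shorter. *)
Lemma qsh_gan kap kap' c x y F : letter_morphism kap kap' c -> P (x ++ y) ->
  lin (qsh kap x y) (fun z => lin (gan c z) F)
    = lin (gan c x) (fun x' => lin (gan c y) (fun y' => lin (qsh kap' x' y') F)).
Proof.
move=> cm; have [n] := ubnP (size x + size y)%N.
elim: n x y F => // n IHn [|l x] y F le_n Pw.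
  by rewrite lin_qsh0l lin_gan0; apply: eq_lin => z; rewrite lin_qsh0l.
case: y le_n Pw => [|m y] le_n Pw.
  by rewrite lin_qsh0r; apply: eq_lin => z; rewrite lin_gan0 lin_qsh0r.
(* [hd] splits off the first segment; its value 0 on the empty segment allows a sum over all cuts,
   to which [lin_qsh_cut] applies. *)
pose hd z r := if z is [::] then 0 else c z * lin (gan c r) (fun z' => F (collapse z :: z')).
have cons_hd k X : lin X (fun z => lin (gan c (k :: z)) F) = lin X (fun z => cut (k :: z) hd).
  apply: eq_lin => z; rewrite lin_gan_cons cut_cons add0r.
  by apply: eq_cut.
have -> : lin (qsh kap (l :: x) (m :: y)) (fun z => lin (gan c z) F)
   = lin (qsh kap (l :: x) (m :: y)) (fun z => cut z hd).
  by rewrite !lin_qsh_cons !cons_hd.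
rewrite lin_qsh_cut.
pose G x2 y2 k := lin (gan c x2) (fun x' => lin (gan c y2) (fun y' =>
  lin (qsh kap' x' y') (fun z => F (k :: z)))).
have hdG x2 y2 : (size x2 + size y2 < n)%N -> P (x2 ++ y2) -> forall k s,
    lin (qsh kap x2 y2) (hd (k :: s)) = c (k :: s) * G x2 y2 (collapse (k :: s)).
  by move=> le2 P2 k s; rewrite /hd linZ IHn.
transitivity (cut x (fun x1 x2 => c (l :: x1) * G x2 (m :: y) (collapse (l :: x1)))
  + cut y (fun y1 y2 => c (m :: y1) * G (l :: x) y2 (collapse (m :: y1)))
  + cut x (fun x1 x2 => cut y (fun y1 y2 => c (l :: x1) * c (m :: y1)
      * diamond kap' (collapse (l :: x1)) (collapse (m :: y1)) (G x2 y2)))).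
  rewrite !cut_cons !lin_qsh0l lin0 add0r addrAC [RHS]addrC; congr (_ + _).
    apply: eq_cut => y1 y2 y_eq; rewrite lin_qsh0l hdG //.
      by move: le_n; rewrite y_eq /= size_cat; lia.
    by apply: (@cw_sub _ _ cP _ (m :: y1)) Pw; rewrite y_eq; perm_count.
  rewrite -cutD; apply: eq_cut => x1 x2 x_eq; rewrite cut_cons lin_qsh0r hdG; first last.
  - by apply: (@cw_sub _ _ cP _ (l :: x1)) Pw; rewrite x_eq; perm_count.
  - by move: le_n; rewrite x_eq /= size_cat; lia.
  congr (_ + _); apply: eq_cut => y1 y2 y_eq.
  have le2 : (size x2 + size y2 < n)%N.
    by move: le_n; rewrite x_eq y_eq /= !size_cat; lia.
  have P2 : P (x2 ++ y2).
    by apply: (@cw_sub _ _ cP _ (l :: x1 ++ m :: y1)) Pw; rewrite x_eq y_eq; perm_count.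
  rewrite -cm; last first.
    by apply: (@cw_sub _ _ cP _ (x2 ++ y2)) Pw; rewrite x_eq y_eq; perm_count.
  rewrite !lin_qsh_cons; congr (_ + _ + _ * (_ - _)); apply: eq_lin => z; exact: hdG.
rewrite lin_gan_cons.
under [X in _ + X + _ = _]eq_cut => y1 y2 _.
  rewrite /G lin_gan_cons -cutZ.
  over.
rewrite cut_cut -!cutD; apply: eq_cut => x1 x2 _.
under [X in _ = _ * X]eq_lin => x'.
  rewrite lin_gan_cons.
  under eq_cut => y1 y2 _.
    under eq_lin => y' do rewrite lin_qsh_cons.
    rewrite !linD linZ linB !mulrDr.
    over.
  rewrite !cutD.
  over.
rewrite !linD !mulrDr; congr (_ * _ + _ + _).
- by rewrite /G; apply: eq_lin => x'; rewrite lin_gan_cons.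
- rewrite -cut_lin -cutZ; apply: eq_cut => y1 y2 _.
  by rewrite linZ; ring.
rewrite -2!cut_lin -2!cutZ -cutD; apply: eq_cut => y1 y2 _.
by rewrite !linZ linN /diamond /G; ring.
Qed.

End Closed.
End PicPoc.

Arguments cpic {K}.
Arguments cpoc {K}.

(** * The bracket uri without denominators *)

Section Uri.
Variable K : comUnitRingType.
Implicit Types (a b p q r s w : word K) (l m : letter K) (t u : K).
Implicit Types (F A B : word K -> K) (f : letter K -> K) (g : K -> K).

(** Newton's divided difference at the nodes [t :: us]; the recursion drops the first or the second
    node. *)
Fixpoint divdiff g t (us : seq K) : K :=
  if us is u :: us' then (u - t)^-1 * (divdiff g u us' - divdiff g t us') else g t.

Definition vpart w : seq K := [seq l.2 | l <- w].

(* For a word x :: s, minus the coefficient of its collapse carrying the first v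
   in the letter component of the coderivation obtained from arit by conjugation
   with ganit_pic. *)
Definition ucoef B t s : K := cut3 s (fun p y z =>
  if (size z <= 1)%N
  then (-1) ^+ size p * divdiff (fun u => B (sh y u)) t (vpart (p ++ z)) else 0).

Definition edgeU B s : seq (K * letter K) :=
  edgeL B s ++
  (if s is x :: s' then [:: (- ucoef B x.2 s', (x.1 + usum s', x.2))] else [::]).

Lemma divdiff_sweep g t p z :
  (-1) ^+ size p * divdiff g t (vpart (p ++ z))
  + cut p (fun a r => if r is m :: b
      then star t a * (m.2 - t)^-1 * ((-1) ^+ size b * divdiff g m.2 (vpart (b ++ z)))
      else 0)
  = star t p * divdiff g t (vpart z).
Proof.
elim: p => [|m p IHp]; first by rewrite cut_nil /= addr0 expr0 star_nil.
rewrite cut_cons star_cons -[in RHS]mulrA -IHp star_nil mulrDr -cutZ addrA; congr (_ + _).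
  by rewrite /= exprS; ring.
apply: eq_cut => a [|n b] _; rewrite ?mulr0 //.
by rewrite star_cons; ring.
Qed.

Lemma lin_gan_nilp c w (k : K) :
  lin (gan c w) (fun z => if z is [::] then k else 0) = if w is [::] then k else 0.
Proof.
case: w => [|l w]; first by rewrite lin_gan0.
by rewrite lin_gan_cons cut_eq0 // => a b _; rewrite lin0 mulr0.
Qed.

Lemma lin_gan_single c w f :
  lin (gan c w) (fun z => if z is [:: l] then f l else 0)
    = if w is [::] then 0 else c w * f (collapse w).
Proof.
case: w => [|l w]; first by rewrite lin_gan0.
rewrite lin_gan_cons -[RHS](cut_if_nilr w (fun a _ => c (l :: a) * f (collapse (l :: a)))).
apply: eq_cut => a b _; rewrite lin_gan_nilp.
by case: b => //; rewrite mulr0.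
Qed.

Lemma gan_cpic_sh A w t :
  lin (gan cpic w) (fun z => lin (gan cpoc (sh z t)) A) = A (sh w t).
Proof.
rewrite -(lin_gan_sh w (fun z => lin (gan cpoc z) A)) ?gan_cpicK // => s.
exact: cpic_sh.
Qed.

(** On the block before the surviving letter [y], the maps for pic and poc cancel, so [B] reappears
    unconjugated. Only the segment opened by [y] leaves a pic weight. *)
Lemma gan_edgeL B w f :
  lin (gan cpic w) (fun z => lin (edgeL (fun s => lin (gan cpoc s) B) z) f)
    = cut w (fun a r => if r is y :: c
        then B (sh a y.2) * star y.2 c * f (usum w, y.2) else 0).
Proof.
under eq_lin => z do rewrite lin_edgeL.
rewrite lin_gan_cut; apply: eq_cut => a r w_eq.
under eq_lin => b do rewrite (lin_gan_single _ _ (fun y =>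
  lin (gan cpoc (sh b y.2)) B * f (usum b + y.1, y.2))).
case: r w_eq => [|y c] w_eq; first by rewrite lin0.
rewrite linZ collapse_cons.
rewrite (lin_gan_usum _ _ (fun u b => lin (gan cpoc (sh b y.2)) B * f (u + (y.1 + usum c), y.2))).
by rewrite linZr gan_cpic_sh w_eq usum_cat usum_cons /=; ring.
Qed.

(** Here the surviving letter [x] opens the first segment, so the pic weight of that segment stays
    in front of [B]. These are the poles that [ucoef] has to absorb. *)
Lemma gan_edgeF B x w f :
  lin (gan cpic (x :: w)) (fun z => lin (edgeF (fun s => lin (gan cpoc s) B) z) f)
    = cut w (fun a b => star x.2 a * B (sh b x.2)) * f (usum (x :: w), x.2).
Proof.
rewrite lin_gan_cons -cutZr; apply: eq_cut => a b w_eq.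
under eq_lin => z do rewrite collapse_cons lin_seq1 /=.
rewrite (lin_gan_usum _ _ (fun u z => lin (gan cpoc (sh z x.2)) B * f (x.1 + usum a + u, x.2))).
by rewrite linZr gan_cpic_sh w_eq usum_cons usum_cat /= !addrA mulrA.
Qed.

Lemma lin_edgeU B s f :
  lin (edgeU B s) f = lin (edgeL B s) f
    - (if s is x :: s' then ucoef B x.2 s' * f (usum s, x.2) else 0).
Proof.
rewrite lin_cat; congr (_ + _); case: s => [|x s]; first by rewrite lin_nil oppr0.
by rewrite lin_seq1 mulNr -usum_cons.
Qed.

Lemma eq_lin_edgeU B s f f' :
  (forall v, f (usum s, v) = f' (usum s, v)) -> lin (edgeU B s) f = lin (edgeU B s) f'.
Proof.
move=> e; rewrite !lin_edgeU !lin_edgeL; congr (_ - _); last by case: s e => // x s ->.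
apply: eq_cut => a [|y [|? ?]] // s_eq.
suff -> : usum a + y.1 = usum s by rewrite e.
by rewrite s_eq usum_cat usum_cons usum_nil addr0.
Qed.

(** The equation that [ucoef] is designed to solve: the terms of [gan_cpic_edge] carrying the first
    v. Everything is sorted by the block [y] at which [B] is evaluated, and [divdiff_sweep] then
    removes the nodes to its left. *)
Lemma ucoef_sweep B t w :
  cut3 w (fun a s c => lin (edgeU B s) (fun l => star t (a ++ l :: c)))
  - cut w (fun s c => ucoef B t s * star t c)
  = - cut w (fun a b => star t a * B (sh b t)).
Proof.
pose e (z : word K) : K := if (size z <= 1)%N then 1 else 0.
have E1 : cut w (fun s c => ucoef B t s * star t c) =
  cut3 w (fun p y q => cut q (fun z c => e z * star t c *
    ((-1) ^+ size p * divdiff (fun u => B (sh y u)) t (vpart (p ++ z))))).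
  rewrite cut3_cutr; apply: eq_cut => s c _; rewrite /ucoef /cut3 -cutZr.
  apply: eq_cut => p r _; rewrite -cutZr; apply: eq_cut => y z _.
  by rewrite /e; case: ifP => _; ring.
have E2 : cut3 w (fun a s c => lin (edgeU B s) (fun l => star t (a ++ l :: c))) =
  cut3 w (fun p y q => if q is m :: _ then star t p * star t q * B (sh y m.2) else 0)
  - cut3 w (fun p y q => cut p (fun a r => cut q (fun z c =>
      if r is m :: b then e z * star t c * (star t a * (m.2 - t)^-1 *
        ((-1) ^+ size b * divdiff (fun u => B (sh y u)) m.2 (vpart (b ++ z)))) else 0))).
  rewrite cut3_cut_cut -cut3B.
  transitivity (cut3 w (fun a s c => lin (edgeL B s) (fun l => star t (a ++ l :: c))
    - if s is m :: s' then ucoef B m.2 s' * star t (a ++ (usum s, m.2) :: c) else 0)).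
    by apply: eq_cut3 => a s c _; rewrite lin_edgeU.
  rewrite !cut3B; congr (_ - _).
    apply: eq_cut => a r _.
    transitivity (cut r (fun s c => cut s (fun b q => if q is [:: y] then
        star t a * star t (y :: c) * B (sh b y.2) else 0))).
      apply: eq_cut => s c _; rewrite lin_edgeL; apply: eq_cut => b [|y [|? ?]] // _.
      by rewrite star_cat !star_cons /=; ring.
    rewrite -cutA; apply: eq_cut => b c _.
    rewrite (cut_singleton c (fun y c => star t a * star t (y :: c) * B (sh b y.2))).
    by case: c.
  apply: eq_cut3 => a s c _; case: s => [|m s]; first by rewrite /cut3 !cut_nil.
  rewrite cut3_cons cut_eq0 // !add0r /ucoef /cut3 -cutZr.
  apply: eq_cut => b r _; rewrite -cutZr; apply: eq_cut => y z _.
  by rewrite star_cat star_cons /e; case: ifP => _ /=; ring.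
have E3 : cut w (fun a b => star t a * B (sh b t)) =
  cut3 w (fun p y q => if q is [::] then star t p * B (sh y t) else 0).
  by apply: eq_cut => p r _; rewrite cut_if_nilr.
rewrite E1 E2 E3 -addrA -opprD -cut3N -cut3D -cut3N -cut3D; apply: eq_cut3 => p y q _.
set g := fun u => B (sh y u).
transitivity ((if q is m :: _ then star t p * star t q * B (sh y m.2) else 0)
   - cut q (fun z c => e z * star t c * (star t p * divdiff g t (vpart z)))).
  congr (_ - _); rewrite cut_cut addrC -cutD; apply: eq_cut => z c _.
  rewrite -divdiff_sweep mulrDr -cutZ; congr (_ + _).
  by apply: eq_cut => a [|? ?] _; rewrite ?mulr0.
(* For nonempty [q] the terms with [z] empty and [z = [:: m]] already cancel the [edgeL] term,
   because the factor [(m.2 - t)^-1] of the divided difference completes [star t q]. Hence the bound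
   [size z <= 1] in [ucoef]. *)
case: q => [|m q]; first by rewrite cut_nil /e /= star_nil -/(g t); ring.
rewrite cut_cons; case: q => [|n q].
  rewrite cut_nil /e /= !star_cons star_nil -/(g m.2); ring.
rewrite cut_cons cut_eq0 => [|a b _].
  by rewrite /e /= !star_cons -/(g m.2); ring.
by rewrite /e /= !mul0r.
Qed.

(** Terms keeping the last v match directly. Those carrying [x.2] come from a segment starting at
    [x], with weight [- ucoef], or from a later segment, which alters the [star] based at [x.2];
    [ucoef_sweep] adds them up. *)
Lemma gan_cpic_edge B w f :
  lin (gan cpic w) (fun z => lin (edge (fun s => lin (gan cpoc s) B) z) f)
    = coder (edgeU B) (fun z => cpic z * f (collapse z)) w.
Proof.
case: w => [|x w]; first by rewrite lin_gan0 /coder /cut3 !cut_nil !lin_nil.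
under eq_lin => z do rewrite lin_edge.
rewrite linB gan_edgeL gan_edgeF; set U := usum (x :: w).
rewrite /coder cut3_cons lin_nil add0r.
transitivity (cut w (fun s c => lin (edgeL B (x :: s)) (fun l => star l.2 c * f (U, l.2)))
  + (cut3 w (fun a s c => lin (edgeU B s) (fun l => star x.2 (a ++ l :: c)))
     - cut w (fun s c => ucoef B x.2 s * star x.2 c)) * f (U, x.2)).
  rewrite ucoef_sweep mulNr; congr (_ - _).
  transitivity (cut (x :: w) (fun a r => cut r (fun b c => if b is [:: y]
      then B (sh a y.2) * (star y.2 c * f (U, y.2)) else 0))).
    apply: eq_cut => a r _.
    rewrite (cut_singleton r (fun y c => B (sh a y.2) * (star y.2 c * f (U, y.2)))).
    by case: r => // y c; rewrite mulrA.
  rewrite cutA cut_cons cut_nil add0r; apply: eq_cut => s c _.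
  by rewrite lin_edgeL.
rewrite mulrBl addrCA [RHS]addrC; congr (_ + _).
  rewrite mulrC -cut3Z; apply: eq_cut3 => a s c w_eq; rewrite mulrC -linZr.
  apply: eq_lin_edgeU => v /=; rewrite collapse_cons /U w_eq.
  by rewrite !(usum_cons, usum_cat).
rewrite -cutZr -cutB; apply: eq_cut => s c w_eq.
under [RHS]eq_lin => l do rewrite collapse_cons.
rewrite lin_edgeU; congr (_ - _); last first.
  by rewrite /= /U w_eq !(usum_cons, usum_cat); rewrite -mulrA; congr (_ * (_ * f (_, _))); ring.
rewrite !lin_edgeL; apply: eq_cut => a [|y [|? ?]] // s_eq /=.
congr (_ * (_ * f (_, _))); rewrite /U w_eq -cat_cons s_eq !(usum_cat, usum_cons) usum_nil; ring.
Qed.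

Lemma gan_cpic_coder A B w :
  lin (gan cpic w) (coder (edge (fun s => lin (gan cpoc s) B)) (fun s => lin (gan cpoc s) A))
    = coder (edgeU B) A w.
Proof.
rewrite (lin_gan_coder (E' := edgeU B)) => [|p s q f _]; last exact: gan_cpic_edge.
by apply: coder_ext => z; rewrite gan_cpicK.
Qed.

Definition urim A B w : K :=
  coder (edgeU B) A w - coder (edgeU A) B w + (mulm A B w - mulm B A w).

Lemma gan_cpic_arim A B w :
  lin (gan cpic w) (arim (fun s => lin (gan cpoc s) A) (fun s => lin (gan cpoc s) B))
    = urim A B w.
Proof.
rewrite linD !linB !gan_cpic_coder !lin_gan_mulm.
have e C D : mulm (fun z => lin (gan cpic z) (fun s => lin (gan cpoc s) C))
    (fun z => lin (gan cpic z) (fun s => lin (gan cpoc s) D)) w = mulm C D w.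
  by apply: eq_cut => a b _; rewrite !gan_cpicK.
by rewrite !e.
Qed.

End Uri.

(** * Segment maps on a stable class of words *)

Section GanClosed.
Variable K : comUnitRingType.
Implicit Types (a b p q r s w x y z : word K) (l m : letter K) (t u : K).
Implicit Types (F A B c : word K -> K).
Variable P : word K -> Prop.
Hypothesis cP : closed_words P.

Lemma cw_collapse p l s q : P (p ++ (l :: s) ++ q) -> P (p ++ collapse (l :: s) :: q).
Proof.
move=> Pw; have /(cw_letter cP) : P (rcons s l ++ p ++ q).
  by apply: cw_perm Pw => //; perm_count.
rewrite collapse_cons [l.1 + _]addrC; apply: (cw_perm cP); perm_count.
Qed.

(** The surrounding letters [p] and [q] keep track of membership in [P]. Collapsing preserves
    emptiness, and [vanishes_gan] relies on this. *)
Lemma eq_lin_gan c c' w F F' p q : P (p ++ w ++ q) ->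
  (forall l s, P (l :: s) -> c (l :: s) = c' (l :: s)) ->
  (forall z, P (p ++ z ++ q) -> nilp z = nilp w -> F z = F' z) ->
  lin (gan c w) F = lin (gan c' w) F'.
Proof.
move=> Pw ec; elim/size_word_ind: w p F F' Pw => -[|l w] IHw p F F' Pw eF.
  by rewrite !lin_gan0 eF.
rewrite !lin_gan_cons; apply: eq_cut => a b w_eq; congr (_ * _).
  by apply: ec; apply: (@cw_sub _ _ cP _ (p ++ b ++ q)) Pw; rewrite w_eq; perm_count.
apply: (IHw _ _ (rcons p (collapse (l :: a)))).
- by rewrite w_eq; apply: size_cat_ltS.
- by rewrite cat_rcons; apply: cw_collapse; rewrite /= catA -w_eq.
by move=> z; rewrite cat_rcons => Pz _; apply: eF.
Qed.

Lemma vanishes_gan kap kap' c F : letter_morphism P kap kap' c ->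
  vanishes_on P kap' F -> vanishes_on P kap (fun z => lin (gan c z) F).
Proof.
move=> cm vF x y x0 y0 Pxy; rewrite (qsh_gan cP _ cm Pxy).
rewrite (@eq_lin_gan c c x _ (fun=> 0) [::] y) ?lin0 // => x' /= Px' nx'.
rewrite (@eq_lin_gan c c y _ (fun=> 0) x' [::]) ?cats0 ?lin0 // => y' /=.
rewrite cats0 => Py' ny'; apply: vF => //.
  by move: nx' x0; case: (x') => //; case: (x).
by move: ny' y0; case: (y') => //; case: (y).
Qed.

End GanClosed.

(** * Words at which rational bimoulds can be evaluated *)

Section McCoy.
Variables (R : comNzRingType) (n : nat).
Implicit Types p q f : {mpoly R[n]}.

Lemma msupp_scale_mlead p f : f != 0 -> p * f = 0 ->
  (exists2 m, m \in msupp p & p@_m *: f != 0) ->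
  exists2 m, p@_m *: f != 0 & (size (msupp (p@_m *: f)) < size (msupp f))%N.
Proof.
move=> f0 pf0 [m0 m0p m0f].
pose p' := \sum_(m <- msupp p | p@_m *: f != 0) p@_m *: 'X_[m].
have p'E m : p'@_m = if p@_m *: f != 0 then p@_m else 0.
  rewrite /p' raddf_sum /=.
  have [mp|mp] := boolP (m \in msupp p); last first.
    rewrite (memN_msupp_eq0 mp) scale0r eqxx /=; apply: big1_seq => m' /andP[_ m'p].
    rewrite mcoeffZ mcoeffX; case: eqP => [e|_]; rewrite ?mulr0 //.
    by move: mp; rewrite -e m'p.
  rewrite big_mkcond (bigD1_seq m) ?msupp_uniq //= big1 ?addr0 => [|m' m'm].
    by case: ifP => // _; rewrite mcoeffZ mcoeffX eqxx mulr1.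
  by case: ifP => // _; rewrite mcoeffZ mcoeffX (negbTE m'm) mulr0.
have p'f0 : p' * f = 0.
  rewrite -[RHS]pf0 [in RHS](mpolyE p) (bigID (fun m => p@_m *: f != 0)) /= mulrDl.
  rewrite -[LHS]addr0; congr (_ + _); rewrite mulr_suml big1 // => m /negPn/eqP mf.
  by rewrite -scalerAl scalerAr mf mulr0.
have p'0 : p' != 0.
  apply: contraNneq (m0f) => /(congr1 (mcoeff m0)); rewrite p'E mcoeff0.
  by rewrite m0f => ->; rewrite scale0r.
exists (mlead p').
  by have := mleadc_eq0 p'; rewrite p'E; case: ifP => //; rewrite eqxx (negbTE p'0).
have lead0 : (p@_(mlead p') *: f)@_(mlead f) = 0.
  have := mleadcM p' f; rewrite p'f0 mcoeff0 p'E mcoeffZ.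
  have := mleadc_eq0 p'; rewrite p'E; case: ifP => // _; by rewrite eqxx (negbTE p'0).
have fin : mlead f \in msupp f by apply: mlead_supp.
have : {subset msupp (p@_(mlead p') *: f) <= rem (mlead f) (msupp f)}.
  move=> m min; rewrite mem_rem_uniq ?msupp_uniq // inE (msuppZ_le min) andbT.
  by apply: contraL min => /eqP->; rewrite -mcoeff_eq0 lead0.
move/(uniq_leq_size (msupp_uniq _)); rewrite size_rem // => /leq_ltn_trans; apply.
by case: (msupp f) fin.
Qed.

(** McCoy's theorem: an annihilator with minimal support is killed by every coefficient of [p], so
    its own coefficients annihilate [p]. *)
Lemma mccoy p : (forall k : R, k *: p = 0 -> k = 0) -> GRing.lreg p.
Proof.
move=> p_ann; apply: mulrI0_lreg => f; have [N] := ubnP (size (msupp f)).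
elim: N f => // N IHN f ltfN pf0; apply/eqP; apply: contraT => f0.
have [[m mp mf]|none] := pselect (exists2 m, m \in msupp p & p@_m *: f != 0).
  have [m' m'f ltm'] := msupp_scale_mlead f0 pf0 (ex_intro2 _ _ m mp mf).
  case/negP: m'f; apply/eqP; apply: IHN; first exact: leq_trans ltm' _.
  by rewrite -scalerAr pf0 scaler0.
suff /p_ann/eqP : f@_(mlead f) *: p = 0 by rewrite mleadc_eq0 (negbTE f0).
apply/mpolyP => m; rewrite mcoeffZ mcoeff0 mulrC.
have [mp|/memN_msupp_eq0->] := boolP (m \in msupp p); last by rewrite mul0r.
rewrite -mcoeffZ; have -> : p@_m *: f = 0; last exact: mcoeff0.
by apply/eqP; apply: contrapT => /negP mf; apply: none; exists m.
Qed.

Lemma lreg_ann p : GRing.lreg p -> forall k : R, k *: p = 0 -> k = 0.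
Proof.
move=> rp k; rewrite -mul_mpolyC mulrC => e.
have : p * k%:MP = p * 0 by rewrite e mulr0.
by move/rp/eqP; rewrite mpolyC_eq0 => /eqP.
Qed.

End McCoy.

(** * Units detected by specialization *)

Section GoodWords.
Variables (R : comNzRingType) (d : nat).
Notation K := (ratfun R d).
Implicit Types (w : word K) (l : letter K) (x y : K).

Lemma polfun_unit (p : {mpoly R[d + d]}) : GRing.lreg p -> polfun p \is a GRing.unit.
Proof.
move=> /regbP rp; apply: (@TotFrac.unitPl _ _ (TotFrac.mk 1 rp)).
rewrite -[LHS]/(TotFrac.mul _ _) TotFrac.mul_mk.
by apply: TotFrac.mk_eq; ring.
Qed.

Section Specialize.
Variables (N : nat) (h : 'I_(d + d) -> {mpoly R[N]}).

Definition spec_to x (f : {mpoly R[N]}) : Prop :=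
  exists2 p, x = polfun p & f = mmap (@mpolyC N R) h p.

Lemma spec_toD x f y g : spec_to x f -> spec_to y g -> spec_to (x + y) (f + g).
Proof. by move=> [p -> ->] [q -> ->]; exists (p + q); rewrite ?mmapD // /polfun rmorphD. Qed.

Lemma spec_toB x f y g : spec_to x f -> spec_to y g -> spec_to (x - y) (f - g).
Proof. by move=> [p -> ->] [q -> ->]; exists (p - q); rewrite ?mmapB // /polfun rmorphB. Qed.

Lemma spec_toM x f y g : spec_to x f -> spec_to y g -> spec_to (x * y) (f * g).
Proof. by move=> [p -> ->] [q -> ->]; exists (p * q); rewrite /polfun rmorphM. Qed.

Lemma spec_toX x f n : spec_to x f -> spec_to (x ^+ n) (f ^+ n).
Proof. by move=> [p -> ->]; exists (p ^+ n); rewrite /polfun rmorphXn. Qed.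

Lemma spec_toC k : spec_to (@pconst R d k) k%:MP.
Proof. by exists k%:MP; rewrite ?mmapC. Qed.

(** Regularity lifts along specializations: by [mccoy] only constant annihilators matter, and a
    constant killing [p] also kills its image [f]. *)
Lemma spec_to_unit x f : GRing.lreg f -> spec_to x f -> x \is a GRing.unit.
Proof.
move=> /lreg_ann rf [p -> fE]; apply: polfun_unit; apply: mccoy => k kp0.
by apply: rf; have := congr1 (mmap (@mpolyC N R) h) kp0; rewrite mmapZ mmap0 -fE mul_mpolyC.
Qed.

Lemma spec_to_mmap m (X : 'I_m -> K) (Y : 'I_m -> {mpoly R[N]}) (p : {mpoly R[m]}) :
  (forall i, spec_to (X i) (Y i)) ->
  spec_to (mmap (@pconst R d) X p) (mmap (@mpolyC N R) Y p).
Proof.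
move=> XY; rewrite /mmap; elim/big_rec2: _ => [|i x f _ xf].
  by rewrite -(rmorph0 (@pconst R d)) -mpolyC0; apply: spec_toC.
apply: spec_toD => //; apply: spec_toM; first exact: spec_toC.
rewrite /mmap1; elim/big_rec2: _ => [|j u g _ ug].
  by rewrite -(rmorph1 (@pconst R d)) -mpolyC1; apply: spec_toC.
by apply: spec_toM => //; apply: spec_toX.
Qed.

End Specialize.
End GoodWords.

Definition lmap (K K' : comUnitRingType) (s : K -> K') (l : letter K) : letter K' :=
  (s l.1, s l.2).

Section Good.
Variables (R : comNzRingType) (d : nat).
Notation K := (ratfun R d).
Implicit Types (w : word K) (l : letter K) (x y : K).

Section SpecWord.
Variables (N : nat) (h : 'I_(d + d) -> {mpoly R[N]}).

Fixpoint spec_word w (t : seq ({mpoly R[N]} * {mpoly R[N]})) : Prop :=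
  match w, t with
  | [::], [::] => True
  | l :: w', m :: t' => [/\ spec_to h l.1 m.1, spec_to h l.2 m.2 & spec_word w' t']
  | _, _ => False
  end.

Lemma spec_word_cat w w' t t' : size w = size t ->
  spec_word (w ++ w') (t ++ t') <-> spec_word w t /\ spec_word w' t'.
Proof.
elim: w t => [|l w IHw] [|m t] //= => [_|[/IHw{}IHw]]; first by tauto.
by split=> [[? ? /IHw[? ?]]|[[? ? ?] ?]] //; split=> //; apply/IHw.
Qed.

Lemma spec_word_nth w t i : spec_word w t -> (i < size w)%N ->
  spec_to h (nth (0, 0) w i).1 (nth (0, 0) t i).1
  /\ spec_to h (nth (0, 0) w i).2 (nth (0, 0) t i).2.
Proof.
elim: w t i => [|l w IHw] [|m t] [|i] //= [] // hl1 hl2 /IHw; exact.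
Qed.

Lemma spec_word_map (T : Type) (s : seq T) (f : T -> letter K) g :
  (forall i, spec_to h (f i).1 (g i).1 /\ spec_to h (f i).2 (g i).2) ->
  spec_word (map f s) (map g s).
Proof. by move=> fg; elim: s => //= i s IHs; have [] := fg i. Qed.

End SpecWord.

(* The letters of w can be sent to any prescribed polynomials by some R-algebra
   morphism, i.e. they are as independent as distinct variables. *)
Definition good w : Prop := forall N (t : seq ({mpoly R[N]} * {mpoly R[N]})),
  size w = size t -> exists h, @spec_word N h w t.

Lemma good_perm w w' : perm_eq w w' -> good w -> good w'.
Proof.
apply: catCA_perm_ind => {w w'} s1 s2 s3 gw N t st.
pose t2 := take (size s2) t; pose t1 := take (size s1) (drop (size s2) t).
pose t3 := drop (size s1) (drop (size s2) t).
have tE : t = t2 ++ t1 ++ t3 by rewrite !cat_take_drop.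
rewrite !size_cat in st.
have e2 : size s2 = size t2 by rewrite /t2 size_takel // -st leq_addr.
have e1 : size s1 = size t1.
  by rewrite /t1 size_takel // size_drop -st addKn leq_addr.
have [|h /(spec_word_cat h _ _ e1)[h1 /(spec_word_cat h _ _ e2)[h2 h3]]] := gw N (t1 ++ t2 ++ t3).
  by rewrite !size_cat; move: st; rewrite tE !size_cat -e1 -e2; lia.
by exists h; rewrite tE; apply/spec_word_cat => //; split=> //; apply/spec_word_cat.
Qed.

Lemma good_closed : closed_words good.
Proof.
split.
- exact: good_perm.
- by move=> l w gw N t st; have [|h /= []] := gw N ((0, 0) :: t); [rewrite /= st | exists h].
(* Sending [m] to zero lets the merged letter take any prescribed value. *)
- move=> l m w gw N [|[a b] t] //= [st].
  have [|h /= [l1 l2 [m1 m2 wt]]] := gw N ((a, b) :: (0, 0) :: t); first by rewrite /= st.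
  by exists h; split=> //=; rewrite -[a]addr0; apply: spec_toD.
- move=> l w gw N t st; rewrite size_map in st.
  have [|h /= [_ l2]] := gw N ((0, 0) :: t); first by rewrite /= st.
  move=> wt; exists h; elim: w t wt {gw st} => [|m w IHw] [|n t] //= [m1 m2 wt].
  by split=> //; [rewrite -[n.2]subr0; apply: spec_toB | apply: IHw].
move=> l m w gw.
(* The values 1 and 0 for the two v's make their difference specialize to 1. *)
pose t : seq ({mpoly R[0]} * {mpoly R[0]}) := (0, 1) :: (0, 0) :: nseq (size w) (0, 0).
have [|h /= [_ l2 [_ m2 _]]] := gw 0%N t; first by rewrite /= size_nseq.
apply: (spec_to_unit (f := 1 - 0) (h := h)); first by rewrite subr0; apply: lreg1.
exact: spec_toB.
Qed.

Lemma size_gword : size (gword R d) = d.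
Proof. by rewrite size_map size_enum_ord. Qed.

Lemma good_gword : good (gword R d).
Proof.
move=> N t; rewrite size_map size_enum_ord => st.
pose h (k : 'I_(d + d)) : {mpoly R[N]} := match split k with
  | inl i => (nth (0, 0) t i).1 | inr i => (nth (0, 0) t i).2 end.
exists h; have -> : t = [seq nth (0, 0) t (i : 'I_d) | i <- enum 'I_d].
  rewrite (map_comp (nth (0, 0) t) val) val_enum_ord st; apply/esym/mkseq_nth.
apply: spec_word_map => i; split.
  exists 'X_(lshift d i) => //; rewrite mmapX mmap1U /h.
  by rewrite -[lshift d i]/(unsplit (inl i)) unsplitK.
exists 'X_(rshift d i) => //; rewrite mmapX mmap1U /h.
by rewrite -[rshift d i]/(unsplit (inr i)) unsplitK.
Qed.

(** Send the letters of [w] to the variables themselves: [psubst w p] then specializes to the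
    regular polynomial [p]. *)
Lemma psubst_unit m w (p : {mpoly R[m + m]}) :
  good w -> size w = m -> regb p -> psubst w p \is a GRing.unit.
Proof.
move=> gw wm /regbP rp.
pose X (k : 'I_(m + m)) : {mpoly R[m + m]} := 'X_k.
pose t := [seq (X (lshift m i), X (rshift m i)) | i <- enum 'I_m].
have st : size w = size t by rewrite size_map size_enum_ord.
have [h wt] := gw _ t st.
apply: (spec_to_unit (f := p) (h := h)) => //.
rewrite -[X in spec_to _ _ X]comp_mpoly_id.
rewrite /comp_mpoly /psubst; apply: spec_to_mmap => k.
rewrite tnth_mktuple -[in 'X_k](splitK k); case: (split k) => i /=.
  have ltiw : (i < size w)%N by rewrite wm.
  by have [] := spec_word_nth wt ltiw; rewrite (nth_map i) ?size_enum_ord // nth_ord_enum.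
have ltiw : (i < size w)%N by rewrite wm.
by have [] := spec_word_nth wt ltiw; rewrite (nth_map i) ?size_enum_ord // nth_ord_enum.
Qed.

Section Subst.
Variables (m : nat) (w : word K).
Hypotheses (gw : good w) (wm : size w = m).

(** The proofs are arguments so that the ring morphism structure, established for good words, can be
    attached to the function. *)
Definition gsubst (gw : good w) (wm : size w = m) : ratfun R m -> K := @rsubst R m d w.

Lemma rsubst_mkg n (e : {mpoly R[m + m]}) (re : regb e) :
  rsubst w (TotFrac.mk n re : ratfun R m) = psubst w n / psubst w e.
Proof. by apply: rsubst_mk; apply: psubst_unit => //; apply: TotFrac.den_reg. Qed.

Lemma psubstB (p q : {mpoly R[m + m]}) : psubst w (p - q) = psubst w p - psubst w q.
Proof. exact: rmorphB. Qed.

Fact gsubst_is_zmod_morphism : zmod_morphism (gsubst gw wm).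
Proof.
move=> f g; rewrite /gsubst; case: (TotFrac.mkP f) => n e re; case: (TotFrac.mkP g) => n' e' re'.
have -> : (TotFrac.mk n re - TotFrac.mk n' re' : totfrac _)
    = TotFrac.mk (n * e' + - n' * e) (regbM re re').
  by rewrite -[LHS]/(TotFrac.add _ (TotFrac.opp _)) TotFrac.opp_mk TotFrac.add_mk.
have ue : psubst w e \is a GRing.unit by apply: psubst_unit.
have ue' : psubst w e' \is a GRing.unit by apply: psubst_unit.
rewrite !rsubst_mkg mulNr psubstB !psubstM invrM // mulrBl; congr (_ - _).
  by rewrite mulrA mulrK.
by rewrite [_^-1 * _]mulrC mulrA mulrK.
Qed.

Fact gsubst_is_monoid_morphism : monoid_morphism (gsubst gw wm).
Proof.
split=> [|f g]; rewrite /gsubst.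
  rewrite -[1]/(TotFrac.mk 1 (regb1 _)) rsubst_mkg divrr // psubst_unit //.
  exact: regb1.
case: (TotFrac.mkP f) => n e re; case: (TotFrac.mkP g) => n' e' re'.
rewrite -[_ * _]/(TotFrac.mul _ _) TotFrac.mul_mk !rsubst_mkg !psubstM.
have ue : psubst w e \is a GRing.unit by apply: psubst_unit.
have ue' : psubst w e' \is a GRing.unit by apply: psubst_unit.
by rewrite invrM //; ring.
Qed.

HB.instance Definition _ := GRing.isZmodMorphism.Build (ratfun R m) K
  (gsubst gw wm) gsubst_is_zmod_morphism.
HB.instance Definition _ := GRing.isMonoidMorphism.Build (ratfun R m) K
  (gsubst gw wm) gsubst_is_monoid_morphism.

Lemma gsubst_polfun p : gsubst gw wm (polfun p) = psubst w p.
Proof.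
rewrite /gsubst /polfun rsubst_mkg.
have -> : psubst w (1 : {mpoly R[m + m]}) = 1 by apply: rmorph1.
exact: divr1.
Qed.

Lemma gsubst_const k : gsubst gw wm (@pconst R m k) = @pconst R d k.
Proof. by rewrite gsubst_polfun /psubst mmapC. Qed.

Lemma map_lmap_gword : map (lmap (gsubst gw wm)) (gword R m) = w.
Proof.
apply: (@eq_from_nth _ (0, 0)); first by rewrite size_map size_map size_enum_ord wm.
move=> i; rewrite size_map size_map size_enum_ord => ltim.
rewrite /gword -map_comp (nth_map (Ordinal ltim)) ?size_enum_ord //=.
rewrite -[i in nth (Ordinal _) _ i]/(val (Ordinal ltim)) nth_ord_enum /=.
rewrite /lmap /uvar /vvar !gsubst_polfun /psubst !mmapX !mmap1U.
rewrite -[lshift m _]/(unsplit (inl (Ordinal ltim))) unsplitK.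
rewrite -[rshift m _]/(unsplit (inr (Ordinal ltim))) unsplitK /=.
by rewrite -surjective_pairing.
Qed.

End Subst.

Lemma bval_size M w m : size w = m -> bval M w = rsubst w (M m).
Proof. by move=> <-. Qed.

Lemma bval_gword M : bval M (gword R d) = M d.
Proof.
by rewrite (@bval_size _ _ d) ?rsubst_gword // size_map size_enum_ord.
Qed.

End Good.

(** * Evaluation commutes with substitution *)

Section Naturality.
Variables (R : comNzRingType) (m d : nat) (w : word (ratfun R d)).
Hypotheses (gw : good w) (wm : size w = m).
Notation s := (gsubst gw wm).

Lemma rsubst_comp n (w' : word (ratfun R m)) (f : ratfun R n) :
  good w' -> size w' = n -> rsubst (map (lmap s) w') f = s (rsubst w' f).
Proof.
move=> gw' w'n; have sp (p : {mpoly R[n + n]}) : psubst (map (lmap s) w') p = s (psubst w' p).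
  rewrite /psubst /mmap rmorph_sum; apply: eq_bigr => k _.
  rewrite rmorphM /= gsubst_const; congr (_ * _).
  rewrite /mmap1 rmorph_prod; apply: eq_bigr => i _; rewrite rmorphXn; congr (_ ^+ _).
  by case: (split i) => j; rewrite (nth_map (0, 0)) ?w'n.
rewrite /rsubst !sp rmorphM rmorphV //.
by apply: psubst_unit => //; apply: TotFrac.den_reg.
Qed.

Lemma bval_map M (w' : word (ratfun R m)) :
  good w' -> bval M (map (lmap s) w') = s (bval M w').
Proof.
move=> gw'; rewrite (@bval_size _ _ _ _ (size w')) ?size_map //.
exact: rsubst_comp.
Qed.

End Naturality.

(** * Flexion sums as sums over deconcatenations *)

Section Reindex.
Variable K : comUnitRingType.
Implicit Types (a b c r s w z : word K) (l x y : letter K) (A B : word K -> K).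

Lemma uflexr_rcons a y b : uflexr (rcons a y) b = rcons a (y.1 + usum b, y.2).
Proof. by case: a => //= l a; rewrite belast_rcons last_rcons. Qed.

Lemma vflexl_rcons a y b : vflexl (rcons a y) b = sh b y.2.
Proof. by case: a => //= l a; rewrite last_rcons. Qed.

Lemma cut_last_letter a (g : word K -> letter K -> K) :
  cut a (fun p q => if q is [:: y] then g p y else 0)
    = if a is x :: a' then g (belast x a') (last x a') else 0.
Proof.
case/lastP: a => [|a y]; first by rewrite cut_nil.
rewrite cut_rcons addr0; transitivity (g a y); last first.
  by case: a => //= x a; rewrite belast_rcons last_rcons.
rewrite -(cut_if_nilr a (fun p _ => g p y)); apply: eq_cut => p q _.
by case: q => [|? [|? ?]].
Qed.

(** Unlike [arit], [edge] admits an empty absorbed block. Each such term equals [k], and there is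
    one per letter of [w] in either half, so they cancel. *)
Lemma arit_coder A B w :
  \sum_(t <- cuts3 w | let: (a, b, c) := t in ~~ nilp b && ~~ nilp c)
     (let: (a, b, c) := t in A (a ++ uflexl b c) * B (vflexr b c))
  - \sum_(t <- cuts3 w | let: (a, b, c) := t in ~~ nilp a && ~~ nilp b)
     (let: (a, b, c) := t in A (uflexr a b ++ c) * B (vflexl a b))
  = coder (edge B) A w.
Proof.
pose X a y b c := A (a ++ (y.1 + usum b, y.2) :: c) * B (sh b y.2).
pose k := A w * B [::].
have -> : coder (edge B) A w =
  cut3 w (fun a b r => if r is y :: c then X a y b c else 0)
  - cut3 w (fun a s c => if s is y :: b then X a y b c else 0).
  rewrite /coder; under eq_cut3 => a s c _ do rewrite lin_edge.
  rewrite cut3B; congr (_ - _).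
    apply: eq_cut => a r _; under eq_cut => s c _ do rewrite lin_edgeL.
    rewrite -cutA; apply: eq_cut => b r' _.
    transitivity (if r' is y :: c then X a y b c else 0) => //.
    rewrite -(cut_singleton r' (fun y c => X a y b c)); apply: eq_cut => q c _.
    by case: q => [|y [|? ?]] //; rewrite /X addrC mulrC.
  apply: eq_cut3 => a s c _; case: s => [|y b]; first by rewrite lin_nil.
  by rewrite lin_seq1 /X /= mulrC.
rewrite !sum_cuts3.
have E1 : cut3 w (fun a b c => if ~~ nilp b && ~~ nilp c
    then A (a ++ uflexl b c) * B (vflexr b c) else 0)
  = cut3 w (fun a b r => if r is y :: c then X a y b c else 0)
    - cut w (fun a c => if c is [::] then 0 else k).
  rewrite -cutB; apply: eq_cut => a r w_eq.
  rewrite -(cut_if_nill r (fun _ c => if c is [::] then 0 else k)) -cutB.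
  apply: eq_cut => b c r_eq.
  case: b r_eq => [|y b] r_eq; case: c r_eq => [|x c] r_eq; rewrite ?subr0 //=.
    by rewrite /X /k w_eq r_eq /= usum_nil addr0 -surjective_pairing subrr.
  by rewrite /X /= addrC.
have E2 : cut3 w (fun a b c => if ~~ nilp a && ~~ nilp b
    then A (uflexr a b ++ c) * B (vflexl a b) else 0)
  = cut3 w (fun a s c => if s is y :: b then X a y b c else 0)
    - cut w (fun a c => if a is [::] then 0 else k).
  have <- : cut3 w (fun a b c => cut a (fun p q => if q is [:: y] then X p y b c else 0))
    = cut3 w (fun a s c => if s is y :: b then X a y b c else 0).
    rewrite cut3_cutl; apply: eq_cut => p r _; case: r => [|y r].
      by rewrite /cut3 !cut_nil.
    rewrite cut3_cons cut_eq0 // !add0r cut_cons add0r.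
    rewrite -[RHS](cut_if_nill r (fun _ r => cut r (fun b c => X p y b c))).
    by apply: eq_cut => q r' _; case: q => [|? ?] //; rewrite cut0.
  rewrite -cutB; apply: eq_cut => a r w_eq.
  rewrite -(cut_if_nill r (fun _ c => if a is [::] then 0 else k)) -cutB.
  apply: eq_cut => b c r_eq; case/lastP: a w_eq => [|a y] w_eq.
    by rewrite cut_nil; case: (b) => [|? ?]; rewrite subr0.
  have -> : cut (rcons a y) (fun p q => if q is [:: y] then X p y b c else 0) = X a y b c.
    by rewrite cut_last_letter; case: (a) => //= x a'; rewrite belast_rcons last_rcons.
  have w_eq' : w = a ++ y :: b ++ c by rewrite w_eq r_eq cat_rcons.
  rewrite uflexr_rcons vflexl_rcons cat_rcons.
  case: (rcons a y) (size_rcons a y) => // x s _; case: b w_eq' {r_eq} => [|n b] w_eq'.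
    by rewrite /X /k w_eq' /= usum_nil addr0 -surjective_pairing subrr.
  by rewrite subr0.
rewrite E1 E2.
have -> : cut w (fun a c : word K => if a is [::] then 0 else k) = cut w (fun a c => k) - k.
  rewrite -[X in _ - X](cut_if_nill w (fun _ _ => k)) -cutB.
  by apply: eq_cut => -[|? ?] b _; rewrite ?subrr ?subr0.
have -> : cut w (fun a c : word K => if c is [::] then 0 else k) = cut w (fun a c => k) - k.
  rewrite -[X in _ - X](cut_if_nilr w (fun _ _ => k)) -cutB.
  by apply: eq_cut => a [|? ?] _; rewrite ?subrr ?subr0.
by ring.
Qed.

(** In a pair [(b, z)], the letters of [b] but the last are singleton segments, and the last opens
    the segment continued by [z]. Since [z] may be empty only at the end of the word, this reading
    of a segmentation is unique. *)
Lemma gan_cut3 B w A (c : word K -> K) : B [::] = 1 -> (forall x z, c (x :: z) = B (sh z x.2)) ->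
  w <> [::] ->
  cut3 w (fun b z r => if ~~ nilp b && (~~ nilp z || nilp r)
      then B (vflexl b z) * lin (gan c r) (fun u => A (uflexr b z ++ u)) else 0)
    = lin (gan c w) A.
Proof.
move=> B1 cB; elim: w A => // x w IHw A _.
rewrite lin_gan_cons cut3_cons cut0 !add0r.
have E1 r z : B (vflexl [:: x] z) * lin (gan c r) (fun u => A (uflexr [:: x] z ++ u))
    = c (x :: z) * lin (gan c r) (fun u => A (collapse (x :: z) :: u)).
  by rewrite cB; congr (_ * _); apply: eq_lin => u; rewrite collapse_cons.
case: w IHw => [|y w] IHw; first by rewrite /cut3 !cut_nil E1.
have := IHw (fun u => A (x :: u)); rewrite /cut3 cut_cons cut0 add0r => IH.
rewrite cut_cons addrC IH // cut_cons add0r [RHS]cut_cons cB B1 mul1r.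
congr (_ + _); first by apply: eq_lin => u; rewrite collapse1.
by apply: eq_cut => z r _; rewrite E1.
Qed.

Lemma ganit_gan n w A B (c : word K -> K) : B [::] = 1 -> (forall x z, c (x :: z) = B (sh z x.2)) ->
  (size w <= n)%N ->
  \sum_(e <- bcdecs_rec n w)
     A (flatten [seq uflexr t.1 t.2 | t <- e]) * \prod_(t <- e) B (vflexl t.1 t.2)
  = lin (gan c w) A.
Proof.
move=> B1 cB; elim: n w A => [|n IHn] [|x w] A lewn //.
- by rewrite /= big_seq1 big_nil lin_gan0 mulr1.
- by rewrite /= big_seq1 big_nil lin_gan0 mulr1.
rewrite -(gan_cut3 _ B1 cB) // -[bcdecs_rec _ _]/(flatten
  [seq [seq (t.1.1, t.1.2) :: e | e <- bcdecs_rec n t.2]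
     | t <- cuts3 (x :: w) & ~~ nilp t.1.1 && (~~ nilp t.1.2 || nilp t.2)]).
rewrite big_flatten big_map big_filter sum_cuts3; apply: eq_cut3 => a b d w_eq /=.
case: ifP => //; case: a w_eq => [|y a] w_eq //= _.
rewrite big_map -IHn; last first.
  by case: w_eq lewn => _ -> /=; rewrite !size_cat ltnS; lia.
rewrite mulr_sumr; apply: eq_bigr => s _.
by rewrite big_cons /=; ring.
Qed.

End Reindex.

(** * Transport of the word operations along ring morphisms *)

Section Transport.
Variables (K K' : comUnitRingType) (s : {rmorphism K -> K'}).
Variable P : word K -> Prop.
Hypothesis cP : closed_words P.
Implicit Types (a b c r w z : word K) (l x y : letter K).
Notation smap := (map (lmap s)).

Lemma cut_lmap w phi psi :
  (forall a b, w = a ++ b -> s (phi a b) = psi (smap a) (smap b)) ->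
  s (cut w phi) = cut (smap w) psi.
Proof.
elim: w phi psi => [|l w IHw] phi psi e; first by rewrite !cut_nil e.
rewrite [smap _]/= !cut_cons rmorphD e //=; congr (_ + _); apply: IHw => a b w_eq.
by rewrite e // w_eq.
Qed.

Lemma usum_lmap w : usum (smap w) = s (usum w).
Proof. by rewrite /usum big_map rmorph_sum. Qed.

Lemma sh_lmap w t : sh (smap w) (s t) = smap (sh w t).
Proof.
by rewrite /sh -!map_comp; apply: eq_map => l; rewrite /lmap /= rmorphB.
Qed.

Lemma mulm_lmap A B A' B' w : P w ->
  (forall z, P z -> s (A z) = A' (smap z)) ->
  (forall z, P z -> s (B z) = B' (smap z)) ->
  s (mulm A B w) = mulm A' B' (smap w).
Proof.
move=> Pw eA eB; apply: cut_lmap => a b w_eq; rewrite rmorphM.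
have Pa : P a by apply: (@cw_sub _ _ cP _ b) Pw; rewrite w_eq; perm_count.
have Pb : P b by apply: (@cw_sub _ _ cP _ a) Pw; rewrite w_eq; perm_count.
by rewrite eA ?eB.
Qed.

Lemma coder_edge_lmap A B A' B' w : P w ->
  (forall z, P z -> s (A z) = A' (smap z)) ->
  (forall z, P z -> s (B z) = B' (smap z)) ->
  s (coder (edge B) A w) = coder (edge B') A' (smap w).
Proof.
move=> Pw eA eB; apply: cut_lmap => a r w_eq; apply: cut_lmap => b c r_eq.
have Pb y p q v : b = p ++ y :: q -> v = y.2 ->
    s (A (a ++ (usum b, v) :: c)) = A' (smap a ++ (s (usum b), s v) :: smap c).
  move=> b_eq ->; rewrite eA ?map_cat //.
  have /(cw_letter cP) : P (rcons (p ++ q) y ++ a ++ c).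
    by apply: cw_perm Pw => //; rewrite w_eq r_eq b_eq; perm_count.
  rewrite (_ : usum (p ++ q) + y.1 = usum b); last first.
    by rewrite b_eq !usum_cat usum_cons; ring.
  by apply: (cw_perm cP); perm_count.
have Psh y z rest : perm_eq b (y :: z ++ rest) -> s (B (sh z y.2)) = B' (sh (smap z) (s y.2)).
  move=> e; rewrite sh_lmap eB //; apply: (cw_sh cP (l := y)).
  apply: (@cw_sub _ _ cP _ (a ++ c ++ rest)) Pw; apply/permP => o.
  move/permP: e => /(_ o); rewrite w_eq r_eq.
  by repeat first [rewrite count_cat | progress simpl]; lia.
rewrite !lin_edge rmorphB; congr (_ - _).
  rewrite !lin_edgeL; apply: cut_lmap => p q b_eq.
  case: q b_eq => [|y [|y' q]] b_eq; rewrite ?rmorph0 //=.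
  have be : usum p + y.1 = usum b by rewrite b_eq usum_cat usum_cons usum_nil addr0.
  rewrite rmorphM be (Pb y p [::]) //= usum_lmap -rmorphD be (Psh y p [::]) //.
  by rewrite b_eq; perm_count.
case: b Pb Psh {r_eq} => [|y z] Pb Psh; first by rewrite !lin_nil rmorph0.
rewrite !lin_seq1 /= rmorphM usum_lmap -rmorphD -usum_cons (Pb y [::] z) //.
by rewrite (Psh y z [::]) // cats0.
Qed.

Lemma gan_lmap A A' (c : word K -> K) (c' : word K' -> K') w : P w ->
  (forall z, P z -> s (A z) = A' (smap z)) ->
  (forall x z, P (x :: z) -> s (c (x :: z)) = c' (smap (x :: z))) ->
  s (lin (gan c w) A) = lin (gan c' (smap w)) A'.
Proof.
move=> Pw eA ec.
suff H p F F' : P (p ++ w) -> (forall z, P (p ++ z) -> s (F z) = F' (smap z)) ->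
    s (lin (gan c w) F) = lin (gan c' (smap w)) F' by apply: (H [::]).
elim/size_word_ind: w p F F' {Pw A A' eA} => -[|x w] IHw p F F' Pw eF.
  by rewrite !lin_gan0 eF.
rewrite [smap _]/= !lin_gan_cons; apply: cut_lmap => a b w_eq; rewrite rmorphM.
rewrite -[_ :: smap a]/(smap (x :: a)) ec; last first.
  by apply: (@cw_sub _ _ cP _ (p ++ b)) Pw; rewrite w_eq; perm_count.
congr (_ * _); apply: (IHw _ _ (rcons p (collapse (x :: a)))).
- by rewrite w_eq; apply: size_cat_ltS.
- by rewrite cat_rcons; apply: (cw_collapse cP); rewrite /= -w_eq.
move=> z; rewrite cat_rcons => /eF->; congr F' => /=.
by rewrite !collapse_cons /= usum_lmap -rmorphD.
Qed.

End Transport.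

Section Evaluation.
Variable R : comNzRingType.
Implicit Types A B M : bimould R.

Lemma good_unit d (w : word (ratfun R d)) l : good w -> l \in w -> l.2 \is a GRing.unit.
Proof.
move=> gw lw; have {gw} : good (l :: rem l w) by apply: good_perm gw; apply: perm_to_rem.
move=> gw; pose t : seq ({mpoly R[0]} * {mpoly R[0]}) := (0, 1) :: nseq (size (rem l w)) (0, 0).
have [|h /= [_ l2 _]] := gw 0%N t; first by rewrite /= size_nseq.
by apply: (spec_to_unit (f := 1) (h := h)) => //; apply: lreg1.
Qed.

Notation bv A := (@bval R A _).

(** The definition of [mu] concerns the generic word; the morphism [gsubst] carries it to any good
    word. [arit] and [ganit] follow the same scheme. *)
Lemma bval_mu A B d (w : word (ratfun R d)) : good w ->
  bval (mu A B) w = mulm (bv A) (bv B) w.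
Proof.
move=> gw; rewrite -[in RHS](map_lmap_gword gw erefl) -[LHS]/(gsubst gw erefl _).
by apply: (mulm_lmap (good_closed R _)); [exact: good_gword | move=> z gz; rewrite bval_map..].
Qed.

Lemma bval_arit A B d (w : word (ratfun R d)) : good w ->
  bval (arit B A) w = coder (edge (bv B)) (bv A) w.
Proof.
move=> gw; rewrite -[in RHS](map_lmap_gword gw erefl) -[LHS]/(gsubst gw erefl _).
rewrite /arit arit_coder.
by apply: (coder_edge_lmap (good_closed R _));
  [exact: good_gword | move=> z gz; rewrite bval_map..].
Qed.

Lemma bval_ganit A B d (c : word (ratfun R d) -> ratfun R d) w : good w ->
  (forall d', bval B ([::] : word (ratfun R d')) = 1) ->
  (forall x z, good (x :: z) -> c (x :: z) = bval B (sh z x.2)) ->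
  bval (ganit B A) w = lin (gan c w) (bv A).
Proof.
move=> gw B1 cB.
(* The weight [c] lives over one ring only; [cc] is uniform in [d'], as the transport between two
   rings requires. *)
pose cc d' (s : word (ratfun R d')) := if s is x :: z then bval B (sh z x.2) else 0.
transitivity (lin (gan (@cc d) w) (bv A)); last first.
  apply: (eq_lin_gan (good_closed R d) (p := [::]) (q := [::])) => [|l s gs|//].
    by rewrite cats0.
  by rewrite cB.
rewrite -[in RHS](map_lmap_gword gw erefl) -[LHS]/(gsubst gw erefl _).
rewrite /ganit (ganit_gan _ (c := @cc (size w))) // ?size_gword //; last exact: B1.
apply: (gan_lmap (good_closed R _)); first exact: good_gword.
  by move=> z gz; rewrite bval_map.
move=> x z gxz /=; rewrite sh_lmap bval_map //; exact: (cw_sh (good_closed R _)) gxz.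
Qed.

End Evaluation.

(** * Values of pic and poc at good words *)

Section PicPocValues.
Variable R : comNzRingType.

Lemma bval_nil0 (M : bimould R) d : M 0%N = 0 -> bval M ([::] : word (ratfun R d)) = 0.
Proof.
move=> M0; have g0 : good ([::] : word (ratfun R d)) by move=> N [|? ?] // _; exists (fun=> 0).
by rewrite -[LHS]/(gsubst g0 erefl (M 0%N)) M0 rmorph0.
Qed.

Lemma bval_nil1 (M : bimould R) d : M 0%N = 1 -> bval M ([::] : word (ratfun R d)) = 1.
Proof.
move=> M1; have g0 : good ([::] : word (ratfun R d)) by move=> N [|? ?] // _; exists (fun=> 0).
by rewrite -[LHS]/(gsubst g0 erefl (M 0%N)) M1 rmorph1.
Qed.

Lemma pic0 : @pic R 0%N = 1.
Proof. by rewrite /pic big_ord0 invr1. Qed.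

Lemma pic_star d : @pic R d = star 0 (gword R d).
Proof.
rewrite /pic -prodrV /star => [|i _]; last first.
  have := @good_unit R d (gword R d) (uvar R i, vvar R i) (@good_gword R d); apply.
  by apply/mapP; exists i; rewrite ?mem_enum.
by rewrite /gword big_map big_enum /=; apply: eq_bigr => i _; rewrite subr0.
Qed.

Lemma bval_pic d (w : word (ratfun R d)) : good w -> bval (pic R) w = star 0 w.
Proof.
move=> gw; rewrite -[in RHS](map_lmap_gword gw erefl) -[LHS]/(gsubst gw erefl _).
rewrite pic_star /star [RHS]big_map rmorph_prod; apply: eq_big_seq => l lin.
rewrite !subr0 rmorphV //; exact: (good_unit (@good_gword R _) lin).
Qed.

Lemma bval_pic_sh d (w : word (ratfun R d)) l : good (l :: w) ->
  bval (pic R) (sh w l.2) = star l.2 w.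
Proof.
move=> gw; rewrite bval_pic; last exact: (cw_sh (good_closed R d)) gw.
by rewrite /star big_map; apply: eq_bigr => m _; rewrite subr0.
Qed.

Lemma chain_prod d x (w : word (ratfun R d)) : good (x :: w) ->
  let v := vpart (x :: w) in
  (\prod_(i < size w) (v`_i - v`_i.+1) \is a GRing.unit)
  /\ (\prod_(i < size w) (v`_i - v`_i.+1))^-1 = chain x.2 w.
Proof.
elim: w x => [|y w IHw] x gw /=; first by rewrite big_ord0 unitr1 invr1.
have [uw IH] := IHw y (cw_behead (good_closed R d) gw).
have u := cw_unit (good_closed R d) gw.
by rewrite big_ord_recl /= unitrM u uw invrM // mulrC IH.
Qed.

Lemma poc_chain d : @poc R d = chain 0 (gword R d).
Proof.
rewrite /poc; case: d => [|d] /=; first by rewrite /gword enum_ord0.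
have gw := @good_gword R d.+1; have sw := size_gword R d.+1.
have -> : [seq vvar R i | i <- enum 'I_d.+1] = vpart (gword R d.+1).
  by rewrite /vpart /gword -[RHS]map_comp.
case: (gword R d.+1) gw sw => [|x w] //= gw [sw].
have [u <-] := chain_prod gw; rewrite sw in u *.
have ux : x.2 \is a GRing.unit by apply: (good_unit gw); rewrite inE eqxx.
by rewrite sub0r invrN invrM // mulNr mulrC.
Qed.

Lemma chain_lmap m d (s : {rmorphism ratfun R m -> ratfun R d}) x (z : word (ratfun R m)) :
  good (x :: z) -> s (chain x.2 z) = chain (s x.2) (map (lmap s) z).
Proof.
elim: z x => [|y z IHz] x gz /=; first exact: rmorph1.
rewrite rmorphM /= rmorphV ?rmorphB ?(cw_unit (good_closed R _) gz) //=.
by rewrite IHz //; exact: (cw_behead (good_closed R _)) gz.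
Qed.

Lemma bval_poc d (w : word (ratfun R d)) : good w -> bval (poc R) w = chain 0 w.
Proof.
move=> gw; rewrite -[in RHS](map_lmap_gword gw erefl) -[LHS]/(gsubst gw erefl _).
rewrite poc_chain.
case: (gword R (size w)) (@good_gword R (size w)) => [|x z] gz /=; first exact: rmorph1.
rewrite rmorphM (chain_lmap _ gz) /= rmorphV ?rmorphB ?rmorph0 //.
by rewrite sub0r unitrN (good_unit gz) // inE eqxx.
Qed.

Lemma poc0 : @poc R 0%N = 1.
Proof. by []. Qed.

Lemma chain_sh d t (w : word (ratfun R d)) : chain 0 (sh w t) = chain t w.
Proof.
have H u z : chain (u - t) (sh z t) = chain u z.
  by elim: z u => //= m z IHz u; rewrite IHz; congr (_^-1 * _); ring.
by rewrite -(H t) subrr.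
Qed.

Lemma bval_poc_sh d (w : word (ratfun R d)) l : good (l :: w) ->
  bval (poc R) (sh w l.2) = chain l.2 w.
Proof.
move=> gw; rewrite bval_poc ?chain_sh //.
exact: (cw_sh (good_closed R d)) gw.
Qed.

Lemma bval_ganit_pic M d (w : word (ratfun R d)) : good w ->
  bval (ganit (pic R) M) w = lin (gan cpic w) (@bval R M d).
Proof.
move=> gw; apply: bval_ganit => // [d'|x z gz]; first exact: bval_nil1 pic0.
by rewrite bval_pic_sh.
Qed.

Lemma bval_ganit_poc M d (w : word (ratfun R d)) : good w ->
  bval (ganit (poc R) M) w = lin (gan cpoc w) (@bval R M d).
Proof.
move=> gw; apply: bval_ganit => // [d'|x z gz]; first exact: bval_nil1 poc0.
by rewrite bval_poc_sh.
Qed.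

End PicPocValues.

(** * Lie algebra structure *)

Section FunctionalLie.
Variable K : comUnitRingType.
Implicit Types (A B C : word K -> K) (w : word K) (k : K).

Lemma coderP E k A B w :
  coder E (fun z => k * A z + B z) w = k * coder E A w + coder E B w.
Proof.
rewrite /coder -cut3Z -cut3D; apply: eq_cut3 => a s c _.
by rewrite linD linZ.
Qed.

Lemma coder_edgeP k A B C w :
  coder (edge (fun z => k * A z + B z)) C w = k * coder (edge A) C w + coder (edge B) C w.
Proof.
rewrite /coder -cut3Z -cut3D; apply: eq_cut3 => a s c _.
move: (fun l => C (a ++ l :: c)) => f.
have eL : lin (edgeL (fun z => k * A z + B z) s) f = k * lin (edgeL A s) f + lin (edgeL B s) f.
  rewrite !lin_edgeL -cutZ -cutD; apply: eq_cut => p q _.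
  by case: q => [|y [|? ?]]; rewrite ?mulr0 ?addr0 //; ring.
rewrite !lin_edge eL; case: s {eL} => [|x s]; first by rewrite !lin_nil; ring.
by rewrite !lin_seq1 /=; ring.
Qed.

Lemma mulmPl k A B C w :
  mulm (fun z => k * A z + B z) C w = k * mulm A C w + mulm B C w.
Proof. by rewrite /mulm -cutZ -cutD; apply: eq_cut => a b _; ring. Qed.

Lemma mulmPr k A B C w :
  mulm C (fun z => k * A z + B z) w = k * mulm C A w + mulm C B w.
Proof. by rewrite /mulm -cutZ -cutD; apply: eq_cut => a b _; ring. Qed.

Lemma arimP k A B C w :
  arim (fun z => k * A z + B z) C w = k * arim A C w + arim B C w.
Proof. by rewrite /arim coderP coder_edgeP mulmPl mulmPr; ring. Qed.

Lemma arim_split A B w :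
  arim A B w = -1 * (coder (edge A) B w + mulm B A w) + (coder (edge B) A w + mulm A B w).
Proof. by rewrite /arim; ring. Qed.

(** [coder_edge_comm] replaces the action of an inner bracket by a commutator and [coder_mulm]
    distributes over products. The cyclic sum then cancels by associativity of [mulm]. *)
Lemma arim_jacobi A B C w :
  arim A (arim B C) w + arim B (arim C A) w + arim C (arim A B) w = 0.
Proof.
have D1 E (F G : word K -> K) z : coder E (fun z => F z + G z) z = coder E F z + coder E G z.
  have := coderP E 1 F G z; rewrite mul1r => <-.
  by apply: coder_ext => u; rewrite mul1r.
have M1 (F G H : word K -> K) z : mulm (fun z => F z + G z) H z = mulm F H z + mulm G H z.
  by rewrite /mulm -cutD; apply: eq_cut => a b _; rewrite mulrDl.
have M2 (F G H : word K -> K) z : mulm H (fun z => F z + G z) z = mulm H F z + mulm H G z.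
  by rewrite /mulm -cutD; apply: eq_cut => a b _; rewrite mulrDr.
have X (F G H : word K -> K) : arim F (arim G H) w =
    coder (edge H) (coder (edge G) F) w - coder (edge G) (coder (edge H) F) w
    - (- (coder (edge F) (coder (edge G) H) w + mulm (coder (edge F) H) G w
           + mulm H (coder (edge F) G) w)
       + (coder (edge F) (coder (edge H) G) w + mulm (coder (edge F) G) H w
          + mulm G (coder (edge F) H) w))
    + (- (mulm F (coder (edge G) H) w + mulm F (mulm H G) w)
       + (mulm F (coder (edge H) G) w + mulm F (mulm G H) w)
       - (- (mulm (coder (edge G) H) F w + mulm (mulm H G) F w)
          + (mulm (coder (edge H) G) F w + mulm (mulm G H) F w))).
  rewrite {1}/arim -coder_edge_comm.
  have e : arim G H = fun z => -1 * (coder (edge G) H z + mulm H G z)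
      + (coder (edge H) G z + mulm G H z).
    by apply: funext => z; rewrite arim_split.
  by rewrite e coderP mulmPl mulmPr !D1 !M1 !M2 !coder_mulm; ring.
rewrite !X -!mulmA.
ring.
Qed.

Definition gpoc A w : K := lin (gan cpoc w) A.

Lemma urimE A B w : urim A B w = lin (gan cpic w) (arim (gpoc A) (gpoc B)).
Proof. by rewrite gan_cpic_arim. Qed.

Lemma gpoc_urim A B : gpoc (urim A B) = arim (gpoc A) (gpoc B).
Proof.
apply: funext => w; rewrite /gpoc; under eq_lin => z do rewrite urimE.
exact: gan_cpocK.
Qed.

Lemma urim_jacobi A B C w :
  urim A (urim B C) w + urim B (urim C A) w + urim C (urim A B) w = 0.
Proof.
rewrite !urimE !gpoc_urim -!linD -[RHS](lin0 (gan cpic w)).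
by apply: eq_lin => z; exact: arim_jacobi.
Qed.

Lemma urimC A B w : urim A B w = - urim B A w.
Proof. by rewrite /urim; ring. Qed.

Lemma urimP k A B C w :
  urim (fun z => k * A z + B z) C w = k * urim A C w + urim B C w.
Proof.
have e : gpoc (fun z => k * A z + B z) = fun z => k * gpoc A z + gpoc B z.
  by apply: funext => z; rewrite /gpoc linD linZ.
by rewrite !urimE e -linZ -linD; apply: eq_lin => z; rewrite arimP.
Qed.

Section Closed.
Variable P : word K -> Prop.
Hypothesis cP : closed_words P.

Lemma eq_arim A B A' B' w : P w -> (forall z, P z -> A z = A' z) ->
  (forall z, P z -> B z = B' z) -> arim A B w = arim A' B' w.
Proof.
move=> Pw eA eB.
(* Extensionality on [P] is the transport along the identity morphism. *)
have wE (z : word K) : map (lmap (@idfun K)) z = z.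
  by rewrite -[RHS]map_id; apply: eq_map => -[].
have H (F F' : word K -> K) : (forall z, P z -> F z = F' z) ->
    forall z, P z -> idfun (F z) = F' (map (lmap (@idfun K)) z).
  by move=> e z; rewrite wE; exact: e.
have eA' := H _ _ eA; have eB' := H _ _ eB.
have c1 := coder_edge_lmap (s := idfun) cP Pw eA' eB'.
have c2 := coder_edge_lmap (s := idfun) cP Pw eB' eA'.
have m1 := mulm_lmap (s := idfun) cP Pw eA' eB'.
have m2 := mulm_lmap (s := idfun) cP Pw eB' eA'.
by rewrite /= !wE in c1 c2 m1 m2; rewrite /arim c1 c2 m1 m2.
Qed.

Lemma eq_gan c A A' w : P w -> (forall z, P z -> A z = A' z) ->
  lin (gan c w) A = lin (gan c w) A'.
Proof.
move=> Pw eA; apply: (eq_lin_gan cP (p := [::]) (q := [::])) => // [|z]; rewrite cats0 //.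
by move=> + _; exact: eA.
Qed.

Lemma eq_urim A B A' B' w : P w -> (forall z, P z -> A z = A' z) ->
  (forall z, P z -> B z = B' z) -> urim A B w = urim A' B' w.
Proof.
move=> Pw eA eB; rewrite !urimE; apply: eq_gan => // z Pz.
by apply: eq_arim => // u Pu; apply: eq_gan.
Qed.

Lemma vanishes_urim A B : A [::] = 0 -> B [::] = 0 ->
  vanishes_on P stk A -> vanishes_on P stk B -> vanishes_on P stk (urim A B).
Proof.
move=> A0 B0 vA vB.
have -> : urim A B = fun w => lin (gan cpic w) (arim (gpoc A) (gpoc B)).
  by apply: funext => w; rewrite urimE.
apply: (vanishes_gan cP (cpic_letter cP)).
apply: (shuf_arim cP); rewrite /gpoc ?lin_gan0 //.
- exact: (vanishes_gan cP (cpoc_letter cP)).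
- exact: (vanishes_gan cP (cpoc_letter cP)).
Qed.

End Closed.
End FunctionalLie.

Section StuffleTransport.
Variables (K K' : comUnitRingType) (s : {rmorphism K -> K'}).
Variable P : word K -> Prop.
Hypothesis cP : closed_words P.
Notation smap := (map (lmap s)).

Lemma stuffle_lmap x y F F' : P (x ++ y) -> (forall z, P z -> s (F z) = F' (smap z)) ->
  s (lin (qsh stk x y) F) = lin (qsh stk (smap x) (smap y)) F'.
Proof.
move=> Pw eF.
suff H p G G' : P (p ++ x ++ y) -> (forall z, P (p ++ z) -> s (G z) = G' (smap z)) ->
    s (lin (qsh stk x y) G) = lin (qsh stk (smap x) (smap y)) G' by apply: (H [::]).
move=> {F F' Pw eF}; elim: x p y G G' => [|l x IHx] p y G G' Pw eG.
  by rewrite !lin_qsh0l eG.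
elim: y p G G' Pw eG => [|m y IHy] p G G' Pw eG.
  by rewrite !lin_qsh0r eG // -[l :: x]cats0.
rewrite [smap (l :: x)]/= [smap (m :: y)]/= !lin_qsh_cons.
have /andP[u _] := cw_unit2 cP Pw.
rewrite !rmorphD rmorphM rmorphB /stk rmorphV // rmorphB.
have ext k z : P (rcons p k ++ z) -> s (G (k :: z)) = G' (lmap s k :: smap z).
  by rewrite cat_rcons => /eG.
have Pm : P (rcons p (l.1 + m.1, l.2) ++ x ++ y).
  apply: (cw_perm cP) (cw_merge cP (l := l) (m := m) (w := p ++ x ++ y) _); first by perm_count.
  by apply: (cw_perm cP) Pw; perm_count.
have Pm' : P (rcons p (l.1 + m.1, m.2) ++ x ++ y).
  apply: (cw_perm cP) (cw_merge cP (l := m) (m := l) (w := p ++ x ++ y) _).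
    by rewrite addrC; perm_count.
  by apply: (cw_perm cP) Pw; perm_count.
congr (_ + _ + _ * (_ - _)).
- apply: (IHx (rcons p l)) => [|z]; [by rewrite cat_rcons | exact: ext].
- apply: (IHy (rcons p m)) => [|z]; last exact: ext.
  by apply: (cw_perm cP) Pw; perm_count.
- apply: (IHx (rcons p (l.1 + m.1, l.2))) => // z Pz.
  by rewrite ext // /lmap /= rmorphD.
apply: (IHx (rcons p (l.1 + m.1, m.2))) => // z Pz.
by rewrite ext // /lmap /= rmorphD.
Qed.

End StuffleTransport.

(** * The Lie algebra of alternil rational bimoulds *)

Section LieRat.
Variable R : comNzRingType.
Implicit Types (A B C M : bimould R) (k : R).
Notation bv A := (@bval R A _).

Lemma bimould_eqP A B : (forall d, bv A (gword R d) = bv B (gword R d)) -> A = B.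
Proof. by move=> e; apply: functional_extensionality_dep => d; rewrite -!bval_gword. Qed.

Lemma bvalP k A B d (w : word (ratfun R d)) : good w ->
  bval (k *: A + B) w = @pconst R d k * bval A w + bval B w.
Proof.
move=> gw; rewrite -[LHS]/(gsubst gw erefl (@pconst R _ k * A (size w) + B (size w))).
by rewrite rmorphD rmorphM /= gsubst_const.
Qed.

Lemma bvalB A B d (w : word (ratfun R d)) : good w ->
  bval (A - B) w = bval A w - bval B w.
Proof.
move=> gw; rewrite -[LHS]/(gsubst gw erefl (A (size w) - B (size w))).
exact: rmorphB.
Qed.

Lemma bvalD A B d (w : word (ratfun R d)) : good w ->
  bval (A + B) w = bval A w + bval B w.
Proof.
move=> gw; rewrite -[LHS]/(gsubst gw erefl (A (size w) + B (size w))).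
exact: rmorphD.
Qed.

Lemma bval0 d (w : word (ratfun R d)) : good w -> bval (0 : bimould R) w = 0.
Proof.
by move=> gw; rewrite -[LHS]/(gsubst gw erefl 0) rmorph0.
Qed.

Lemma bval_ari A B d (w : word (ratfun R d)) : good w ->
  bval (ari A B) w = arim (bv A) (bv B) w.
Proof.
move=> gw; rewrite /ari bvalD // bvalB // /lu bvalB //.
by rewrite !bval_arit // !bval_mu.
Qed.

Lemma bval_uri A B d (w : word (ratfun R d)) : good w ->
  bval (uri A B) w = urim (bv A) (bv B) w.
Proof.
move=> gw; rewrite bval_ganit_pic // urimE; apply: (eq_gan (good_closed R d)) => // z gz.
rewrite bval_ari //; apply: (eq_arim (good_closed R d)) => // u gu; exact: bval_ganit_poc.
Qed.

(** [alternil] tests generic words only. Substitution carries the test to all good words, since the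
    denominators of the stuffle are units there. *)
Lemma alternil_vanishes M d : alternil M -> vanishes_on (@good R d) stk (@bval R M d).
Proof.
move=> aM x y x0 y0 gxy; set w := x ++ y; pose g := gword R (size w).
have map_g : map (lmap (gsubst gxy erefl)) g = w := map_lmap_gword gxy erefl.
have gg : good (take (size x) g ++ drop (size x) g).
  by rewrite cat_take_drop; exact: good_gword.
have := stuffle_lmap (s := gsubst gxy erefl) (good_closed R (size w))
  (F := @bval R M (size w)) (F' := @bval R M d) gg.
rewrite map_take map_drop map_g take_size_cat // drop_size_cat // => <-.
  rewrite -[lin _ _]/(lcval M _) -stuffleE aM ?rmorph0 // /w size_cat.
  by case: (x) x0 => // ? ?; case: (y) y0 => // ? ? _ _ /=; lia.
by move=> z gz; rewrite bval_map.
Qed.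

Lemma vanishes_alternil M :
  (forall d, vanishes_on (@good R d) stk (@bval R M d)) -> alternil M.
Proof.
move=> vM d n /andP[n0 nd]; apply: vM; last by rewrite cat_take_drop; exact: good_gword.
  by move/(congr1 size); rewrite size_takel ?size_gword; case: (n) n0 nd => // n' _ /ltnW.
by move/(congr1 size)/eqP; rewrite size_drop size_gword subn_eq0 leqNgt nd.
Qed.

Lemma alternil_lin k A B : alternil A -> alternil B -> alternil (k *: A + B).
Proof.
move=> aA aB; apply: vanishes_alternil => d x y x0 y0 gxy.
rewrite (@lin_qsh_ext _ _ (good_closed R d) _ _ _ _
  (fun z => @pconst R d k * bval A z + bval B z)) //.
  by rewrite linD linZ !(alternil_vanishes _ x0 y0 gxy) // mulr0 addr0.
by move=> z gz; rewrite bvalP.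
Qed.

Lemma alternil0 : alternil (0 : bimould R).
Proof.
apply: vanishes_alternil => d x y x0 y0 gxy.
rewrite (@lin_qsh_ext _ _ (good_closed R d) _ _ _ _ (fun z => 0)) ?lin0 //.
exact: bval0.
Qed.

Lemma submodule_il_rat : submodule (@BARI_il_rat R).
Proof.
split; first by split; [|exact: alternil0].
move=> k A B [A0 aA] [B0 aB]; split; last exact: alternil_lin.
by rewrite /BARI_rat -[LHS]/(@pconst R 0%N k * A 0%N + B 0%N) A0 B0 mulr0 addr0.
Qed.

Lemma uri0 A B : uri A B 0%N = 0.
Proof.
rewrite -bval_gword bval_uri; last exact: good_gword.
rewrite (size0nil (size_gword R 0)) /urim /coder /cut3 /mulm !cut_nil !lin_nil.
by rewrite mulrC; ring.
Qed.

Lemma uri_il_rat A B : BARI_il_rat A -> BARI_il_rat B -> BARI_il_rat (uri A B).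
Proof.
move=> [A0 aA] [B0 aB]; split; first exact: uri0.
apply: vanishes_alternil => d x y x0 y0 gxy.
rewrite (@lin_qsh_ext _ _ (good_closed R d) _ _ _ _ (urim (bv A) (bv B))) //; last first.
  by move=> z gz; rewrite bval_uri.
apply: (vanishes_urim (good_closed R d)) => //.
- exact: bval_nil0.
- exact: bval_nil0.
- exact: alternil_vanishes.
- exact: alternil_vanishes.
Qed.

Lemma uri_linl k A B C : uri (k *: A + B) C = k *: uri A C + uri B C.
Proof.
apply: bimould_eqP => d; have gw := @good_gword R d.
move: (bval_uri A C gw) (bval_uri B C gw) (bval_uri (k *: A + B) C gw).
move: (uri A C) (uri B C) (uri (k *: A + B) C) => X Y Z eX eY ->.
rewrite (bvalP k X Y gw) eX eY -urimP.
by apply: (eq_urim (good_closed R d)) => // z gz; rewrite (bvalP k A B gz).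
Qed.

Lemma uri_skew A B : uri A B = - uri B A.
Proof.
apply: bimould_eqP => d; have gw := @good_gword R d.
move: (bval_uri A B gw) (bval_uri B A gw); move: (uri A B) (uri B A) => X Y eX eY.
by rewrite -[- Y]sub0r (bvalB 0 Y gw) (bval0 gw) sub0r eX eY urimC.
Qed.

Lemma uri_linr k A B C : uri C (k *: A + B) = k *: uri C A + uri C B.
Proof.
move: (uri_skew C A) (uri_skew C B) (uri_linl k A B C) (uri_skew C (k *: A + B)).
move: (uri C A) (uri C B) (uri A C) (uri B C) (uri C (k *: A + B)) (uri (k *: A + B) C).
by move=> X Y X' Y' Z Z' -> -> -> ->; rewrite opprD scalerN.
Qed.

Lemma uri_alt A : uri A A = 0.
Proof.
apply: bimould_eqP => d; have gw := @good_gword R d.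
by rewrite (bval_uri A A gw) (bval0 gw) /urim; ring.
Qed.

Lemma uri_jacobi A B C :
  uri A (uri B C) + uri B (uri C A) + uri C (uri A B) = 0.
Proof.
apply: bimould_eqP => d; have gw := @good_gword R d.
have e F G H : bval (uri F (uri G H)) (gword R d) = urim (bv F) (urim (bv G) (bv H)) (gword R d).
  rewrite (bval_uri F (uri G H) gw); apply: (eq_urim (good_closed R d)) => // z gz.
  exact: (bval_uri G H gz).
move: (e A B C) (e B C A) (e C A B).
move: (uri A (uri B C)) (uri B (uri C A)) (uri C (uri A B)) => X Y Z eX eY eZ.
by rewrite (bvalD (X + Y) Z gw) (bvalD X Y gw) eX eY eZ urim_jacobi (bval0 gw).
Qed.

Lemma lie_il_rat : lie_algebra (@BARI_il_rat R) (@uri R).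
Proof.
split.
- exact: submodule_il_rat.
- exact: uri_il_rat.
- by move=> k A B C _ _ _; exact: uri_linl.
- by move=> k A B C _ _ _; exact: uri_linr.
- by move=> A _; exact: uri_alt.
- by move=> A B C _ _ _; exact: uri_jacobi.
Qed.

End LieRat.

(** * Polynomial bimoulds *)

Section PolynomialValues.
Variables (R : comNzRingType) (d : nat).
Notation K := (ratfun R d).
Notation A0 := {mpoly R[d + d]}.
Implicit Types (x y : K) (w : word K) (M : bimould R).

Definition ispol x : Prop := exists p, x = polfun p.

Lemma ispol_polfun p : ispol (polfun p). Proof. by exists p. Qed.

Lemma ispolD x y : ispol x -> ispol y -> ispol (x + y).
Proof. by move=> [p ->] [q ->]; exists (p + q); rewrite /polfun rmorphD. Qed.

Lemma ispolN x : ispol x -> ispol (- x).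
Proof. by move=> [p ->]; exists (- p); rewrite /polfun rmorphN. Qed.

Lemma ispolM x y : ispol x -> ispol y -> ispol (x * y).
Proof. by move=> [p ->] [q ->]; exists (p * q); rewrite /polfun rmorphM. Qed.

Lemma ispol0 : ispol 0.
Proof. by exists 0; rewrite /polfun rmorph0. Qed.

Lemma ispolX x n : ispol x -> ispol (x ^+ n).
Proof. by move=> [p ->]; exists (p ^+ n); rewrite /polfun rmorphXn. Qed.

Lemma ispol_sign n : ispol ((-1) ^+ n).
Proof. by apply: ispolX; apply: ispolN; exists 1; rewrite /polfun rmorph1. Qed.

Lemma ispol_cut w f : (forall a b, w = a ++ b -> ispol (f a b)) -> ispol (cut w f).
Proof.
elim: w f => [|l w IHw] f pf; first by rewrite cut_nil; exact: pf.
rewrite cut_cons; apply: ispolD; first exact: pf.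
by apply: IHw => a b w_eq; apply: pf; rewrite w_eq.
Qed.

Fixpoint polw w : Prop := if w is l :: w' then [/\ ispol l.1, ispol l.2 & polw w'] else True.

Lemma polw_cat w w' : polw (w ++ w') <-> polw w /\ polw w'.
Proof.
elim: w => [|l w IHw] /=; first by tauto.
by split=> [[? ? /IHw[]]|[[? ? ?] ?]] //; split=> //; apply/IHw.
Qed.

Lemma polw_usum w : polw w -> ispol (usum w).
Proof.
elim: w => [_|l w IHw /= [l1 _ /IHw pw]]; first by rewrite usum_nil; exact: ispol0.
by rewrite usum_cons; apply: ispolD.
Qed.

Lemma polw_sh w x : ispol x -> polw w -> polw (sh w x).
Proof.
move=> px; elim: w => //= l w IHw [l1 l2 /IHw pw]; split=> //.
by apply: ispolD => //; exact: ispolN.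
Qed.

Lemma polw_nth w i : polw w -> ispol (nth (0, 0) w i).1 /\ ispol (nth (0, 0) w i).2.
Proof.
elim: w i => [|l w IHw] [|i] /=; try by move=> *; split; exact: ispol0.
  by case.
by case=> _ _; exact: IHw.
Qed.

Lemma polw_gword : polw (gword R d).
Proof.
rewrite /gword; elim: (enum _) => //= i s IHs; split=> //; exact: ispol_polfun.
Qed.

Lemma bval_polfun M w p : good w -> M (size w) = polfun p -> bval M w = psubst w p.
Proof.
by move=> gw Mp; rewrite -[LHS]/(gsubst gw erefl (M (size w))) Mp gsubst_polfun.
Qed.

Lemma ispol_psubst m w (p : {mpoly R[m + m]}) : polw w -> ispol (psubst w p).
Proof.
move=> pw; rewrite /psubst /mmap; apply: big_ind => [||k _]; [exact: ispol0|exact: ispolD|].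
apply: ispolM; first exact: ispol_polfun.
rewrite /mmap1; apply: big_ind => [||i _]; [by exists 1; rewrite /polfun rmorph1|exact: ispolM|].
by apply: ispolX; case: (split i) => j; have [] := polw_nth j pw.
Qed.

Lemma ispol_bval M w : good w -> polw w ->
  (forall n, exists p : {mpoly R[n + n]}, M n = polfun p) -> ispol (bval M w).
Proof.
move=> gw pw Mp; have [p Mp'] := Mp (size w).
by rewrite (bval_polfun gw Mp'); exact: ispol_psubst.
Qed.

Lemma size_divX (f : {poly A0}) u : exists h : {poly A0},
  (size h <= (size f).-1)%N /\ forall q, f.[u] - f.[q] = h.[q] * (u - q).
Proof.
have /factor_theorem[h hE] : root (f - f.[u]%:P) u by rewrite /root !hornerE subrr.
exists h; split=> [|q].
  have [->|h0] := eqVneq h 0; first by rewrite size_poly0.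
  have szh : size (f - f.[u]%:P) = (size h).+1.
    by rewrite hE (size_Mmonic h0 (monicXsubC u)) size_XsubC addn2.
  have : (size (f - f.[u]%:P)%R <= maxn (size f) 1)%N.
    rewrite (leq_trans (size_polyD _ _)) // size_polyN geq_max leq_maxl /=.
    by rewrite (leq_trans (size_polyC_leq1 _)) // leq_maxr.
  rewrite szh; have : (0 < size h)%N by rewrite size_poly_gt0.
  by case: (size f) => [|[|n]]; case: (size h) => //= n' _; lia.
have := congr1 (horner^~ q) hE; rewrite /= !hornerE => e.
by rewrite -[LHS]opprB e; ring.
Qed.

(** Each node divides a difference of values exactly and lowers the size by one, so [h] is zero once
    there are at least [size f] nodes in [us]. Agreement of [g] with [f] is asked at the nodes only,
    where [B] can be evaluated. *)
Lemma divdiff_poly (g : K -> K) (us : seq A0) (f : {poly A0}) :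
  exists h : {poly A0}, (size h <= size f - size us)%N /\ forall q,
    (forall q', q' \in q :: us -> g (polfun q') = polfun f.[q']) ->
    pairwise (fun q q' => polfun (q' - q) \is a GRing.unit) (q :: us) ->
    divdiff g (polfun q) (map (@polfun R d) us) = polfun h.[q].
Proof.
elim: us f => [|u us IHus] f.
  by exists f; rewrite subn0; split=> // q gq _; rewrite /= gq // inE eqxx.
have [h' [szh' h'E]] := IHus f; have [h [szh hE]] := size_divX h' u.
exists h; split=> [|q gq /= /and3P[/andP[uq qus] uus usus]].
  by rewrite (leq_trans szh) // [size (u :: us)]/= subnS -!subn1 leq_sub2r.
rewrite h'E ?h'E /=; first last.
- by rewrite uus.
- by move=> q' q'in; apply: gq; rewrite inE q'in orbT.
- by rewrite qus.
- move=> q' q'in; apply: gq; move: q'in; rewrite !inE.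
  by case/orP=> ->; rewrite ?orbT.
have -> : polfun u - polfun q = polfun (u - q) by rewrite /polfun rmorphB.
have -> : polfun h'.[u] - polfun h'.[q] = polfun (u - q) * polfun h.[q].
  by rewrite /polfun -rmorphB -rmorphM hE mulrC.
by rewrite mulKr.
Qed.

End PolynomialValues.

Section ShiftPolynomial.
Variables (R : comNzRingType) (d : nat).
Notation K := (ratfun R d).
Notation A0 := {mpoly R[d + d]}.
Implicit Types (x y : K) (w : word K) (M : bimould R).

(** Each variable is replaced by a polynomial of degree at most 1, so the degree is bounded by the
    total degree of [p]; both sizes are degree plus one. *)
Lemma size_mmap_poly m (c : {rmorphism R -> A0}) (H : 'I_m -> {poly A0}) (p : {mpoly R[m]}) :
  (forall i, (size (H i) <= 2)%N) -> (size (mmap (polyC \o c) H p) <= msize p)%N.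
Proof.
move=> H2; rewrite /mmap big_seq; apply: (big_ind (fun f : {poly A0} => (size f <= msize p)%N)).
- by rewrite size_poly0.
- by move=> f g szf szg; rewrite (leq_trans (size_polyD _ _)) // geq_max szf.
move=> k kp; rewrite /= mul_polyC (leq_trans (size_scale_leq _ _)) //.
apply: leq_trans (msize_mdeg_lt kp); rewrite /mmap1.
rewrite (leq_trans (size_poly_prod_leq _ _)) // card_ord mdegE leq_subLR addnS ltnS.
have -> : (m + \sum_(i < m) k i = \sum_(i < m) (1 + k i))%N.
  by rewrite big_split /= sum1_card card_ord.
apply: leq_sum => i _; rewrite (leq_trans (size_poly_exp_leq _ _)) // add1n ltnS.
by rewrite -[X in (_ <= X)%N]mul1n leq_mul2r; apply/orP; right; have := H2 i; case: (size (H i)).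
Qed.

Lemma polw_lift w : polw w -> exists P : seq (A0 * A0), w = [seq (polfun a.1, polfun a.2) | a <- P].
Proof.
elim: w => [|[x y] w IHw] /=; first by exists [::].
by case=> [[p ->] [q ->] /IHw[P ->]]; exists ((p, q) :: P).
Qed.

Lemma bval_sh_poly M w (p : {mpoly R[size w + size w]}) : polw w -> M (size w) = polfun p ->
  exists2 f : {poly A0}, (size f <= msize p)%N &
    forall q, good (sh w (polfun q)) -> bval M (sh w (polfun q)) = polfun f.[q].
Proof.
move=> /polw_lift[P wE] Mp.
pose H (k : 'I_(size w + size w)) : {poly A0} := match split k with
  | inl i => ((nth (0, 0) P i).1)%:P
  | inr i => ((nth (0, 0) P i).2)%:P - 'X end.
exists (mmap (polyC \o @mpolyC (d + d) R) H p).
  apply: size_mmap_poly => k; rewrite /H; case: (split k) => i.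
    by rewrite (leq_trans (size_polyC_leq1 _)).
  rewrite (leq_trans (size_polyD _ _)) // size_polyN size_polyX geq_max andbT.
  by rewrite (leq_trans (size_polyC_leq1 _)).
move=> q gq; rewrite (@bval_size _ _ _ _ (size w)) ?size_map //.
have ssh : size (sh w (polfun q)) = size w by rewrite size_map.
rewrite -[LHS]/(gsubst gq ssh (M (size w))) Mp gsubst_polfun /psubst /mmap.
rewrite horner_sum /polfun rmorph_sum; apply: eq_bigr => k _.
rewrite /= hornerM hornerC rmorphM; congr (_ * _).
rewrite /mmap1 horner_prod rmorph_prod; apply: eq_bigr => i _.
rewrite horner_exp rmorphXn; congr (_ ^+ _); rewrite /H.
have szP : size P = size w by rewrite wE size_map.
case: (split i) => j; rewrite (nth_map (0, 0)) // [X in nth _ X]wE (nth_map (0, 0)) ?szP //=.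
  by rewrite hornerC.
by rewrite !hornerE /polfun rmorphB.
Qed.

End ShiftPolynomial.

Ltac perm_count_from e :=
  let o := fresh "o" in
  apply/permP => o; move/permP: (e) => /(_ o); rewrite -?cats1;
  repeat first [rewrite count_cat | progress simpl]; lia.

Lemma urim_eq0 (K : comUnitRingType) (A B : word K -> K) w :
  coder (edgeU B) A w = 0 -> coder (edgeU A) B w = 0 ->
  mulm A B w = 0 -> mulm B A w = 0 -> urim A B w = 0.
Proof. by rewrite /urim => -> -> -> ->; rewrite !subrr addr0. Qed.

(** * Polynomiality and finite depth of the bracket *)

Section PolClosure.
Variable R : comNzRingType.
Implicit Types A B M : bimould R.
Notation bv M := (@bval R M _).

Lemma bval_degree M N d (w : word (ratfun R d)) : (forall n, (N < n)%N -> M n = 0) ->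
  good w -> (N < size w)%N -> bval M w = 0.
Proof.
by move=> M0 gw Nw; rewrite -[LHS]/(gsubst gw erefl (M (size w))) M0 // rmorph0.
Qed.

Lemma good_pairwise d (w : word (ratfun R d)) : good w ->
  pairwise (fun x y => y - x \is a GRing.unit) (vpart w).
Proof.
elim: w => //= l w IHw gw; rewrite IHw ?andbT; last exact: (cw_behead (good_closed R d)) gw.
apply/allP => _ /mapP[m mw ->]; apply: (cw_unit (good_closed R d) (w := rem m w)).
by apply: good_perm gw; perm_count_from (perm_to_rem mw).
Qed.

Section Divdiff.
Variables (B : bimould R) (N D : nat).
Hypothesis Bpol : forall n, (n <= N)%N -> exists2 p, B n = polfun p & (msize p <= D)%N.
Hypothesis B0 : forall n, (N < n)%N -> B n = 0.
Variable d : nat.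
Implicit Types (a c p y z s w : word (ratfun R d)) (x l : letter (ratfun R d)).

Lemma divdiff_pol x p y z : good (x :: p ++ y ++ z) -> polw (x :: p ++ y ++ z) ->
  let v := divdiff (fun u => bv B (sh y u)) x.2 (vpart (p ++ z)) in
  ispol v /\ ((N < size y)%N || (D <= size p)%N -> v = 0).
Proof.
move=> gw pw v.
have [x1 x2 /polw_cat[pp /polw_cat[py pz]]] := pw.
(* Beyond depth [N] the choice [q = 0] turns both vanishing conditions into the single bound
   [msize q <= size p]. *)
have [q By szq] : exists2 q, B (size y) = polfun q &
    ((N < size y)%N || (D <= size p)%N -> (msize q <= size p)%N).
  case: (leqP (size y) N) => [/Bpol[q Bq szq]|/B0 Bq].
    by exists q => // Dp; exact: leq_trans szq Dp.
  by exists 0; rewrite ?msize0 // Bq /polfun rmorph0.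
have [f szf fE] := bval_sh_poly py By.
have [us usE] : exists us, vpart (p ++ z) = map (@polfun R d) us.
  have : polw (p ++ z) by apply/polw_cat.
  by move=> /polw_lift[P ->]; exists (map snd P); rewrite /vpart -!map_comp.
have [qx xE] := x2.
have [h [szh hE]] := divdiff_poly (fun u => bv B (sh y u)) us f.
have vE : v = polfun h.[qx].
  rewrite /v usE xE; apply: hE => [q' q'in|].
    apply: fE; have : polfun q' \in vpart (x :: p ++ z).
      by rewrite [vpart _]/= usE xE -map_cons; apply: map_f.
    case/mapP => l lin ->; apply: (cw_sh (good_closed R d)).
    apply: (@cw_sub _ _ (good_closed R d) _ (rem l (x :: p ++ z))) gw.
    by perm_count_from (perm_to_rem lin).
  have : good (x :: p ++ z) by apply: (@cw_sub _ _ (good_closed R d) _ y) gw; perm_count.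
  move/good_pairwise; rewrite [vpart _]/= usE xE -map_cons pairwise_map.
  by apply: sub_pairwise => u u' /=; rewrite /polfun -rmorphB.
split; first by rewrite vE; exact: ispol_polfun.
move=> /szq szp; rewrite vE; suff -> : h = 0 by rewrite horner0 /polfun rmorph0.
apply/eqP; rewrite -size_poly_leq0 (leq_trans szh) // leqn0 subn_eq0.
rewrite (leq_trans szf) // (leq_trans szp) // -(size_map (@polfun R d)) -usE.
by rewrite size_map size_cat leq_addr.
Qed.

(** A nonzero term needs [size y <= N], [size p < D] and [size z <= 1], hence at most [N + D]
    letters. *)
Lemma ucoef_pol x s : good (x :: s) -> polw (x :: s) ->
  ispol (ucoef (bv B) x.2 s) /\ ((N + D < size s)%N -> ucoef (bv B) x.2 s = 0).
Proof.
move=> gw pw; split=> [|szs].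
  apply: ispol_cut => p r s_eq; apply: ispol_cut => y z r_eq; case: ifP => _; last exact: ispol0.
  apply: ispolM; first exact: ispol_sign.
  by have [||//] := @divdiff_pol x p y z; rewrite -r_eq -s_eq.
apply: cut_eq0 => p r s_eq; apply: cut_eq0 => y z r_eq; case: ifP => // szz.
have [||_ ->] := @divdiff_pol x p y z; rewrite -?r_eq -?s_eq ?mulr0 //.
move: szs; rewrite s_eq r_eq !size_cat => szs.
by case: (leqP (size y) N) => //= szy; rewrite leqNgt; apply/negP => szp; lia.
Qed.

End Divdiff.

Section Coder.
Variables (A B : bimould R) (N D : nat).
Hypothesis Apol : forall n, exists p : {mpoly R[n + n]}, A n = polfun p.
Hypothesis Bpol : forall n, exists p : {mpoly R[n + n]}, B n = polfun p.
Hypothesis BD : forall n, (n <= N)%N -> exists2 p, B n = polfun p & (msize p <= D)%N.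
Hypothesis A0 : forall n, (N < n)%N -> A n = 0.
Hypothesis B0 : forall n, (N < n)%N -> B n = 0.
Variable d : nat.
Implicit Types (a c p q y z s w : word (ratfun R d)) (x l : letter (ratfun R d)).

Lemma mulm_pol w : good w -> polw w ->
  ispol (mulm (bv A) (bv B) w) /\ ((N + N < size w)%N -> mulm (bv A) (bv B) w = 0).
Proof.
move=> gw pw.
have ga a c : w = a ++ c -> good a /\ good c.
  move=> w_eq; split.
    by apply: (@cw_sub _ _ (good_closed R d) _ c) gw; rewrite w_eq; perm_count.
  by apply: (@cw_sub _ _ (good_closed R d) _ a) gw; rewrite w_eq; perm_count.
split=> [|szw].
  apply: ispol_cut => a c w_eq; have [? ?] := ga _ _ w_eq; rewrite w_eq in pw.
  by have [? ?] := (polw_cat a c).1 pw; apply: ispolM; apply: ispol_bval.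
apply: cut_eq0 => a c w_eq; have [? ?] := ga _ _ w_eq.
case: (leqP (size a) N) => sza; last by rewrite (bval_degree A0) ?mul0r.
rewrite (bval_degree B0) ?mulr0 //; move: szw; rewrite w_eq size_cat; lia.
Qed.

(** A nonzero value needs at most [N] letters in [a ++ l :: c] and at most [N + D + 1] in [s], so at
    most [N + N + D] in all; the added 2 is slack. *)
Lemma edgeU_pol a s c : good (a ++ s ++ c) -> polw (a ++ s ++ c) ->
  let v := lin (edgeU (bv B) s) (fun l => bv A (a ++ l :: c)) in
  ispol v /\ ((N + N + D + 2 < size (a ++ s ++ c))%N -> v = 0).
Proof.
move=> gw pw v; rewrite /v lin_edgeU lin_edgeL.
have [pa /polw_cat[ps pc]] := (polw_cat a (s ++ c)).1 pw.
have gA x s1 s2 : s = s1 ++ x :: s2 -> good (a ++ (usum s, x.2) :: c).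
  move=> s_eq; have us : usum s = usum (s1 ++ s2) + x.1.
    by rewrite s_eq !usum_cat usum_cons; ring.
  rewrite us.
  apply: (cw_perm (good_closed R d)) (_ : good ((usum (s1 ++ s2) + x.1, x.2) :: a ++ c)).
    by perm_count.
  apply: (cw_letter (good_closed R d)); apply: (cw_perm (good_closed R d)) gw.
  by rewrite s_eq; perm_count.
have pA x s1 s2 : s = s1 ++ x :: s2 -> polw (a ++ (usum s, x.2) :: c).
  move=> s_eq; apply/polw_cat; split=> //; split=> //=; first exact: polw_usum.
  by move: ps; rewrite s_eq => /polw_cat[_ []].
have zA x s1 s2 : s = s1 ++ x :: s2 -> (N < size a + (size c).+1)%N ->
    bv A (a ++ (usum s, x.2) :: c) = 0.
  by move=> s_eq ?; apply: (bval_degree A0); [exact: gA s_eq | rewrite size_cat].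
have iA x s1 s2 : s = s1 ++ x :: s2 -> ispol (bv A (a ++ (usum s, x.2) :: c)).
  by move=> s_eq; apply: ispol_bval => //; [exact: gA s_eq | exact: pA s_eq].
have usE p x : s = p ++ [:: x] -> usum p + x.1 = usum s.
  by move->; rewrite usum_cat usum_cons usum_nil addr0.
have gB p x : s = p ++ [:: x] -> good (sh p x.2).
  move=> s_eq; apply: (cw_sh (good_closed R d)).
  by apply: (@cw_sub _ _ (good_closed R d) _ (a ++ c)) gw; rewrite s_eq; perm_count.
split=> [|szw].
  apply: ispolD.
    apply: ispol_cut => p [|x [|? ?]] s_eq; try exact: ispol0.
    rewrite (usE _ _ s_eq); apply: ispolM; last exact: iA s_eq.
    move: ps; rewrite s_eq => /polw_cat[pp [_ px _]].
    by apply: ispol_bval => //; [exact: gB | exact: polw_sh].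
  apply: ispolN; case: s ps gw {pw} gA pA zA iA usE gB @v =>
    [|x s] ps gw gA pA zA iA usE gB v; first exact: ispol0.
  apply: ispolM; last exact: (iA x [::] s).
  have [] // := ucoef_pol BD B0 (x := x) (s := s).
  by apply: (@cw_sub _ _ (good_closed R d) _ (a ++ c)) gw; perm_count.
rewrite cut_eq0 ?sub0r => [|p [|x [|? ?]] s_eq] //; last first.
  rewrite (usE _ _ s_eq); case: (leqP (size p) N) => szp.
    rewrite (zA _ _ _ s_eq) ?mulr0 //.
    by move: szw; rewrite s_eq !size_cat /=; lia.
  by rewrite (bval_degree B0) ?mul0r ?size_map //; exact: gB.
case: s ps gw szw {pw} gA pA zA iA usE gB @v =>
  [|x s] ps gw szw gA pA zA iA usE gB v; first exact: oppr0.
case: (leqP (size s) (N + D)) => szs.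
  rewrite (zA x [::] s) ?mulr0 ?oppr0 //.
  by move: szw; rewrite !size_cat /=; lia.
have [||_ ->] // := ucoef_pol BD B0 (x := x) (s := s); last by rewrite mul0r oppr0.
by apply: (@cw_sub _ _ (good_closed R d) _ (a ++ c)) gw; perm_count.
Qed.

Lemma coder_pol w : good w -> polw w ->
  ispol (coder (edgeU (bv B)) (bv A) w)
  /\ ((N + N + D + 2 < size w)%N -> coder (edgeU (bv B)) (bv A) w = 0).
Proof.
move=> gw pw; split=> [|szw].
  apply: ispol_cut => a r w_eq; apply: ispol_cut => s c r_eq.
  by have [||] // := @edgeU_pol a s c; rewrite -r_eq -w_eq.
apply: cut_eq0 => a r w_eq; apply: cut_eq0 => s c r_eq.
by have [||_ ->] // := @edgeU_pol a s c; rewrite -r_eq -w_eq.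
Qed.

End Coder.

Lemma pol_bound B : BARI_pol B -> exists N, (forall n, (N < n)%N -> B n = 0)
  /\ forall m, exists D, forall n, (n <= m)%N -> exists2 p, B n = polfun p & (msize p <= D)%N.
Proof.
move=> [_ Bp [N B0]]; exists N; split=> //; elim=> [|m [D IH]].
  have [p Bp0] := Bp 0%N; exists (msize p) => n; rewrite leqn0 => /eqP->.
  by exists p.
have [p Bpm] := Bp m.+1; exists (maxn D (msize p)) => n; rewrite leq_eqVlt => /orP[/eqP->|].
  by exists p => //; exact: leq_maxr.
by rewrite ltnS => /IH[q Bq szq]; exists q => //; rewrite (leq_trans szq) // leq_maxl.
Qed.

Lemma uri_pol A B : BARI_pol A -> BARI_pol B -> BARI_pol (uri A B).
Proof.
move=> Ap Bp; have [NA [A0 AD]] := pol_bound Ap; have [NB [B0 BD]] := pol_bound Bp.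
have [_ pA _] := Ap; have [_ pB _] := Bp.
pose N := maxn NA NB; have [DA AD'] := AD N; have [DB BD'] := BD N.
have A0' n : (N < n)%N -> A n = 0 by rewrite gtn_max => /andP[/A0].
have B0' n : (N < n)%N -> B n = 0 by rewrite gtn_max => /andP[_ /B0].
have uE d : uri A B d = urim (bv A) (bv B) (gword R d).
  by rewrite -bval_uri ?bval_gword //; exact: good_gword.
have gw d := @good_gword R d; have pw d := polw_gword R d.
split; first exact: uri0.
  move=> d; rewrite uE.
  have [c1 _] := coder_pol pA pB BD' A0' B0' (gw d) (pw d).
  have [c2 _] := coder_pol pB pA AD' B0' A0' (gw d) (pw d).
  have [m1 _] := mulm_pol pA pB A0' B0' (gw d) (pw d).
  have [m2 _] := mulm_pol pB pA B0' A0' (gw d) (pw d).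
  by apply: ispolD; apply: ispolD => //; apply: ispolN.
(* The sum [DA + DB] gives one bound that dominates those of both coderivations. *)
exists (N + N + (DA + DB) + 2)%N => d szd; rewrite uE.
have [_ c1] := coder_pol pA pB BD' A0' B0' (gw d) (pw d).
have [_ c2] := coder_pol pB pA AD' B0' A0' (gw d) (pw d).
have [_ m1] := mulm_pol pA pB A0' B0' (gw d) (pw d).
have [_ m2] := mulm_pol pB pA B0' A0' (gw d) (pw d).
have szw k : (k <= N + N + (DA + DB) + 2)%N -> (k < size (gword R d))%N.
  by rewrite size_gword => /leq_ltn_trans; apply.
have e1 : coder (edgeU (bv B)) (bv A) (gword R d) = 0 by apply: c1; apply: szw; lia.
have e2 : coder (edgeU (bv A)) (bv B) (gword R d) = 0 by apply: c2; apply: szw; lia.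
have e3 : mulm (bv A) (bv B) (gword R d) = 0 by apply: m1; apply: szw; lia.
have e4 : mulm (bv B) (bv A) (gword R d) = 0 by apply: m2; apply: szw; lia.
exact: (urim_eq0 e1 e2 e3 e4).
Qed.

Lemma submodule_il_pol : submodule (@BARI_il_pol R).
Proof.
split.
  split; last exact: alternil0.
  split=> //; last by exists 0%N.
  by move=> d; exists 0; rewrite /polfun rmorph0.
move=> k A B [Ap aA] [Bp aB]; split; last exact: alternil_lin.
have [A00 pA [NA A0]] := Ap; have [B00 pB [NB B0]] := Bp.
have E d : (k *: A + B) d = @pconst R d k * A d + B d by [].
split.
- by rewrite E A00 B00 mulr0 addr0.
- move=> d; rewrite E; have [p ->] := pA d; have [q ->] := pB d.
  by exists (k%:MP * p + q); rewrite /pconst /polfun rmorphD rmorphM.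
exists (maxn NA NB) => d; rewrite gtn_max E => /andP[/A0-> /B0->].
by rewrite mulr0 addr0.
Qed.

End PolClosure.

Theorem theorem1p3 (R : comAlgType rat) :
  lie_subalgebra (@BARI_il_pol R) (@BARI_il_rat R) (@uri R).
Proof.
split.
- exact: lie_il_rat.
- by move=> A [[A0 _ _] aA].
- exact: submodule_il_pol.
move=> A B [Ap aA] [Bp aB]; split; first exact: uri_pol.
have [A0 _ _] := Ap; have [B0 _ _] := Bp.
by have [] := @uri_il_rat R A B (conj A0 aA) (conj B0 aB).
Qed.
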